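(* Let $d\geq 1$, $2<p<q<\infty$, $1\leq\theta\leq\infty$, $r>d/2$. Then, for $m\in\mathbb{N}$, $$ e_m(B^{r}_{p,\theta})_{B_{q,1}}\asymp m^{-\frac{r}{d}}. $$
   Context: $\mathbb{T}^d=[0,2\pi)^d$; $L_p(\mathbb{T}^d)$ is the space of functions $2\pi$-periodic in each variable with norm $\|f\|_p=\big((2\pi)^{-d}\int_{\mathbb{T}^d}|f|^p\big)^{1/p}$ ($1\le p<\infty$), $\|f\|_\infty=\operatorname{ess\,sup}|f|$. For $\boldsymbol h\in\mathbb{R}^d$, $\Delta_{\boldsymbol h}f(\boldsymbol x)=f(\boldsymbol x+\boldsymbol h)-f(\boldsymbol x)$, $\Delta^k_{\boldsymbol h}=\Delta_{\boldsymbol h}\Delta^{k-1}_{\boldsymbol h}$, and $\omega_k(f,t)_p=\sup_{|\boldsymbol h|\le t}\|\Delta^k_{\boldsymbol h}f\|_p$ (Euclidean $|\boldsymbol h|$). For $r>0$, $1\le p,\theta\le\infty$ and a fixed integer $k>r$, the Nikol'skii–Besov space $B^r_{p,\theta}$ consists of $f\in L_p(\mathbb{T}^d)$ with finite norm $\|f\|_{B^r_{p,\theta}}=\|f\|_p+\big(\int_0^\infty (t^{-r}\omega_k(f,t)_p)^\theta\,\frac{dt}{t}\big)^{1/\theta}$ for $\theta<\infty$, and $\|f\|_p+\sup_{t>0}t^{-r}\omega_k(f,t)_p$ for $\theta=\infty$; the class $B^r_{p,\theta}$ denotes its unit ball $\{f:\|f\|_{B^r_{p,\theta}}\le1\}$.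 Let $V_l(t)=l^{-1}\sum_{k=l}^{2l-1}D_k(t)$ with $D_k(t)=\sum_{|j|\le k}e^{ijt}$ be the de la Vallée-Poussin kernel, $V_l(\boldsymbol x)=\prod_{j=1}^dV_l(x_j)$, $V_l(f)=f*V_l$. Set $\sigma_0(f)=V_1(f)$ and $\sigma_s(f)=V_{2^s}(f)-V_{2^{s-1}}(f)$ for $s\in\mathbb{N}$. For $1\le q\le\infty$, $B_{q,1}$ is the space of $f\in L_q(\mathbb{T}^d)$ with $\|f\|_{B_{q,1}}:=\sum_{s\ge0}\|\sigma_s(f)\|_q<\infty$. For a normed space $\mathcal X$ of functions and $f\in\mathcal X$, the best $m$-term trigonometric approximation is $e_m(f)_{\mathcal X}=\inf_{\Theta_m}\inf_{c_{\boldsymbol k}}\|f-\sum_{\boldsymbol k\in\Theta_m}c_{\boldsymbol k}e^{i(\boldsymbol k,\boldsymbol x)}\|_{\mathcal X}$, where $\Theta_m$ ranges over sets of $m$ vectors in $\mathbb{Z}^d$ and $c_{\boldsymbol k}\in\mathbb{C}$; for a class $F$, $e_m(F)_{\mathcal X}=\sup_{f\in F}e_m(f)_{\mathcal X}$. The notation $a(m)\asymp b(m)$ means there are constants $0<C_1<C_2$ independent of $m$ (depending possibly on the other parameters) with $C_1a(m)\le b(m)\le C_2a(m)$ for all $m\in\mathbb{N}$. *)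

(* Defs.v *)
From HB Require Import structures.
From mathcomp Require Import all_boot all_order all_algebra.
From mathcomp Require Import all_classical all_reals all_analysis.
From mathcomp Require complex.
Import complex.ComplexField.

Set Implicit Arguments.
Unset Strict Implicit.
Unset Printing Implicit Defensive.

Import Order.TTheory GRing.Theory Num.Theory.
Import numFieldNormedType.Exports.

Local Open Scope classical_set_scope.
Local Open Scope ring_scope.

Section TorusDefs.
Variable R : realType.

Local Notation C := (complex.complex R).
Definition cpx (a b : R) : C := complex.Complex a b.
Definition rC (a : R) : C := cpx a 0.
Definition cabs (z : C) : R := Num.sqrt (complex.Re z ^+ 2 + complex.Im z ^+ 2).
Definition eix (a : R) : C := cpx (cos a) (sin a).

Definition upd (x : nat -> R) (n : nat) (t : R) : nat -> R :=
  fun j => if j == n then t else x j.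

Fixpoint itint (n : nat) (F : (nat -> R) -> \bar R) (x : nat -> R) : \bar R :=
  match n with
  | 0 => F x
  | n'.+1 => (\int[@lebesgue_measure R]_(t in `[0%R, (2 * pi)%R[%classic)
                 itint n' F (upd x n' t))%E
  end.

Definition torus_int (d : nat) (g : 'rV[R]_d -> \bar R) : \bar R :=
  (((2 * pi) ^- d)%:E * itint d (fun x => g (\row_i x i)) (fun _ => 0%R))%E.

Definition torus_rint (d : nat) (g : 'rV[R]_d -> R) : R :=
  fine (torus_int (fun x => (Num.max (g x) 0)%:E))
  - fine (torus_int (fun x => (Num.max (- g x) 0)%:E)).

Definition torus_cint (d : nat) (g : 'rV[R]_d -> C) : C :=
  cpx (torus_rint (fun x => complex.Re (g x))) (torus_rint (fun x => complex.Im (g x))).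

Definition Lpnorm (d : nat) (p : R) (f : 'rV[R]_d -> C) : \bar R :=
  poweR (torus_int (fun x => ((cabs (f x)) `^ p)%:E)) p^-1.

Definition borel_fun (d : nat) (g : 'rV[R]_d -> R) : Prop :=
  forall U : set R, open U ->
    <<s [set O : set 'rV[R]_d | open O] >> (g @^-1` U).

Definition cmeasurable (d : nat) (f : 'rV[R]_d -> C) : Prop :=
  borel_fun (fun x => complex.Re (f x)) /\ borel_fun (fun x => complex.Im (f x)).

Definition periodic (d : nat) (f : 'rV[R]_d -> C) : Prop :=
  forall (x : 'rV[R]_d) (j : 'I_d), f (x + (2 * pi) *: delta_mx ord0 j) = f x.

Definition inLp (d : nat) (p : R) (f : 'rV[R]_d -> C) : Prop :=
  cmeasurable f /\ periodic f /\ (Lpnorm p f < +oo)%E.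

Definition fdiff (d : nat) (h : 'rV[R]_d) (f : 'rV[R]_d -> C) : 'rV[R]_d -> C :=
  fun x => f (x + h) - f x.
Definition fdiffk (d k : nat) (h : 'rV[R]_d) (f : 'rV[R]_d -> C) : 'rV[R]_d -> C :=
  iter k (fdiff h) f.
Definition enorm (d : nat) (h : 'rV[R]_d) : R := Num.sqrt (\sum_(j < d) h ord0 j ^+ 2).

Definition modulus (d k : nat) (p : R) (f : 'rV[R]_d -> C) (t : R) : \bar R :=
  ereal_sup [set Lpnorm p (fdiffk k h f) | h in [set h : 'rV[R]_d | enorm h <= t]].

Definition besov_semi (d : nat) (r p : R) (theta : \bar R) (k : nat)
    (f : 'rV[R]_d -> C) : \bar R :=
  match theta with
  | th%:E => poweR (\int[@lebesgue_measure R]_(t in `]0%R, +oo[%classic)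
                     (poweR ((t `^ (- r))%:E * modulus k p f t)%E th * (t^-1)%:E)%E) th^-1
  | _ => ereal_sup [set ((t `^ (- r))%:E * modulus k p f t)%E | t in `]0%R, +oo[%classic]
  end.

Definition besov_norm (d : nat) (r p : R) (theta : \bar R) (k : nat)
    (f : 'rV[R]_d -> C) : \bar R :=
  (Lpnorm p f + besov_semi r p theta k f)%E.

Definition besov_ball (d : nat) (r p : R) (theta : \bar R) (k : nat) : set ('rV[R]_d -> C) :=
  [set f | inLp p f /\ (besov_norm r p theta k f <= 1)%E].

Definition dirichlet (n : nat) (t : R) : C :=
  \sum_(j < (2 * n).+1) eix ((((nat_of_ord j)%:Z - n%:Z)%:~R : R) * t).

Definition vp1 (l : nat) (t : R) : C :=
  rC (l%:R^-1) * \sum_(l <= k < 2 * l) dirichlet k t.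

Definition vpd (d l : nat) (x : 'rV[R]_d) : C := \prod_(j < d) vp1 l (x ord0 j).

Definition vp_op (d l : nat) (f : 'rV[R]_d -> C) : 'rV[R]_d -> C :=
  fun x => torus_cint (fun y => f (x - y) * vpd l y).

Definition sigma_op (d : nat) (s : nat) (f : 'rV[R]_d -> C) : 'rV[R]_d -> C :=
  match s with
  | 0 => vp_op 1 f
  | s'.+1 => fun x => vp_op (2 ^ s) f x - vp_op (2 ^ s') f x
  end.

Definition Bq1norm (d : nat) (q : R) (g : 'rV[R]_d -> C) : \bar R :=
  if `[< inLp q g >] then (\sum_(s <oo) Lpnorm q (sigma_op s g))%E else +oo%E.

Definition expk (d : nat) (kv : 'rV[int]_d) (x : 'rV[R]_d) : C :=
  eix (\sum_(j < d) ((kv ord0 j)%:~R : R) * x ord0 j).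

Definition mterm_polys (d m : nat) : set ('rV[R]_d -> C) :=
  [set P | exists (ks : 'I_m -> 'rV[int]_d) (c : 'I_m -> C),
      injective ks /\ P = (fun x => \sum_(i < m) c i * expk (ks i) x)].

Definition best_mterm (d m : nat) (q : R) (f : 'rV[R]_d -> C) : \bar R :=
  ereal_inf [set Bq1norm q (fun x => f x - P x) | P in @mterm_polys d m].

Definition best_mterm_class (d m : nat) (q : R) (F : set ('rV[R]_d -> C)) : \bar R :=
  ereal_sup [set best_mterm m q f | f in F].

End TorusDefs.

Arguments besov_ball {R} d r p theta k.
Arguments mterm_polys {R} d m.

(* Main.v *)
(** Upper bound.  A function of the ball has modulus of smoothness [O(t^r)] in quadratic mean, so
   Bessel's inequality applied to its differences gives [sum |c_k| = O(rho^s)] over the dyadic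
   level [s], with [rho = 2^(d/2-r) < 1].  (Averaging the differences against a Fejer kernel shows
   that such a function is essentially bounded, hence in [L_q].)  One keeps all frequencies below a
   level [s0] with [2^(d s0) ~ m] and replaces the higher levels by the mean of [M ~ m] randomly
   chosen terms [c_k e_k / p_k].  Instead of a random choice, the terms are picked greedily so as
   to keep an exponential potential, summed over all blocks [sigma_t], from growing; the error of
   the block [sigma_t] is then [O(rho^s0 M^(-1/2))] with a factor decaying geometrically in [t].

   Lower bound.  A tensor product of Rudin-Shapiro polynomials with [2^(nd) >= 2m] unimodular
   coefficients has sup norm [O(2^(nd/2))] and all of its spectrum inside the block
   [sigma_(n+1)].  Every [m]-term polynomial leaves half of that spectrum untouched, so Parseval's
   identity bounds the error from below. *)

Require Import Defs.
From HB Require Import structures.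
From mathcomp Require Import all_boot all_order all_algebra.
From mathcomp Require Import all_classical all_reals all_analysis measurable_realfun.
From mathcomp Require complex.
From mathcomp Require Import zify ring lra.
Import complex.ComplexField.

Set Implicit Arguments.
Unset Strict Implicit.
Unset Printing Implicit Defensive.

Import Order.TTheory GRing.Theory Num.Theory.
Import numFieldNormedType.Exports.

Local Open Scope classical_set_scope.
Local Open Scope ring_scope.

(** The upper bound uses the class only through quadratic means, available because [p > 2] on a
    probability space. The exponents add up since [2^(d s0) ~ m] turns [rho^s0] into
    [m^(-(r/d - 1/2))], and sampling supplies the missing [m^(-1/2)]. The obstacle is that one
    selection of terms must serve all blocks while the target norm sums the block errors. Decay
    across blocks is bought twice out of the decay of the coefficients: by tilting the sampling
    probabilities towards high levels, and by weighting the blocks in the potential. The exponential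
    dominates every power, so a finite [q] costs only a constant. Moreover the target norm is
    infinite outside [L_q], and [q > p], so membership in [L_q] has to be earned from smoothness
    before any error is estimated. In the lower bound flatness is decisive: the Besov norm of the
    polynomial is of order [2^(nd/2) 2^(nr)], Parseval's identity returns the factor [2^(nd/2)], and
    [2^(-nr) ~ m^(-r/d)] remains. *)

(** * Affine changes of variable for periodic functions of one variable *)

Section PeriodicIntegral.
Variable R : realType.
Local Open Scope ereal_scope.
Local Notation leb := (@lebesgue_measure R).

Let measurable_affine (a b : R) :
  measurable_fun setT (fun x : measurableTypeR R => (a * x + b)%R : measurableTypeR R).
Proof. by apply: measurable_funD => //; exact: measurable_funM. Qed.

Let affine_pushforward (a b : R) : {measure set (measurableTypeR R) -> \bar R} :=
  measure_function_pushforward__canonical__measure_function_Measure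
    (@lebesgue_measure R) (measurable_affine a b).

(** By uniqueness of Lebesgue measure, both sides need comparing only on half-open intervals. A
    negative [a] moves the closed end to the other side, which leaves the length unchanged. *)
Let lebesgue_measure_affine (a b : R) (A : set R) : a != 0%R -> measurable A ->
  leb A = mscale (NngNum (normr_ge0 a)) (affine_pushforward a b) A.
Proof.
move=> a0 mA.
apply: lebesgue_measure_unique => // _ [[c d]] _ <-.
rewrite -[RHS]/(`|a|%:E * leb ((fun x => a * x + b)%R @^-1` `]c, d]%classic)).
have [agt|alt] := ltP 0%R a.
  rewrite [X in _ * leb X](_ : _ = `]((c - b) / a)%R, ((d - b) / a)%R]%classic); last first.
    by apply/seteqP; split => x /=; rewrite !in_itv/= ltr_pdivrMr// ler_pdivlMr//; lra.
  rewrite !lebesgue_measure_itv/= !lte_fin ltr_pM2r ?invr_gt0// ltrD2r.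
  case: ifP => _; last by rewrite mule0.
  by rewrite -!EFinD -EFinM gtr0_norm//; congr (_%:E); field.
have {}alt : (a < 0)%R by rewrite lt_neqAle a0.
rewrite [X in _ * leb X](_ : _ = `[((d - b) / a)%R, ((c - b) / a)%R[%classic); last first.
  by apply/seteqP; split => x /=; rewrite !in_itv/= ltr_ndivlMr// ler_ndivrMr//; lra.
rewrite !lebesgue_measure_itv/= !lte_fin ltr_nM2r ?invr_lt0// ltrD2r.
case: ifP => _; last by rewrite mule0.
by rewrite -!EFinD -EFinM ltr0_norm//; congr (_%:E); field.
Qed.

Lemma ge0_integral_affine (a b : R) (D : set R) (f : R -> \bar R) : a != 0%R ->
  measurable D -> measurable_fun D f -> (forall x, D x -> 0 <= f x) ->
  \int[leb]_(x in D) f x =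
  `|a|%:E * \int[leb]_(x in (fun x => a * x + b)%R @^-1` D) f (a * x + b)%R.
Proof.
move=> a0 mD mf f0.
transitivity (\int[mscale (NngNum (normr_ge0 a)) (affine_pushforward a b)]_(x in D) f x).
  by apply: eq_measure_integral => //= A mA _; rewrite (lebesgue_measure_affine b a0).
rewrite ge0_integral_mscale//=; congr (_ * _).
rewrite (@ge0_integral_pushforward _ _ _ _ _ _ (measurable_affine a b))//.
by move=> y; rewrite inE; exact: f0.
Qed.

Variable g : R -> \bar R.
Hypotheses (mg : measurable_fun setT g) (g0 : forall x, 0 <= g x)
  (gper : forall x, g (x + 2 * pi)%R = g x).

Let pi2gt0 : (0 < 2 * pi :> R)%R.
Proof. by rewrite mulr_gt0// pi_gt0. Qed.

Let mgD (D : set R) : measurable_fun D g. Proof. exact: measurable_funTS. Qed.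

Lemma periodic_addz (z : int) (x : R) : g (x + z%:~R * (2 * pi))%R = g x.
Proof.
have H (n : nat) y : g (y + n%:R * (2 * pi))%R = g y.
  elim: n y => [|n IH] y; first by rewrite mul0r addr0.
  by rewrite -natr1 mulrDl mul1r addrA gper IH.
case: z => n; first exact: H.
by rewrite -[LHS](H n.+1) NegzE; congr g; rewrite mulrNz mulNr -pmulrn; ring.
Qed.

Lemma integral_period (c : R) :
  \int[leb]_(x in `[c, (c + 2 * pi)%R[%classic) g x =
  \int[leb]_(x in `[0%R, (2 * pi)%R[%classic) g x.
Proof.
(* Shifting by [z] periods brings the left end into [[0, 2 pi)]; the part of the window that then
   sticks out past [2 pi] is moved back by one more period. *)
pose z : int := (- Num.floor (c / (2 * pi)))%R.
have sh y w : \int[leb]_(x in `[y, w[%classic) g x =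
   \int[leb]_(x in `[(y + z%:~R * (2 * pi))%R, (w + z%:~R * (2 * pi))%R[%classic) g x.
  rewrite [RHS](@ge0_integral_affine 1 (z%:~R * (2 * pi))) ?oner_eq0// normr1 mul1e.
  have -> : (fun x : R => (1 * x + z%:~R * (2 * pi))%R) @^-1`
     `[(y + z%:~R * (2 * pi))%R, (w + z%:~R * (2 * pi))%R[%classic = `[y, w[%classic.
    by apply/seteqP; split => x /=; rewrite !in_itv/= mul1r lerD2r ltrD2r.
  by apply: eq_integral => x _; rewrite mul1r periodic_addz.
rewrite sh.
have [c0 c1] : ((0 <= c + z%:~R * (2 * pi)) /\ (c + z%:~R * (2 * pi) < 2 * pi))%R.
  have h1 := Num.Theory.floor_le (c / (2 * pi)).
  have h2 := Num.Theory.floorD1_gt (c / (2 * pi)).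
  rewrite /z mulrNz; move: h1 h2; rewrite intrD ler_pdivlMr// ltr_pdivrMr//; split; lra.
have -> : (c + 2 * pi + z%:~R * (2 * pi) = c + z%:~R * (2 * pi) + 2 * pi)%R by ring.
move: (c + z%:~R * (2 * pi))%R c0 c1 => {sh z}{}c c0 c1.
have sh : \int[leb]_(x in `[0%R, c[%classic) g x =
    \int[leb]_(x in `[(2 * pi)%R, (c + 2 * pi)%R[%classic) g x.
  rewrite [RHS](@ge0_integral_affine 1 (2 * pi)) ?oner_eq0// normr1 mul1e.
  have -> : (fun x : R => (1 * x + 2 * pi)%R) @^-1`
     `[(2 * pi)%R, (c + 2 * pi)%R[%classic = `[0%R, c[%classic.
    by apply/seteqP; split => x /=; rewrite !in_itv/= mul1r; lra.
  by apply: eq_integral => x _; rewrite mul1r gper.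
have -> : `[c, (c + 2 * pi)%R[%classic =
    `[c, (2 * pi)%R[%classic `|` `[(2 * pi)%R, (c + 2 * pi)%R[%classic.
  apply/seteqP; split => x /=; rewrite !in_itv/=.
    by move=> /andP[h1 h2]; case: (ltP x (2 * pi)%R) => h; [left|right]; lra.
  by move=> [|]; lra.
have -> : `[0%R, (2 * pi)%R[%classic = `[0%R, c[%classic `|` `[c, (2 * pi)%R[%classic.
  apply/seteqP; split => x /=; rewrite !in_itv/=.
    by move=> /andP[h1 h2]; case: (ltP x c) => h; [left|right]; lra.
  by move=> [|]; lra.
rewrite !ge0_integral_setU//; [by rewrite sh addeC|exact: mgD| |exact: mgD| ].
- by apply/disj_setPS => x [] /=; rewrite !in_itv/=; lra.
- by apply/disj_setPS => x [] /=; rewrite !in_itv/=; lra.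
Qed.

Lemma integral_periods (n : nat) (c : R) :
  \int[leb]_(x in `[c, (c + n%:R * (2 * pi))%R[%classic) g x =
  n%:R%:E * \int[leb]_(x in `[0%R, (2 * pi)%R[%classic) g x.
Proof.
elim: n => [|n IH].
  by rewrite mul0r addr0 mul0e set_itvco0 integral_set0.
have -> : `[c, (c + n.+1%:R * (2 * pi))%R[%classic =
   `[c, (c + n%:R * (2 * pi))%R[%classic `|`
   `[(c + n%:R * (2 * pi))%R, (c + n%:R * (2 * pi) + 2 * pi)%R[%classic.
  have h : (0 <= n%:R * (2 * pi) :> R)%R by rewrite mulr_ge0// ltW.
  have h' := pi2gt0; have E : (n.+1%:R = n%:R + 1 :> R)%R by rewrite natr1.
  apply/seteqP; split => x /=; rewrite !in_itv/= E.
    by move=> /andP[h1 h2]; case: (ltP x (c + n%:R * (2 * pi))%R) => h3; [left|right]; lra.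
  by move=> [|]; lra.
rewrite ge0_integral_setU//; [|exact: mgD|]; last first.
  by apply/disj_setPS => x [] /=; rewrite !in_itv/=; lra.
have -> : (n.+1%:R = n%:R + 1 :> R)%R by rewrite natr1.
by rewrite IH integral_period EFinD ge0_muleDl ?mul1e// lee_fin.
Qed.

(** The image of one period covers [|a|] periods and the Jacobian is [|a|] as well, so the two
    factors cancel. Reflections need [a = -1], and the dilations [h -> j h] inside iterated
    differences need general [a]. *)
Lemma integral_period_affine (a : int) (b : R) : a != 0%R ->
  \int[leb]_(x in `[0%R, (2 * pi)%R[%classic) g (a%:~R * x + b)%R =
  \int[leb]_(x in `[0%R, (2 * pi)%R[%classic) g x.
Proof.
move=> a0; have aR0 : (a%:~R != 0 :> R)%R by rewrite intr_eq0.
have nE : (`|a|%N%:R = `|a%:~R| :> R)%R by rewrite -intr_norm -abszE.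
have inj (x y : \bar R) : `|a%:~R : R|%:E * x = `|a%:~R : R|%:E * y -> x = y.
  have h : (0 < `|a%:~R : R|)%R by rewrite normr_gt0.
  move=> /(congr1 (fun z => (`|a%:~R : R|^-1)%:E * z)).
  by rewrite !muleA -!EFinM mulVf ?gt_eqF// !mul1e.
apply: inj; rewrite -{2}nE.
have [agt|alt] := ltP 0%R (a%:~R : R).
  rewrite -(integral_periods _ b) [RHS](@ge0_integral_affine a%:~R b)//.
  congr (_ * integral _ _ _).
  apply/seteqP; split => x /=; rewrite !in_itv/= nE gtr0_norm//.
    by rewrite lerDr pmulr_rge0// addrC ltrD2l ltr_pM2l.
  by rewrite lerDr pmulr_rge0// addrC ltrD2l ltr_pM2l.
have {}alt : (a%:~R < 0 :> R)%R by rewrite lt_neqAle aR0.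
(* For negative [a] the image runs down from [b], so the periods are counted from its lower end, and
   the closed endpoint changes side. *)
rewrite -(integral_periods _ (b + a%:~R * (2 * pi))) nE ltr0_norm//.
have -> : (b + a%:~R * (2 * pi) + - a%:~R * (2 * pi) = b)%R by ring.
rewrite [RHS](_ : _ = \int[leb]_(x in `](b + a%:~R * (2 * pi))%R, b]%classic) g x); last first.
  by rewrite !integral_itv_bndoo//; exact: mgD.
rewrite [RHS](@ge0_integral_affine a%:~R b)// ltr0_norm//.
congr (_ * integral _ _ _).
apply/seteqP; split => x /=; rewrite !in_itv/=.
  by rewrite gerDr nmulr_rle0// [(b + _)%R]addrC ltrD2r ltr_nM2l// andbC.
by rewrite gerDr nmulr_rle0// [(b + _)%R]addrC ltrD2r ltr_nM2l// andbC.
Qed.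

End PeriodicIntegral.

(** * The uniform probability on the torus behind the iterated integrals *)

Section TorusMeasure.
Variable R : realType.

(** [itint] works on sequences whose coordinates are overwritten one at a time, so the product
    sigma-algebra is put on all real sequences first and transported to row vectors at the end. *)
Definition cylinders : set (set (nat -> R)) :=
  [set A | exists n (B : set R), measurable B /\ A = (fun x : nat -> R => x n) @^-1` B].

Local Notation X := (g_sigma_algebraType cylinders).
Local Notation Tor d := (g_sigma_algebraType [set O : set 'rV[R]_d | open O]).

Lemma measurable_coordinate n : measurable_fun setT (fun x : X => x n).
Proof.
by move=> _ B mB; rewrite setTI; apply: sub_sigma_algebra; exists n, B.
Qed.

Lemma measurable_fun_coordinates (disp : measure_display) (T : measurableType disp)
    (f : T -> X) :
  (forall n, measurable_fun setT (fun t => f t n)) -> measurable_fun setT f.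
Proof.
move=> mf; apply: (@measurability _ _ T X setT f cylinders) => // _ [_ [n [B [mB ->]]] <-].
by rewrite setTI; have := mf n measurableT B mB; rewrite setTI.
Qed.

Lemma borel_funP d (g : 'rV[R]_d -> R) :
  borel_fun g <-> measurable_fun setT (g : Tor d -> R).
Proof.
split=> [bg|mg U oU].
  apply: (measurability _ (RGenOpens.measurableE R)).
  move=> _ [_ [x [y ->]] <-]; rewrite setTI.
  by apply: bg; exact: interval_open.
rewrite -[X in <<s _ >> X]setTI; apply: mg => //; exact: open_measurable.
Qed.

Lemma continuous_measurable_torus d (g : 'rV[R]_d -> R) : continuous g ->
  measurable_fun setT (g : Tor d -> R).
Proof.
move=> cg; apply/borel_funP => U oU; apply: sub_sigma_algebra.
by apply: open_comp => // x _; exact: cg.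
Qed.

Lemma measurable_coord_torus d (i : 'I_d) :
  measurable_fun setT (fun x : Tor d => x ord0 i).
Proof. by apply: continuous_measurable_torus; exact: coord_continuous. Qed.

Let rbox d (u : 'rV[rat]_d * nat) : set 'rV[R]_d :=
  [set x | forall i, `|x ord0 i - ratr (u.1 ord0 i)| < u.2.+1%:R^-1].

Let open_rbox d (O : set 'rV[R]_d) : open O ->
  O = \bigcup_(u in [set u | rbox u `<=` O]) rbox u.
Proof.
move=> oO; apply/seteqP; split => [x Ox|x [u /= uO]]; last exact: uO.
have /nbhs_ballP[e /= e0 xeO] : nbhs x O by exact: open_nbhs_nbhs.
have [n ne] : exists n, (n.+1%:R^-1 : R) < e / 2.
  exists (Num.truncn (e / 2)^-1); rewrite invf_plt ?posrE ?divr_gt0//.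
  exact: truncnS_gt.
have /choice [q hq] : forall i : 'I_d, exists q : rat, `|x ord0 i - ratr q| < n.+1%:R^-1.
  move=> i; have [|q] := @rat_in_itvoo R (x ord0 i - n.+1%:R^-1) (x ord0 i + n.+1%:R^-1).
    by rewrite ltrBlDr -addrA ltrDl addr_gt0.
  by rewrite in_itv/= => h; exists q; rewrite ltr_norml; move: h; set v := n.+1%:R^-1; lra.
exists (\row_i q i, n) => /=; last by move=> i; rewrite mxE.
move=> y hy; apply: xeO; split => // i j; rewrite (ord1 i) /ball/=.
have := hy j; rewrite mxE /= => h1; have h2 := hq j.
rewrite (_ : _ - _ = (x ord0 j - ratr (q j)) - (y ord0 j - ratr (q j))); last by ring.
rewrite (le_lt_trans (ler_normB _ _))//; move: h1 h2 ne; set v := n.+1%:R^-1; lra.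
Qed.

(* An open set is a countable union of rational boxes. *)
Lemma measurable_fun_torus d (disp : measure_display) (T : measurableType disp)
    (f : T -> Tor d) :
  (forall i, measurable_fun setT (fun t => f t ord0 i)) -> measurable_fun setT f.
Proof.
move=> mf; apply: (@measurability _ _ T (Tor d) setT f [set O : set 'rV[R]_d | open O]) => //.
move=> _ [V /= oV <-]; rewrite setTI (open_rbox oV) preimage_bigcup.
have mbox u : measurable (f @^-1` rbox u).
  have -> : f @^-1` rbox u = \bigcap_(i in [set: 'I_d])
      ((fun t => `|f t ord0 i - ratr (u.1 ord0 i)|) @^-1` `]-oo, (u.2.+1%:R^-1 : R)[%classic).
    apply/seteqP; split => t /=; first by move=> h i _ /=; rewrite in_itv/=; exact: h.
    by move=> h i; have := h i I; rewrite /= in_itv.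
  apply: fin_bigcap_measurable => // i _; rewrite -[X in measurable X]setTI.
  have : measurable_fun setT (fun t => `|f t ord0 i - ratr (u.1 ord0 i)|).
    by apply: measurableT_comp => //; exact: measurable_funB.
  by apply.
(* The boxes are enumerated through [unpickle], with [set0] for codes that stand for no box inside
   [V], to get a union indexed by [nat]. *)
rewrite (_ : \bigcup_(_ in _) _ = \bigcup_k
  (if unpickle k is Some u then if `[< rbox u `<=` V >] then f @^-1` rbox u else set0 else set0)).
  apply: bigcup_measurable => k _; case: unpickle => // u; case: ifP => // _.
apply/seteqP; split => t /=.
  by move=> [u /= uO tu]; exists (pickle u) => //; rewrite pickleK; move/asboolP : uO => ->.
move=> [k _]; case: unpickle => // u; case: ifPn => // /asboolP uO tu.
by exists u.
Qed.

Let pi2gt0 : (0 < 2 * pi :> R).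
Proof. by rewrite mulr_gt0// pi_gt0. Qed.

Definition circle_prob : probability (measurableTypeR R) R := uniform_prob pi2gt0.

Local Open Scope ereal_scope.

Lemma integral_circle_prob (f : R -> \bar R) : measurable_fun setT f ->
  (forall x, 0 <= f x) ->
  \int[circle_prob]_x f x =
  ((2 * pi)^-1)%:E * \int[lebesgue_measure]_(x in `[0%R, (2 * pi)%R[%classic) f x.
Proof.
move=> mf f0; rewrite integral_uniform// subr0; congr (_ * _).
by rewrite integral_itv_bndo_bndc//; exact: measurable_funTS.
Qed.

Lemma measurable_upd n :
  measurable_fun setT (fun p : X * measurableTypeR R => upd p.1 n p.2 : X).
Proof.
apply: measurable_fun_coordinates => j; rewrite /upd.
case: (eqVneq j n) => _; first exact: measurable_snd.
exact: (measurableT_comp (measurable_coordinate j) measurable_fst).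
Qed.

Definition upd_mfun n : {mfun (X * measurableTypeR R)%type >-> X} :=
  HB.pack (fun p : X * measurableTypeR R => upd p.1 n p.2 : X)
    (isMeasurableFun.Build _ _ _ _ _ (measurable_upd n)).

(** The law of a sequence whose first [n] coordinates are independent and uniform on the circle, the
    others being 0 as in the starting point of [torus_int]. *)
Fixpoint coordinate_prob (n : nat) : probability X R :=
  match n with
  | 0 => dirac ((fun _ => 0%R) : X)
  | n'.+1 => distribution (coordinate_prob n' \x circle_prob)%E (upd_mfun n')
  end.

Lemma measurable_comp_upd n (F : X -> \bar R) : measurable_fun setT F ->
  measurable_fun setT (fun p : X * measurableTypeR R => F (upd p.1 n p.2)).
Proof. by move=> mF; exact: (measurableT_comp mF (measurable_upd n)). Qed.

Lemma integral_coordinate_probS n (F : X -> \bar R) : measurable_fun setT F ->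
  (forall x, 0 <= F x) ->
  \int[coordinate_prob n.+1]_x F x =
  \int[circle_prob]_t \int[coordinate_prob n]_y F (upd y n t).
Proof.
move=> mF F0; rewrite /= ge0_integral_distribution// fubini_tonelli2//=.
exact: measurable_comp_upd.
Qed.

Lemma updC (x : nat -> R) n m s t : n != m -> upd (upd x m t) n s = upd (upd x n s) m t.
Proof.
move=> nm; apply/funext => j; rewrite /upd.
by case: (eqVneq j n) => [->|//]; rewrite (negbTE nm).
Qed.

(** The [n] integrations overwrite only coordinates below [n], so a value placed at [m >= n]
    survives them. *)
Lemma itint_upd n m (F : (nat -> R) -> \bar R) x t : (n <= m)%N ->
  itint n F (upd x m t) = itint n (fun y => F (upd y m t)) x.
Proof.
elim: n x => //= n IH x nm.
by apply: eq_integral => s _; rewrite updC ?ltn_eqF// IH// ltnW.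
Qed.

Lemma measurable_inner_integral n (F : X -> \bar R) : measurable_fun setT F ->
  (forall x, 0 <= F x) ->
  measurable_fun setT (fun t : measurableTypeR R => \int[coordinate_prob n]_y F (upd y n t)).
Proof.
move=> mF F0.
exact: (@measurable_fun_fubini_tonelli_G _ _ _ _ _ (coordinate_prob n)
  (fun p : X * measurableTypeR R => F (upd p.1 n p.2)) (measurable_comp_upd n mF)).
Qed.

Lemma measurable_upd_fixed n t : measurable_fun setT (fun y : X => upd y n t : X).
Proof.
apply: measurable_fun_coordinates => j; rewrite /upd.
by case: (eqVneq j n) => _ //; exact: measurable_coordinate.
Qed.

Lemma integral_coordinate_prob n (F : X -> \bar R) : measurable_fun setT F ->
  (forall x, 0 <= F x) ->
  ((2 * pi) ^- n)%:E * itint n F (fun _ => 0%R) = \int[coordinate_prob n]_x F x.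
Proof.
elim: n F => [|n IH] F mF F0.
  by rewrite expr0 invr1 mul1e /= integral_dirac// diracT mul1e.
have pi2X : (0 < (2 * pi) ^+ n :> R)%R by rewrite exprn_gt0.
have E t : itint n F (upd (fun _ => 0%R) n t) =
    ((2 * pi) ^+ n)%:E * \int[coordinate_prob n]_y F (upd y n t).
  rewrite itint_upd// -IH//; last exact: (measurableT_comp mF (measurable_upd_fixed n t)).
  by rewrite muleA -EFinM divff ?gt_eqF// mul1e.
have mI := @measurable_inner_integral n F mF F0.
have I0 t : 0 <= \int[coordinate_prob n]_y F (upd y n t) by exact: integral_ge0.
rewrite integral_coordinate_probS// integral_circle_prob//=.
under eq_integral do rewrite E.
rewrite ge0_integralZl//; [|exact: measurable_funTS|by rewrite lee_fin ltW].
by rewrite muleA -EFinM exprS invfM mulfVK ?gt_eqF.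
Qed.

Definition aff_coord n (a : R) (b : nat -> R) (x : nat -> R) : nat -> R :=
  fun j => if (j < n)%N then (a * x j + b j)%R else x j.

Lemma measurable_aff_coord n a b : measurable_fun setT (aff_coord n a b : X -> X).
Proof.
apply: measurable_fun_coordinates => j; rewrite /aff_coord.
case: (j < n)%N; last exact: measurable_coordinate.
by apply: measurable_funD => //; apply: measurable_funM => //; exact: measurable_coordinate.
Qed.

(** One coordinate at a time: Tonelli's theorem isolates the last coordinate, which
    [integral_period_affine] treats, and the induction hypothesis treats the inner integral. *)
Lemma integral_aff_coord n (a : int) (b : nat -> R) (F : X -> \bar R) : a != 0%R ->
  measurable_fun setT F -> (forall x, 0 <= F x) ->
  (forall x j, (j < n)%N -> F (upd x j (x j + 2 * pi)) = F x) ->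
  \int[coordinate_prob n]_x F (aff_coord n a%:~R b x) = \int[coordinate_prob n]_x F x.
Proof.
move=> a0; elim: n F => [|n IH] F mF F0 Fper.
  by congr integral; apply/funext => x; congr F; apply/funext.
rewrite (@integral_coordinate_probS n F)//.
rewrite (@integral_coordinate_probS n (fun x => F (aff_coord n.+1 a%:~R b x))); last 2 first.
- exact: (measurableT_comp mF (measurable_aff_coord _ _ _)).
- by move=> x; exact: F0.
have affS y t : aff_coord n.+1 a%:~R b (upd y n t) =
    upd (aff_coord n a%:~R b y) n (a%:~R * t + b n)%R.
  apply/funext => j; rewrite /aff_coord /upd ltnS leq_eqVlt.
  by case: (eqVneq j n) => [->|].
under eq_integral do under eq_integral do rewrite affS.
pose g t := \int[coordinate_prob n]_y F (upd y n t).
have mI : measurable_fun setT g by exact: measurable_inner_integral.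
have g0 t : 0 <= g t by exact: integral_ge0.
transitivity (\int[circle_prob]_t g (a%:~R * t + b n)%R).
  apply: eq_integral => t _.
  rewrite (IH (fun y => F (upd y n (a%:~R * t + b n)%R)))//.
    exact: (measurableT_comp mF (measurable_upd_fixed _ _)).
  move=> x j jn; rewrite updC ?gtn_eqF// -[RHS](@Fper _ j); last exact: ltnW.
  by congr F; congr (upd _ _ (_ + _)%R); rewrite /upd ltn_eqF.
rewrite (@integral_circle_prob g)// (@integral_circle_prob (fun t => g (a%:~R * t + b n)%R)); last 2 first.
- by apply: (measurableT_comp mI); apply: measurable_funD => //; exact: measurable_funM.
- by move=> x; exact: g0.
congr (_ * _); apply: integral_period_affine => // t.
apply: eq_integral => y _; rewrite -[RHS](@Fper _ n)//; congr F.
by apply/funext => j; rewrite /upd eqxx; case: eqP.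
Qed.

Variable d : nat.

Let row_of (x : X) : Tor d := \row_(i < d) x i.

Let measurable_row_of : measurable_fun setT row_of.
Proof.
apply: measurable_fun_torus => i; rewrite /row_of.
rewrite (_ : (fun t => _) = (fun t : X => t i)); last by apply/funext => t; rewrite mxE.
exact: measurable_coordinate.
Qed.

Let row_mfun : {mfun X >-> Tor d} :=
  HB.pack row_of (isMeasurableFun.Build _ _ _ _ _ measurable_row_of).

Definition torus_prob : probability (Tor d) R := distribution (coordinate_prob d) row_mfun.

(** The bridge from the iterated integrals of the definitions to a probability measure, for which
    Tonelli's theorem and the other limit theorems are available. *)
Lemma torus_intE (g : Tor d -> \bar R) : measurable_fun setT g -> (forall x, 0 <= g x) ->
  torus_int g = \int[torus_prob]_x g x.
Proof.
move=> mg g0; rewrite /torus_prob ge0_integral_distribution// -integral_coordinate_prob//.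
- exact: (measurableT_comp mg measurable_row_of).
- by move=> x; exact: g0.
Qed.

Lemma integral_torus_affine (a : int) (b : 'rV[R]_d) (g : Tor d -> \bar R) : a != 0%R ->
  measurable_fun setT g -> (forall x, 0 <= g x) ->
  (forall (x : 'rV[R]_d) (j : 'I_d), g (x + (2 * pi) *: delta_mx ord0 j)%R = g x) ->
  \int[torus_prob]_x g (a%:~R *: x + b)%R = \int[torus_prob]_x g x.
Proof.
move=> a0 mg g0 gper.
have maff : measurable_fun setT (fun x : Tor d => (a%:~R *: x + b)%R : Tor d).
  apply: measurable_fun_torus => i.
  rewrite (_ : (fun t => _) = (fun t : Tor d => a%:~R * t ord0 i + b ord0 i)%R); last first.
    by apply/funext => t; rewrite !mxE.
  by apply: measurable_funD => //; apply: measurable_funM => //; exact: measurable_coord_torus.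
rewrite /torus_prob !ge0_integral_distribution//; last exact: (measurableT_comp mg maff).
rewrite -[RHS](@integral_aff_coord d a (fun j => if insub j is Some i then b ord0 i else 0%R) _ a0)//.
- apply: eq_integral => x _ /=; congr g; apply/rowP => i.
  by rewrite !mxE /aff_coord ltn_ord valK.
- exact: (measurableT_comp mg measurable_row_of).
- by move=> x; exact: g0.
- move=> x j jd; rewrite /= -[RHS](@gper _ (Ordinal jd)); congr g.
  apply/rowP => i; rewrite !mxE /upd eqxx -val_eqE/=.
  by case: eqP => [->|_]; rewrite ?mulr1 ?mulr0 ?addr0.
Qed.

End TorusMeasure.

Notation Torus R d := (g_sigma_algebraType [set O : set 'rV[R]_d | open O]).

#[global] Opaque torus_prob.

(** * Arithmetic of complex numbers and characters *)

Section ComplexBasics.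
Variable R : realType.
Local Notation C := (complex.complex R).
Local Notation Re := (@complex.Re R).
Local Notation Im := (@complex.Im R).
Implicit Types (z w : C) (a b : R).

Lemma cReD z w : Re (z + w) = Re z + Re w. Proof. by case: z; case: w. Qed.
Lemma cImD z w : Im (z + w) = Im z + Im w. Proof. by case: z; case: w. Qed.
Lemma cReN z : Re (- z) = - Re z. Proof. by case: z. Qed.
Lemma cImN z : Im (- z) = - Im z. Proof. by case: z. Qed.
Lemma cReM z w : Re (z * w) = Re z * Re w - Im z * Im w.
Proof. by case: z; case: w. Qed.
Lemma cImM z w : Im (z * w) = Re z * Im w + Im z * Re w.
Proof. by case: z; case: w. Qed.

Lemma cRe_sum I (s : seq I) (P : pred I) (F : I -> C) :
  Re (\sum_(i <- s | P i) F i) = \sum_(i <- s | P i) Re (F i).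
Proof. by apply: (big_morph Re) => //; exact: cReD. Qed.
Lemma cIm_sum I (s : seq I) (P : pred I) (F : I -> C) :
  Im (\sum_(i <- s | P i) F i) = \sum_(i <- s | P i) Im (F i).
Proof. by apply: (big_morph Im) => //; exact: cImD. Qed.

Lemma complexE z w : Re z = Re w -> Im z = Im w -> z = w.
Proof. by case: z => ? ?; case: w => ? ? /= -> ->. Qed.

Lemma rC0 : rC (0 : R) = 0. Proof. by []. Qed.
Lemma rC1 : rC (1 : R) = 1. Proof. by []. Qed.
Lemma rCD a b : rC (a + b) = rC a + rC b.
Proof. by apply: complexE; rewrite ?cReD ?cImD//= addr0. Qed.
Lemma rCN a : rC (- a) = - rC a.
Proof. by apply: complexE; rewrite ?cReN ?cImN//= oppr0. Qed.
Lemma rCM a b : rC (a * b) = rC a * rC b.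
Proof. by apply: complexE; rewrite ?cReM ?cImM/= ?mulr0 ?mul0r ?subr0 ?addr0. Qed.
Lemma rC_sum I (s : seq I) (P : pred I) (F : I -> R) :
  rC (\sum_(i <- s | P i) F i) = \sum_(i <- s | P i) rC (F i).
Proof. by apply: (big_morph (@rC R)) => //; exact: rCD. Qed.
Lemma rC_prod I (s : seq I) (P : pred I) (F : I -> R) :
  rC (\prod_(i <- s | P i) F i) = \prod_(i <- s | P i) rC (F i).
Proof. by apply: (big_morph (@rC R)) => //; exact: rCM. Qed.

Definition cconj z : C := cpx (Re z) (- Im z).
Definition sqnorm z : R := Re z ^+ 2 + Im z ^+ 2.

Lemma cconjD z w : cconj (z + w) = cconj z + cconj w.
Proof. by apply: complexE; rewrite ?cReD ?cImD/= ?cReD ?cImD ?opprD. Qed.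
Lemma cconjM z w : cconj (z * w) = cconj z * cconj w.
Proof. by apply: complexE; rewrite ?cReM ?cImM/= ?cReM ?cImM; ring. Qed.
Lemma cconj_sum I (s : seq I) (P : pred I) (F : I -> C) :
  cconj (\sum_(i <- s | P i) F i) = \sum_(i <- s | P i) cconj (F i).
Proof. by apply: (big_morph cconj); [exact: cconjD|apply: complexE; rewrite /= ?oppr0]. Qed.

Lemma mul_cconj z : z * cconj z = rC (sqnorm z).
Proof. by apply: complexE; rewrite ?cReM ?cImM/= /sqnorm; ring. Qed.

Lemma sqnorm_ge0 z : 0 <= sqnorm z. Proof. by rewrite addr_ge0// sqr_ge0. Qed.
Lemma sqnormM z w : sqnorm (z * w) = sqnorm z * sqnorm w.
Proof. by rewrite /sqnorm cReM cImM; ring. Qed.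
Lemma sqnormN z : sqnorm (- z) = sqnorm z.
Proof. by rewrite /sqnorm cReN cImN; ring. Qed.
Lemma sqnorm_rC a : sqnorm (rC a) = a ^+ 2. Proof. by rewrite /sqnorm/=; ring. Qed.

Lemma cabsE z : cabs z = Num.sqrt (sqnorm z). Proof. by []. Qed.
Lemma sqr_cabs z : cabs z ^+ 2 = sqnorm z.
Proof. by rewrite cabsE sqr_sqrtr// sqnorm_ge0. Qed.
Lemma cabs_ge0 z : 0 <= cabs z. Proof. exact: sqrtr_ge0. Qed.
Lemma cabsM z w : cabs (z * w) = cabs z * cabs w.
Proof. by rewrite !cabsE sqnormM sqrtrM// sqnorm_ge0. Qed.
Lemma cabs_rC a : cabs (rC a) = `|a|.
Proof. by rewrite cabsE sqnorm_rC sqrtr_sqr. Qed.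
Lemma cabs0 : cabs (0 : C) = 0. Proof. by rewrite -rC0 cabs_rC normr0. Qed.
Lemma cabs1 : cabs (1 : C) = 1. Proof. by rewrite -rC1 cabs_rC normr1. Qed.
Lemma cabsN z : cabs (- z) = cabs z. Proof. by rewrite !cabsE sqnormN. Qed.
Lemma cabsX z n : cabs (z ^+ n) = cabs z ^+ n.
Proof. by elim: n => [|n IH]; rewrite ?expr0 ?cabs1// !exprS cabsM IH. Qed.
Lemma cabs_prod I (s : seq I) (P : pred I) (F : I -> C) :
  cabs (\prod_(i <- s | P i) F i) = \prod_(i <- s | P i) cabs (F i).
Proof. by apply: (big_morph (@cabs R)); [exact: cabsM|exact: cabs1]. Qed.
Lemma cabs_eq0 z : cabs z = 0 -> z = 0.
Proof.
move=> h; have : sqnorm z == 0 by rewrite -sqr_cabs h expr0n.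
rewrite paddr_eq0 ?sqr_ge0// !sqrf_eq0 => /andP[/eqP h1 /eqP h2].
exact: complexE.
Qed.
Lemma ler_Re_cabs z : `|Re z| <= cabs z.
Proof. by rewrite -sqrtr_sqr ler_wsqrtr// lerDl sqr_ge0. Qed.
Lemma ler_Im_cabs z : `|Im z| <= cabs z.
Proof. by rewrite -sqrtr_sqr ler_wsqrtr// lerDr sqr_ge0. Qed.
Lemma ler_cabs_ReIm z : cabs z <= `|Re z| + `|Im z|.
Proof.
rewrite -[leRHS]ger0_norm ?addr_ge0// -sqrtr_sqr ler_wsqrtr//.
by rewrite sqrrD !real_normK ?num_real// lerD2r lerDl mulrn_wge0// mulr_ge0.
Qed.
Lemma ler_cabsD z w : cabs (z + w) <= cabs z + cabs w.
Proof.
by case: z => a b; case: w => a' b'; exact: (complex.le_normcD (cpx a b) (cpx a' b')).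
Qed.
Lemma ler_cabsB z w : cabs (z - w) <= cabs z + cabs w.
Proof. by rewrite -[cabs w]cabsN ler_cabsD. Qed.
Lemma ler_cabs_sum I (s : seq I) (P : pred I) (F : I -> C) :
  cabs (\sum_(i <- s | P i) F i) <= \sum_(i <- s | P i) cabs (F i).
Proof.
elim/big_rec2: _ => [|i y z _ IH]; first by rewrite cabs0.
by rewrite (le_trans (ler_cabsD _ _))// lerD2l.
Qed.

Lemma eixD a b : eix (a + b) = eix a * eix b.
Proof. by apply: complexE; rewrite ?cReM ?cImM/= ?cosD ?sinD//; ring. Qed.
Lemma eix0 : eix (0 : R) = 1. Proof. by rewrite /eix cos0 sin0. Qed.
Lemma eix_sum I (s : seq I) (P : pred I) (F : I -> R) :
  eix (\sum_(i <- s | P i) F i) = \prod_(i <- s | P i) eix (F i).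
Proof. by apply: (big_morph (@eix R)); [exact: eixD|exact: eix0]. Qed.
Lemma eixN a : eix (- a) = cconj (eix a).
Proof. by rewrite /eix /cconj cosN sinN. Qed.
Lemma sqnorm_eix a : sqnorm (eix a) = 1. Proof. exact: cos2Dsin2. Qed.
Lemma cabs_eix a : cabs (eix a) = 1.
Proof. by rewrite cabsE sqnorm_eix sqrtr1. Qed.
Lemma eix_2pi : eix (2 * pi : R) = 1.
Proof. by rewrite /eix mulr_natl cos2pi sin2pi. Qed.
Lemma eix_pi : eix (pi : R) = -1.
Proof. by apply: complexE; rewrite /= ?cospi ?sinpi ?oppr0. Qed.
Lemma eixMn a n : eix (n%:R * a) = eix a ^+ n.
Proof.
elim: n => [|n IH]; first by rewrite mul0r eix0 expr0.
by rewrite exprS -IH -eixD -natr1; congr eix; ring.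
Qed.
Lemma eix_mulz2pi (z : int) : eix (z%:~R * (2 * pi) : R) = 1.
Proof.
have H n : eix (n%:R * (2 * pi) : R) = 1 by rewrite eixMn eix_2pi expr1n.
case: z => n; first exact: H.
rewrite NegzE mulrNz mulNr eixN -pmulrn H.
by apply: complexE; rewrite /= ?oppr0.
Qed.

Lemma sqnorm_eixB1 a : sqnorm (eix a - 1) = 2 - 2 * cos a.
Proof.
rewrite /sqnorm cReD cImD cReN cImN/=; have := cos2Dsin2 a.
by rewrite oppr0 addr0; lra.
Qed.

End ComplexBasics.

Section Characters.
Variable R : realType.
Variable d : nat.
Local Notation C := (complex.complex R).
Implicit Types (k l : 'rV[int]_d) (x h : 'rV[R]_d).

Lemma expkD k l x : expk (k + l) x = expk k x * expk l x :> C.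
Proof.
rewrite /expk -eixD -big_split/=; congr eix; apply: eq_bigr => j _.
by rewrite mxE intrD mulrDl.
Qed.
Lemma expk0 x : expk 0 x = 1 :> C.
Proof. by rewrite /expk big1 ?eix0// => j _; rewrite mxE mul0r. Qed.
Lemma expk_shift k x h : expk k (x + h) = expk k x * expk k h :> C.
Proof.
rewrite /expk -eixD -big_split/=; congr eix; apply: eq_bigr => j _.
by rewrite mxE mulrDr.
Qed.
Lemma expkN k x : expk (- k) x = cconj (expk k x) :> C.
Proof.
rewrite /expk -eixN -sumrN; congr eix; apply: eq_bigr => j _.
by rewrite mxE mulrNz mulNr.
Qed.
Lemma expk_opp k x : expk k (- x) = expk (- k) x :> C.
Proof.
rewrite /expk; congr eix; apply: eq_bigr => j _.
by rewrite !mxE mulrNz mulNr mulrN.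
Qed.
Lemma expk_scale k x (a : int) : expk k (a%:~R *: x) = expk (a *: k) x :> C.
Proof.
rewrite /expk; congr eix; apply: eq_bigr => j _.
by rewrite !mxE intrM; ring.
Qed.
Lemma cabs_expk k x : cabs (expk k x : C) = 1. Proof. exact: cabs_eix. Qed.
Lemma sqnorm_expk k x : sqnorm (expk k x : C) = 1. Proof. exact: sqnorm_eix. Qed.
Lemma expk_delta k (t : R) (j : 'I_d) :
  expk k (t *: delta_mx ord0 j) = eix ((k ord0 j)%:~R * t) :> C.
Proof.
rewrite /expk (bigD1 j)//= big1 ?addr0 => [|i ij].
  by rewrite !mxE !eqxx mulr1.
by rewrite !mxE (negbTE ij) andbF mulr0 mulr0.
Qed.
Lemma expk_periodic k : Defs.periodic (expk k : 'rV[R]_d -> C).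
Proof. by move=> x j; rewrite expk_shift expk_delta eix_mulz2pi mulr1. Qed.

End Characters.

(** * Integration of complex functions on the torus *)

Section TorusIntegration.
Variable R : realType.
Variable d : nat.
Local Notation C := (complex.complex R).
Local Notation Re := (@complex.Re R).
Local Notation Im := (@complex.Im R).
Local Notation T := (Torus R d).
Local Notation P := (torus_prob R d).
Implicit Types (f g : 'rV[R]_d -> C) (u : 'rV[R]_d -> R).

Lemma cmeasurableP f : cmeasurable f <->
  measurable_fun setT (fun x : T => Re (f x)) /\ measurable_fun setT (fun x : T => Im (f x)).
Proof. by rewrite /cmeasurable !borel_funP. Qed.

Lemma cmeasurable_cst (c : C) : cmeasurable (fun _ : 'rV[R]_d => c).
Proof. by apply/cmeasurableP; split; exact: measurable_cst. Qed.

Lemma cmeasurableD f g : cmeasurable f -> cmeasurable g -> cmeasurable (fun x => f x + g x).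
Proof.
move=> /cmeasurableP[f1 f2] /cmeasurableP[g1 g2]; apply/cmeasurableP; split.
  rewrite (_ : (fun x => _) = (fun x : T => Re (f x) + Re (g x))); first exact: measurable_funD.
  by apply/funext => x; rewrite cReD.
rewrite (_ : (fun x => _) = (fun x : T => Im (f x) + Im (g x))); first exact: measurable_funD.
by apply/funext => x; rewrite cImD.
Qed.

Lemma cmeasurableM f g : cmeasurable f -> cmeasurable g -> cmeasurable (fun x => f x * g x).
Proof.
move=> /cmeasurableP[f1 f2] /cmeasurableP[g1 g2]; apply/cmeasurableP; split.
  rewrite (_ : (fun x => _) = (fun x : T => Re (f x) * Re (g x) - Im (f x) * Im (g x))).
    by apply: measurable_funB; exact: measurable_funM.
  by apply/funext => x; rewrite cReM.
rewrite (_ : (fun x => _) = (fun x : T => Re (f x) * Im (g x) + Im (f x) * Re (g x))).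
  by apply: measurable_funD; exact: measurable_funM.
by apply/funext => x; rewrite cImM.
Qed.

Lemma cmeasurableN f : cmeasurable f -> cmeasurable (fun x => - f x).
Proof.
move=> /cmeasurableP[f1 f2]; apply/cmeasurableP; split.
  rewrite (_ : (fun x => _) = (fun x : T => - Re (f x))); first exact: measurableT_comp.
  by apply/funext => x; rewrite cReN.
rewrite (_ : (fun x => _) = (fun x : T => - Im (f x))); first exact: measurableT_comp.
by apply/funext => x; rewrite cImN.
Qed.

Lemma cmeasurableB f g : cmeasurable f -> cmeasurable g -> cmeasurable (fun x => f x - g x).
Proof. by move=> mf mg; apply: cmeasurableD => //; exact: cmeasurableN. Qed.

Lemma cmeasurable_sum I (s : seq I) (F : I -> 'rV[R]_d -> C) :
  (forall i, cmeasurable (F i)) -> cmeasurable (fun x => \sum_(i <- s) F i x).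
Proof.
move=> mF; elim: s => [|i s IH].
  by under eq_fun do rewrite big_nil; exact: cmeasurable_cst.
by under eq_fun do rewrite big_cons; exact: cmeasurableD.
Qed.

Lemma cmeasurable_affine f (a : R) (b : 'rV[R]_d) : cmeasurable f ->
  cmeasurable (fun x => f (a *: x + b)).
Proof.
have maff : measurable_fun setT (fun x : T => (a *: x + b : T)).
  apply: measurable_fun_torus => i.
  rewrite (_ : (fun t => _) = (fun t : T => a * t ord0 i + b ord0 i)); last first.
    by apply/funext => t; rewrite !mxE.
  by apply: measurable_funD => //; apply: measurable_funM => //; exact: measurable_coord_torus.
move=> /cmeasurableP[f1 f2]; apply/cmeasurableP; split.
  exact: (measurableT_comp f1 maff).
exact: (measurableT_comp f2 maff).
Qed.

Lemma cmeasurable_shift f (b : 'rV[R]_d) : cmeasurable f -> cmeasurable (fun x => f (x + b)).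
Proof.
by move=> /(@cmeasurable_affine _ 1 b); under eq_fun do rewrite scale1r.
Qed.

Lemma cmeasurable_expk (k : 'rV[int]_d) : cmeasurable (expk k : 'rV[R]_d -> C).
Proof.
have m1 : measurable_fun setT (fun x : T => \sum_(j < d) ((k ord0 j)%:~R : R) * x ord0 j).
  apply: measurable_sum => j; apply: measurable_funM => //; exact: measurable_coord_torus.
apply/cmeasurableP; split => /=.
  by apply: measurableT_comp m1; apply: continuous_measurable_fun; exact: continuous_cos.
by apply: measurableT_comp m1; apply: continuous_measurable_fun; exact: continuous_sin.
Qed.

Lemma measurable_sqnorm f : cmeasurable f -> measurable_fun setT (fun x : T => sqnorm (f x)).
Proof.
by move=> /cmeasurableP[f1 f2]; apply: measurable_funD; exact: measurable_funX.
Qed.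

Lemma measurable_cabs f : cmeasurable f -> measurable_fun setT (fun x : T => cabs (f x)).
Proof.
move=> mf; apply: (measurableT_comp _ (measurable_sqnorm mf)).
by apply: continuous_measurable_fun; exact: sqrt_continuous.
Qed.

Lemma measurable_cabs_powR f (p : R) : cmeasurable f ->
  measurable_fun setT (fun x : T => (cabs (f x) `^ p)%:E).
Proof.
move=> mf; apply/measurable_EFinP; apply: (measurableT_comp (measurable_powR p)).
exact: measurable_cabs.
Qed.

Definition cintegrable f :=
  P.-integrable setT (fun x => (Re (f x))%:E) /\ P.-integrable setT (fun x => (Im (f x))%:E).

Local Open Scope ereal_scope.

Lemma cintegrable_cmeasurable f : cintegrable f -> cmeasurable f.
Proof.
move=> [/measurable_int /measurable_EFinP f1 /measurable_int /measurable_EFinP f2].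
by apply/cmeasurableP.
Qed.

Lemma cintegrable_lty f : cmeasurable f -> \int[P]_x (cabs (f x))%:E < +oo -> cintegrable f.
Proof.
move=> mf fi; have mc := measurable_cabs mf; move/cmeasurableP : mf => [f1 f2].
split; apply/integrableP; split; try exact/measurable_EFinP.
  apply: le_lt_trans fi; apply: ge0_le_integral => //; try exact/measurable_EFinP.
  - by apply: measurableT_comp => //; exact/measurable_EFinP.
  - by move=> x _; rewrite lee_fin ler_Re_cabs.
apply: le_lt_trans fi; apply: ge0_le_integral => //; try exact/measurable_EFinP.
- by apply: measurableT_comp => //; exact/measurable_EFinP.
- by move=> x _; rewrite lee_fin ler_Im_cabs.
Qed.

Lemma lty_cintegrable f : cintegrable f -> \int[P]_x (cabs (f x))%:E < +oo.
Proof.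
move=> fi; have mf := cintegrable_cmeasurable fi; have mc := measurable_cabs mf.
case: fi => /integrableP[f1 f1i] /integrableP[f2 f2i].
apply: (@le_lt_trans _ _ (\int[P]_x (`|(Re (f x))%:E| + `|(Im (f x))%:E|))).
  apply: ge0_le_integral => //.
  - by move=> x _; rewrite lee_fin cabs_ge0.
  - exact/measurable_EFinP.
  - by apply: emeasurable_funD; exact: measurableT_comp.
  - by move=> x _; rewrite lee_fin ler_cabs_ReIm.
by rewrite ge0_integralD//; [exact: lte_add_pinfty|exact: measurableT_comp..].
Qed.

Lemma cintegrable_bounded f (M : R) : cmeasurable f -> (forall x, cabs (f x) <= M)%R ->
  cintegrable f.
Proof.
move=> mf fM; apply: cintegrable_lty => //.
apply: (@le_lt_trans _ _ (\int[P]_x (cst M%:E x))).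
  apply: ge0_le_integral => //.
  - by move=> x _; rewrite lee_fin cabs_ge0.
  - by apply/measurable_EFinP; exact: measurable_cabs.
  - by move=> x _; rewrite lee_fin.
by rewrite integral_cst// [X in _ * X](_ : _ = 1) ?mule1 ?ltry//; exact: probability_setT.
Qed.

Lemma cintegrableD f g : cintegrable f -> cintegrable g -> cintegrable (fun x => f x + g x)%R.
Proof.
move=> [f1 f2] [g1 g2]; split.
  rewrite (_ : (fun x => _) = (fun x : T => (Re (f x))%:E + (Re (g x))%:E)); first exact: integrableD.
  by apply/funext => x; rewrite cReD.
rewrite (_ : (fun x => _) = (fun x : T => (Im (f x))%:E + (Im (g x))%:E)); first exact: integrableD.
by apply/funext => x; rewrite cImD.
Qed.

Lemma cintegrableM f g (M : R) : cintegrable f -> cmeasurable g -> (forall x, cabs (g x) <= M)%R ->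
  cintegrable (fun x => f x * g x)%R.
Proof.
move=> fi mg gM; have mf := cintegrable_cmeasurable fi.
have M0 : (0 <= M)%R by apply: le_trans (gM 0%R); exact: cabs_ge0.
apply: cintegrable_lty; first exact: cmeasurableM.
apply: (@le_lt_trans _ _ (\int[P]_x (M%:E * (cabs (f x))%:E))).
  apply: ge0_le_integral => //.
  - by move=> x _; rewrite lee_fin cabs_ge0.
  - by apply/measurable_EFinP; apply: measurable_cabs; exact: cmeasurableM.
  - by apply: measurable_funeM; apply/measurable_EFinP; exact: measurable_cabs.
  - by move=> x _; rewrite lee_fin cabsM mulrC ler_wpM2r// cabs_ge0.
rewrite ge0_integralZl//.
- by apply: lte_mul_pinfty => //; exact: lty_cintegrable.
- by apply/measurable_EFinP; exact: measurable_cabs.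
- by move=> x _; rewrite lee_fin cabs_ge0.
Qed.

Lemma cintegrableZ (c : C) f : cintegrable f -> cintegrable (fun x => c * f x)%R.
Proof.
move=> fi; have := @cintegrableM f (fun _ => c) (cabs c) fi (cmeasurable_cst c) (fun _ => lexx _).
by under eq_fun do rewrite mulrC.
Qed.

Lemma cintegrable_sum I (s : seq I) (F : I -> 'rV[R]_d -> C) :
  (forall i, cintegrable (F i)) -> cintegrable (fun x => \sum_(i <- s) F i x)%R.
Proof.
move=> mF; elim: s => [|i s IH].
  under eq_fun do rewrite big_nil; apply: (@cintegrable_bounded _ 0%R) => [|x].
    exact: cmeasurable_cst.
  by rewrite cabs0.
by under eq_fun do rewrite big_cons; exact: cintegrableD.
Qed.

Lemma cintegrable_expk k : cintegrable (expk k : 'rV[R]_d -> C).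
Proof.
by apply: (@cintegrable_bounded _ 1%R) => [|x]; [exact: cmeasurable_expk|rewrite cabs_expk].
Qed.

Lemma torus_rintE u : P.-integrable setT (fun x => (u x)%:E) ->
  torus_rint u = fine (\int[P]_x (u x)%:E).
Proof.
move=> ui; have mu : measurable_fun setT (u : T -> R).
  by apply/measurable_EFinP; exact: measurable_int ui.
have H (v : T -> R) : measurable_fun setT v ->
    torus_int (fun x => (Num.max (v x) 0)%:E)%R = \int[P]_x (Num.max (v x) 0)%:E.
  move=> mv; apply: torus_intE; first by apply/measurable_EFinP; exact: measurable_maxr.
  by move=> x; rewrite lee_fin le_max lexx orbT.
rewrite /torus_rint H// (H (fun x => - u x)%R); last exact: measurableT_comp.
rewrite [in RHS]integralE [RHS]fineB//; last 2 first.
- exact: integrable_pos_fin_num.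
- exact: integrable_neg_fin_num.
congr (fine _ - fine _)%R; apply: eq_integral => x _.
  by rewrite funeposE EFin_max.
by rewrite funenegE EFin_max.
Qed.

Lemma torus_cintE f : cintegrable f -> torus_cint f =
  cpx (fine (\int[P]_x (Re (f x))%:E)) (fine (\int[P]_x (Im (f x))%:E)).
Proof. by move=> [f1 f2]; rewrite /torus_cint !torus_rintE. Qed.

Lemma torus_cintD f g : cintegrable f -> cintegrable g ->
  torus_cint (fun x => f x + g x)%R = (torus_cint f + torus_cint g)%R.
Proof.
move=> fi gi; rewrite !torus_cintE//; last exact: cintegrableD.
case: fi gi => [f1 f2] [g1 g2]; apply: complexE; rewrite ?cReD ?cImD/=.
  under eq_integral do rewrite cReD EFinD.
  by rewrite integralD// fineD//; exact: integrable_fin_num.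
under eq_integral do rewrite cImD EFinD.
by rewrite integralD// fineD//; exact: integrable_fin_num.
Qed.

Lemma torus_cintZ (c : C) f : cintegrable f ->
  torus_cint (fun x => c * f x)%R = (c * torus_cint f)%R.
Proof.
move=> fi; rewrite !torus_cintE//; last exact: cintegrableZ.
have zi a u : P.-integrable setT (fun x => (u x)%:E) ->
    P.-integrable setT (fun x => a%:E * (u x)%:E) by exact: integrableZl.
case: fi => [f1 f2]; apply: complexE; rewrite ?cReM ?cImM/=.
  under eq_integral do rewrite cReM EFinB !EFinM.
  rewrite integralB//; try exact: zi.
  rewrite fineB; try (by apply: integrable_fin_num => //; exact: zi).
  by rewrite !integralZl// !fineM//; exact: integrable_fin_num.
under eq_integral do rewrite cImM EFinD !EFinM.
rewrite integralD//; try exact: zi.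
rewrite fineD; try (by apply: integrable_fin_num => //; exact: zi).
by rewrite !integralZl// !fineM//; exact: integrable_fin_num.
Qed.

Lemma torus_cint_cst (c : C) : torus_cint (fun _ : 'rV[R]_d => c) = c.
Proof.
rewrite torus_cintE; last first.
  by apply: (@cintegrable_bounded _ (cabs c)) => //; exact: cmeasurable_cst.
have PT : P setT = 1 by exact: probability_setT.
by apply: complexE; rewrite /= integral_cst//= PT mule1.
Qed.

Lemma torus_cint_sum I (s : seq I) (F : I -> 'rV[R]_d -> C) : (forall i, cintegrable (F i)) ->
  torus_cint (fun x => \sum_(i <- s) F i x)%R = (\sum_(i <- s) torus_cint (F i))%R.
Proof.
move=> mF; elim: s => [|i s IH].
  by under eq_fun do rewrite big_nil; rewrite torus_cint_cst big_nil.
under eq_fun do rewrite big_cons; rewrite torus_cintD//; last exact: cintegrable_sum.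
by rewrite IH big_cons.
Qed.

Lemma torus_rint_affine (a : int) (b : 'rV[R]_d) u : a != 0%R ->
  measurable_fun setT (u : T -> R) ->
  (forall (x : 'rV[R]_d) (j : 'I_d), u (x + (2 * pi) *: delta_mx ord0 j)%R = u x) ->
  torus_rint (fun x => u (a%:~R *: x + b)%R) = torus_rint u.
Proof.
move=> a0 mu uper.
have H (v : T -> R) : measurable_fun setT v ->
  (forall (x : 'rV[R]_d) (j : 'I_d), v (x + (2 * pi) *: delta_mx ord0 j)%R = v x) ->
  torus_int (fun x => (Num.max (v (a%:~R *: x + b)) 0)%:E)%R = torus_int (fun x => (Num.max (v x) 0)%:E)%R.
  move=> mv vper; pose g := (fun x => (Num.max (v x) 0)%:E) : T -> \bar R.
  have mg : measurable_fun setT g by apply/measurable_EFinP; exact: measurable_maxr.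
  have g0 x : 0 <= g x by rewrite lee_fin le_max lexx orbT.
  have maff : measurable_fun setT (fun x : T => (a%:~R *: x + b : T)%R).
    apply: measurable_fun_torus => i.
    rewrite (_ : (fun t => _) = (fun t : T => a%:~R * t ord0 i + b ord0 i)%R); last first.
      by apply/funext => t; rewrite !mxE.
    by apply: measurable_funD => //; apply: measurable_funM => //; exact: measurable_coord_torus.
  rewrite (torus_intE mg g0) (@torus_intE _ _ (fun x => g (a%:~R *: x + b)%R)) => [|//|x]; last exact: g0.
    by apply: (@integral_torus_affine _ _ _ _ g) => // x j; rewrite /g vper.
  exact: (measurableT_comp mg maff).
rewrite /torus_rint H// (H (fun x => - u x)%R)//; first exact: measurableT_comp.
by move=> x j; rewrite uper.
Qed.

Lemma torus_cint_affine (a : int) (b : 'rV[R]_d) f : a != 0%R -> cmeasurable f ->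
  Defs.periodic f -> torus_cint (fun x => f (a%:~R *: x + b)%R) = torus_cint f.
Proof.
move=> a0 /cmeasurableP[f1 f2] fper; rewrite /torus_cint.
rewrite (@torus_rint_affine a b (fun x => Re (f x)))//; last by move=> x j; rewrite fper.
by rewrite (@torus_rint_affine a b (fun x => Im (f x)))// => x j; rewrite fper.
Qed.

Lemma torus_cint_shift (b : 'rV[R]_d) f : cmeasurable f -> Defs.periodic f ->
  torus_cint (fun x => f (x + b)%R) = torus_cint f.
Proof.
move=> mf pf; rewrite -(@torus_cint_affine 1 b f)//.
by congr torus_cint; apply/funext => x; rewrite scale1r.
Qed.

(** Real and imaginary parts are estimated separately, hence the factor 2. *)
Lemma cabs_torus_cint f : cintegrable f ->
  (cabs (torus_cint f))%:E <= 2%:E * \int[P]_x (cabs (f x))%:E.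
Proof.
move=> fi; have mc := measurable_cabs (cintegrable_cmeasurable fi).
have H u : P.-integrable setT (fun x => (u x)%:E) -> (forall x, `|u x| <= cabs (f x))%R ->
    (`|fine (\int[P]_x (u x)%:E)|)%:E <= \int[P]_x (cabs (f x))%:E.
  move=> ui uf; rewrite -abse_EFin fineK; last exact: integrable_fin_num.
  apply: (le_trans (le_abse_integral _ _ _)) => //; first exact: measurable_int ui.
  apply: ge0_le_integral => //.
  - by apply: measurableT_comp => //; exact: measurable_int ui.
  - exact/measurable_EFinP.
  - by move=> x _; rewrite lee_fin.
case: (fi) => f1 f2; rewrite torus_cintE//.
apply: (@le_trans _ _ (`|fine (\int[P]_x (Re (f x))%:E)|%:E + `|fine (\int[P]_x (Im (f x))%:E)|%:E)).
  by rewrite -EFinD lee_fin; exact: ler_cabs_ReIm.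
rewrite (_ : 2%:E = 1 + 1)// ge0_muleDl// !mul1e leeD// H// => x.
  exact: ler_Re_cabs.
exact: ler_Im_cabs.
Qed.

(* A nontrivial character takes the value -1 somewhere; translate by that point. *)
Lemma torus_cint_expk k : torus_cint (expk k : 'rV[R]_d -> C) = rC (k == 0%R)%:R.
Proof.
have [->|k0] := eqVneq k 0%R.
  rewrite (_ : expk 0 = fun _ => 1%R); first by rewrite torus_cint_cst.
  by apply/funext => x; rewrite expk0.
have [j kj] : exists j, k ord0 j != 0%R.
  apply/existsP; apply: contraNT k0 => /existsPn h; apply/eqP/rowP => j.
  by have := h j; rewrite mxE negbK => /eqP.
pose b : 'rV[R]_d := (pi / (k ord0 j)%:~R)%R *: delta_mx ord0 j.
have eb : expk k b = (-1)%R :> C.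
  by rewrite expk_delta mulrCA divff ?intr_eq0// mulr1 eix_pi.
have := torus_cint_shift b (cmeasurable_expk k) (@expk_periodic R d k).
have -> : (fun x => expk k (x + b)) = (fun x => (-1) * expk k x)%R :> ('rV[R]_d -> C).
  by apply/funext => x; rewrite expk_shift eb mulrC.
rewrite torus_cintZ; last exact: cintegrable_expk.
move: (torus_cint _) => z; rewrite mulN1r => h; apply: complexE => /=.
  by move/(congr1 Re) : h; rewrite cReN; lra.
by move/(congr1 Im) : h; rewrite cImN; lra.
Qed.

End TorusIntegration.

(** * Fourier coefficients, Parseval's identity and Bessel's inequality *)

Section Fourier.
Variable R : realType.
Variable d : nat.
Local Notation C := (complex.complex R).
Local Notation Re := (@complex.Re R).
Local Notation Im := (@complex.Im R).
Local Notation T := (Torus R d).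
Local Notation P := (torus_prob R d).
Implicit Types (f g : 'rV[R]_d -> C) (k l : 'rV[int]_d).

Definition fcoef f k : C := torus_cint (fun x => f x * expk (- k) x).

Definition trigpoly (s : seq 'rV[int]_d) (c : 'rV[int]_d -> C) (x : 'rV[R]_d) : C :=
  \sum_(k <- s) c k * expk k x.

Lemma eq_cintegrable f g : (forall x, f x = g x) -> cintegrable g -> cintegrable f.
Proof. by move=> /funext ->. Qed.

Lemma cintegrable_fcoef f k : cintegrable f -> cintegrable (fun x => f x * expk k x).
Proof.
move=> fi; apply: (@cintegrableM _ _ _ _ 1) => // [|x]; first exact: cmeasurable_expk.
by rewrite cabs_expk.
Qed.

Lemma fcoefD f g k : cintegrable f -> cintegrable g ->
  fcoef (fun x => f x + g x) k = fcoef f k + fcoef g k.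
Proof.
move=> fi gi; rewrite /fcoef -torus_cintD; try exact: cintegrable_fcoef.
by congr torus_cint; apply/funext => x; rewrite mulrDl.
Qed.

Lemma fcoefZ (c : C) f k : cintegrable f -> fcoef (fun x => c * f x) k = c * fcoef f k.
Proof.
move=> fi; rewrite /fcoef -torus_cintZ; last exact: cintegrable_fcoef.
by congr torus_cint; apply/funext => x; rewrite mulrA.
Qed.

Lemma cintegrableN f : cintegrable f -> cintegrable (fun x => - f x).
Proof.
by move=> /(cintegrableZ (-1)); congr cintegrable; apply/funext => x; rewrite mulN1r.
Qed.

Lemma fcoefB f g k : cintegrable f -> cintegrable g ->
  fcoef (fun x => f x - g x) k = fcoef f k - fcoef g k.
Proof.
move=> fi gi; rewrite fcoefD//; last exact: cintegrableN.
congr (_ + _); rewrite -mulN1r -fcoefZ//; congr fcoef.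
by apply/funext => x; rewrite mulN1r.
Qed.

Lemma fcoef_expk k l : fcoef (expk l) k = rC (l == k)%:R.
Proof.
rewrite /fcoef (_ : (fun x => _) = expk (l - k)); first by rewrite torus_cint_expk subr_eq0.
by apply/funext => x; rewrite expkD.
Qed.

Lemma cintegrable_trigpoly s c : cintegrable (trigpoly s c).
Proof.
apply: cintegrable_sum => k; apply: cintegrableZ; exact: cintegrable_expk.
Qed.

Lemma fcoef_sum I (s : seq I) (F : I -> 'rV[R]_d -> C) k : (forall i, cintegrable (F i)) ->
  fcoef (fun x => \sum_(i <- s) F i x) k = \sum_(i <- s) fcoef (F i) k.
Proof.
move=> Fi; rewrite /fcoef -torus_cint_sum => [|i]; last exact: cintegrable_fcoef.
by congr torus_cint; apply/funext => x; rewrite mulr_suml.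
Qed.

Lemma fcoef_trigpoly s c k : uniq s -> fcoef (trigpoly s c) k = if k \in s then c k else 0.
Proof.
move=> us; rewrite fcoef_sum => [|l]; last by apply: cintegrableZ; exact: cintegrable_expk.
rewrite (eq_bigr (fun l => c l * rC (l == k)%:R)) => [|l _]; last first.
  by rewrite fcoefZ ?fcoef_expk//; exact: cintegrable_expk.
case: ifPn => ks.
  rewrite (bigD1_seq k)//= eqxx mulr1 big1 ?addr0// => l lk.
  by rewrite (negbTE lk) mulr0.
rewrite big_seq big1// => l ls; have [lk|] := eqVneq l k; last by rewrite mulr0.
by move: ks; rewrite -lk ls.
Qed.

Lemma cintegrable_shift f h : cintegrable f -> Defs.periodic f -> cintegrable (fun x => f (x + h)).
Proof.
move=> fi pf; have mf := cintegrable_cmeasurable fi.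
apply: cintegrable_lty; first exact: cmeasurable_shift.
have := @integral_torus_affine R d 1 h (fun x => (cabs (f x))%:E).
under eq_integral do rewrite scale1r; move=> -> //; first exact: lty_cintegrable.
- by apply/measurable_EFinP; exact: measurable_cabs.
- by move=> x; rewrite lee_fin cabs_ge0.
- by move=> x j; rewrite pf.
Qed.

Lemma fcoef_shift f h k : cintegrable f -> Defs.periodic f ->
  fcoef (fun x => f (x + h)) k = expk k h * fcoef f k.
Proof.
move=> fi pf; have fki := cintegrable_fcoef (- k) fi.
rewrite /fcoef -torus_cintZ// -(@torus_cint_shift _ _ h (fun x => expk k h * (f x * expk (- k) x))).
- congr torus_cint; apply/funext => x.
  rewrite expk_shift mulrCA; congr (_ * _).
  by rewrite mulrCA -expkD subrr expk0 mulr1.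
- by apply: cintegrable_cmeasurable; exact: cintegrableZ.
- by move=> x j; rewrite pf expk_periodic.
Qed.

(** The multiplier [(expk k h - 1)^n] is what later converts smoothness into decay of coefficients.
    Integrability and periodicity travel along because the induction shifts the function once
    more. *)
Lemma fdiffk_props f h n : cintegrable f -> Defs.periodic f ->
  [/\ cintegrable (fdiffk n h f), Defs.periodic (fdiffk n h f) &
      forall k, fcoef (fdiffk n h f) k = (expk k h - 1) ^+ n * fcoef f k].
Proof.
move=> fi pf; elim: n => [|n [gi pg gE]].
  by split => // k; rewrite expr0 mul1r.
rewrite /fdiffk iterS -/(fdiffk n h f); set g := fdiffk n h f in gi pg gE *.
have ghi := cintegrable_shift h gi pg.
split=> [|x j|k].
- by apply: cintegrableD => //; exact: cintegrableN.
- by rewrite /fdiff addrAC !pg.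
- by rewrite fcoefB// fcoef_shift// gE exprS mulrBl mul1r mulrBl mulrA.
Qed.

Local Open Scope ereal_scope.

Lemma parseval_trigpoly s c : uniq s ->
  \int[P]_x (sqnorm (trigpoly s c x))%:E = (\sum_(k <- s) sqnorm (c k))%:E.
Proof.
move=> us; set S := trigpoly s c.
have Si : cintegrable S by exact: cintegrable_trigpoly.
have mS := cintegrable_cmeasurable Si.
have SE x : (S x * cconj (S x))%R = (\sum_(l <- s) cconj (c l) * (S x * expk (- l) x))%R.
  rewrite /S /trigpoly cconj_sum mulr_sumr; apply: eq_bigr => l _.
  by rewrite cconjM -expkN mulrCA.
have SSi : cintegrable (fun x => S x * cconj (S x))%R.
  apply: (eq_cintegrable SE).
  by apply: cintegrable_sum => l; apply: cintegrableZ; exact: cintegrable_fcoef.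
have : torus_cint (fun x => S x * cconj (S x))%R = rC (\sum_(k <- s) sqnorm (c k))%R.
  under eq_fun do rewrite SE.
  rewrite torus_cint_sum => [|l]; last by apply: cintegrableZ; exact: cintegrable_fcoef.
  rewrite rC_sum big_seq [RHS]big_seq; apply: eq_bigr => l ls.
  rewrite torus_cintZ; last exact: cintegrable_fcoef.
  by rewrite -/(fcoef S l) fcoef_trigpoly// ls mulrC mul_cconj.
rewrite torus_cintE// => /(congr1 Re)/= <-.
rewrite fineK; last by apply: integrable_fin_num => //; case: SSi.
by apply: eq_integral => x _; rewrite mul_cconj.
Qed.

(** Let [S] be the partial sum of [f] over [s]. The integrals of [f conj(S)] and of [|S|^2] both
    equal [B], so integrating [2 Re(f conj(S)) <= |f|^2 + |S|^2] gives [2 B <= B] plus the integral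
    of [|f|^2]. *)
Lemma bessel f s : cmeasurable f -> \int[P]_x (sqnorm (f x))%:E < +oo -> uniq s ->
  (\sum_(k <- s) sqnorm (fcoef f k))%:E <= \int[P]_x (sqnorm (f x))%:E.
Proof.
move=> mf f2 us.
have m2 := measurable_sqnorm mf.
have f2i : P.-integrable setT (fun x => (sqnorm (f x))%:E).
  apply/integrableP; split; first exact/measurable_EFinP.
  by under eq_integral do rewrite gee0_abs ?lee_fin ?sqnorm_ge0//.
have fi : cintegrable f.
  apply: cintegrable_lty => //.
  apply: (@le_lt_trans _ _ (\int[P]_x (1 + (sqnorm (f x))%:E))).
    apply: ge0_le_integral => //.
    - by move=> x _; rewrite lee_fin cabs_ge0.
    - by apply/measurable_EFinP; exact: measurable_cabs.
    - by apply: emeasurable_funD => //; exact/measurable_EFinP.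
    - by move=> x _; rewrite -EFinD lee_fin -sqr_cabs; have := sqr_ge0 (cabs (f x) - 1)%R; have := cabs_ge0 (f x); nra.
  rewrite ge0_integralD//; [|by move=> x _; rewrite lee_fin sqnorm_ge0|exact/measurable_EFinP].
  rewrite integral_cst// mul1e; apply: lte_add_pinfty => //.
  by rewrite [X in X < _](_ : _ = 1) ?ltry//; exact: probability_setT.
pose c k := fcoef f k; set S := trigpoly s c.
have Si : cintegrable S by exact: cintegrable_trigpoly.
have mS := cintegrable_cmeasurable Si.
pose B := (\sum_(k <- s) sqnorm (c k))%R.
have fSE x : (f x * cconj (S x))%R = (\sum_(l <- s) cconj (c l) * (f x * expk (- l) x))%R.
  rewrite /S /trigpoly cconj_sum mulr_sumr; apply: eq_bigr => l _.
  by rewrite cconjM -expkN mulrCA.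
have fSi : cintegrable (fun x => f x * cconj (S x))%R.
  apply: (eq_cintegrable fSE).
  by apply: cintegrable_sum => l; apply: cintegrableZ; exact: cintegrable_fcoef.
have : torus_cint (fun x => f x * cconj (S x))%R = rC B.
  under eq_fun do rewrite fSE.
  rewrite torus_cint_sum => [|l]; last by apply: cintegrableZ; exact: cintegrable_fcoef.
  rewrite rC_sum; apply: eq_bigr => l _.
  rewrite torus_cintZ; last exact: cintegrable_fcoef.
  by rewrite -/(fcoef f l) mulrC mul_cconj.
rewrite torus_cintE// => /(congr1 Re)/= BE.
have {}BE : \int[P]_x (Re (f x * cconj (S x)))%:E = B%:E.
  by rewrite -BE fineK//; apply: integrable_fin_num => //; case: fSi.
have S2 : \int[P]_x (sqnorm (S x))%:E = B%:E by exact: parseval_trigpoly.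
have S2i : P.-integrable setT (fun x => (sqnorm (S x))%:E).
  apply/integrableP; split; first by apply/measurable_EFinP; exact: measurable_sqnorm.
  under eq_integral do rewrite gee0_abs ?lee_fin ?sqnorm_ge0//.
  by rewrite S2 ltry.
have : \int[P]_x (2%:E * (Re (f x * cconj (S x)))%:E) <=
    \int[P]_x ((sqnorm (f x))%:E + (sqnorm (S x))%:E).
  apply: le_integral => //.
  - by apply: integrableZl => //; case: fSi.
  - exact: integrableD.
  - move=> x _; rewrite -EFinM -EFinD lee_fin cReM/=.
    have := sqnorm_ge0 (f x - S x)%R.
    by rewrite /sqnorm cReD cImD cReN cImN; nra.
rewrite integralZl//; last by case: fSi.
rewrite integralD// BE S2.
have A : \int[P]_x (sqnorm (f x))%:E \is a fin_num by exact: integrable_fin_num.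
by rewrite -(fineK A) -[2 * B%:E]/((2 * B)%:E) -EFinD !lee_fin -/B; lra.
Qed.

End Fourier.

(** * De la Vallee-Poussin multipliers and dyadic levels of frequencies *)

Section ValleePoussin.
Variable R : realType.
Local Notation C := (complex.complex R).

Definition zrange (N : nat) : seq int := [seq i%:Z - N%:Z | i <- iota 0 (2 * N).+1].

Lemma mem_zrange N (z : int) : (z \in zrange N) = (`|z| <= N)%N.
Proof.
apply/mapP/idP => [[i]|zN]; first by rewrite mem_iota => iN ->; lia.
by exists (absz (z + N%:Z)); rewrite ?mem_iota; lia.
Qed.

Lemma uniq_zrange N : uniq (zrange N).
Proof. by rewrite map_inj_uniq ?iota_uniq// => i j; lia. Qed.

Lemma sum_zrange_le (N n : nat) (F : int -> C) : (n <= N)%N ->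
  \sum_(z <- zrange n) F z = \sum_(z <- zrange N | (`|z| <= n)%N) F z.
Proof.
move=> nN; rewrite -[RHS]big_filter; apply: perm_big; apply: uniq_perm.
- exact: uniq_zrange.
- by rewrite filter_uniq// uniq_zrange.
- by move=> z; rewrite mem_filter !mem_zrange; lia.
Qed.

Lemma sum_zrange N (F : int -> C) :
  \sum_(z <- zrange N) F z = \sum_(i < (2 * N).+1) F (i%:Z - N%:Z).
Proof. by rewrite big_map -(big_mkord xpredT (fun j => F (j%:Z - N%:Z))) /index_iota subn0. Qed.

Lemma dirichletE n (t : R) : dirichlet n t = \sum_(z <- zrange n) eix (z%:~R * t).
Proof. by rewrite sum_zrange. Qed.

(** The Fourier coefficient at [z] of the one-dimensional kernel, that is the proportion of averaged
    Dirichlet kernels that contain [z]: a trapezoid equal to 1 up to [l] and to 0 from [2 l] on. *)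
Definition vpweight (l : nat) (z : int) : R :=
  l%:R^-1 * \sum_(l <= k < 2 * l) (`|z| <= k)%N%:R.

Lemma vp1E l (t : R) :
  vp1 l t = \sum_(z <- zrange (2 * l)) rC (vpweight l z) * eix (z%:~R * t).
Proof.
rewrite /vp1 mulr_sumr.
under [RHS]eq_bigr => z _ do rewrite /vpweight mulr_sumr rC_sum mulr_suml.
rewrite exchange_big/= big_nat [RHS]big_nat; apply: eq_bigr => k /andP[_ k2l].
rewrite dirichletE (@sum_zrange_le (2 * l)) 1?ltnW// big_mkcond mulr_sumr.
apply: eq_bigr => z _; rewrite rCM -mulrA; congr (_ * _).
by case: ifP => _; rewrite ?rC1 ?rC0 ?mul1r ?mul0r.
Qed.

Lemma vpweight_ge0 l z : 0 <= vpweight l z.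
Proof. by rewrite mulr_ge0 ?invr_ge0 ?sumr_ge0. Qed.

Lemma vpweight_le1 l z : vpweight l z <= 1.
Proof.
case: l => [|l]; first by rewrite /vpweight big_geq// mulr0.
rewrite /vpweight mulrC ler_pdivrMr ?mul1r ?ltr0n//.
have -> : (l.+1%:R : R) = \sum_(l.+1 <= k < 2 * l.+1) 1.
  by rewrite sumr_const_nat mul2n -addnn addnK.
by apply: ler_sum => k _; rewrite lern1 leq_b1.
Qed.

Lemma vpweight1 l z : (0 < l)%N -> (`|z| <= l)%N -> vpweight l z = 1.
Proof.
move=> l0 zl; rewrite /vpweight big_nat (eq_bigr (fun=> 1)).
  by rewrite -big_nat sumr_const_nat mul2n -addnn addnK mulVf// pnatr_eq0 -lt0n.
by move=> k /andP[lk _]; rewrite (leq_trans zl lk).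
Qed.

Lemma vpweight0 l z : (2 * l <= `|z|)%N -> vpweight l z = 0.
Proof.
move=> zl; rewrite /vpweight big_nat big1 ?mulr0// => k /andP[_ kl].
by rewrite leqNgt (leq_trans kl zl).
Qed.

(** At least half of the [l] averaged cut-offs reach [|z|]. The spectrum of the extremal polynomial
    of the lower bound is placed in this range. *)
Lemma vpweight_ge_half l z : (0 < l)%N -> (2 * `|z| <= 3 * l)%N -> 2^-1 <= vpweight l z.
Proof.
move=> l0 zl; rewrite /vpweight.
have l0R : (0 : R) < l%:R by rewrite ltr0n.
rewrite mulrC ler_pdivlMr//.
apply: (@le_trans _ _ (\sum_(maxn l `|z| <= k < 2 * l) 1)).
  rewrite sumr_const_nat ler_pdivrMl// -natrM ler_nat; lia.
rewrite (@big_cat_nat _ _ _ (maxn l `|z|) l (2 * l))/=; [|lia|lia].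
rewrite -[leLHS]add0r lerD ?sumr_ge0// big_nat [leRHS]big_nat ler_sum// => k kl.
by rewrite (_ : (`|z| <= k)%N = true)//; lia.
Qed.

Variable d : nat.
Implicit Types (f : 'rV[R]_d -> C) (k : 'rV[int]_d).

Definition nrm k : nat := (\max_(j < d) absz (k ord0 j))%N.

Lemma nrm_leP k N : reflect (forall j, (`|k ord0 j| <= N)%N) (nrm k <= N)%N.
Proof.
apply: (iffP (bigmax_leqP _ _ _)) => [h j|h j _]; first exact: h.
exact: h.
Qed.

Lemma leq_nrm k j : (`|k ord0 j| <= nrm k)%N.
Proof. exact: (elimT (nrm_leP k (nrm k))). Qed.

Lemma nrm_geP k N : (0 < N)%N -> reflect (exists j, (N <= `|k ord0 j|)%N) (N <= nrm k)%N.
Proof.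
case: N => // N _; rewrite ltnNge; apply: (iffP idP) => [|[j jN]].
  move=> /nrm_leP h; apply/not_existsP => h'; apply: h => j.
  by have := h' j; rewrite ltnNge => /negP; rewrite negbK.
by apply/nrm_leP => h; have := h j; rewrite leqNgt jN.
Qed.

Definition box (N : nat) : seq 'rV[int]_d :=
  [seq \row_j ((phi j)%:Z - N%:Z) | phi : {ffun 'I_d -> 'I_(2 * N).+1}].

Lemma mem_box N k : (k \in box N) = (nrm k <= N)%N.
Proof.
apply/codomP/nrm_leP => [[phi ->] j|h].
  by rewrite mxE; move: (phi j) => [i /= iN]; lia.
have hb j : (absz (k ord0 j + N%:Z)%R < (2 * N).+1)%N by have := h j; lia.
exists [ffun j => Ordinal (hb j)]; apply/rowP => j.
by rewrite !mxE ffunE/= (ord1 0); have := h j; rewrite (ord1 ord0); lia.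
Qed.

Lemma uniq_box N : uniq (box N).
Proof.
rewrite map_inj_uniq ?enum_uniq// => phi psi /rowP h; apply/ffunP => j.
by have := h j; rewrite !mxE => E; apply/val_inj => /=; lia.
Qed.

Lemma size_box N : size (box N) = ((2 * N).+1 ^ d)%N.
Proof. by rewrite size_map -cardE card_ffun !card_ord. Qed.

Lemma sum_box_le (N n : nat) (F : 'rV[int]_d -> C) : (n <= N)%N ->
  (forall k, (n < nrm k)%N -> F k = 0) ->
  \sum_(k <- box n) F k = \sum_(k <- box N) F k.
Proof.
move=> nN F0; rewrite [RHS](bigID (fun k => (nrm k <= n)%N))/= [X in _ + X]big1 ?addr0; last first.
  by move=> k; rewrite -ltnNge; exact: F0.
rewrite -[RHS]big_filter; apply: perm_big; apply: uniq_perm.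
- exact: uniq_box.
- by rewrite filter_uniq// uniq_box.
- by move=> z; rewrite mem_filter !mem_box; lia.
Qed.

Definition vpW (l : nat) k : R := \prod_(j < d) vpweight l (k ord0 j).

Lemma vpW_ge0 l k : 0 <= vpW l k.
Proof. by rewrite prodr_ge0// => j _; exact: vpweight_ge0. Qed.

Lemma vpW_le1 l k : vpW l k <= 1.
Proof. by rewrite prodr_ile1// => j _; rewrite vpweight_ge0 vpweight_le1. Qed.

Lemma vpW1 l k : (0 < l)%N -> (nrm k <= l)%N -> vpW l k = 1.
Proof. by move=> l0 /nrm_leP kl; rewrite /vpW big1// => j _; exact: vpweight1. Qed.

Lemma vpW0 l k : (0 < l)%N -> (2 * l <= nrm k)%N -> vpW l k = 0.
Proof.
move=> l0 /nrm_geP[|j jl]; first by rewrite muln_gt0.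
by rewrite /vpW (bigD1 j)//= vpweight0// mul0r.
Qed.

Lemma vpW_ge_half l k : (0 < l)%N -> (2 * nrm k <= 3 * l)%N -> 2^-1 ^+ d <= vpW l k.
Proof.
move=> l0 kl; rewrite -[X in 2^-1 ^+ X]card_ord -prodr_const ler_prod// => j _.
by rewrite invr_ge0 ler0n/= vpweight_ge_half//; have := leq_nrm k j; lia.
Qed.

Lemma vpdE l (x : 'rV[R]_d) :
  vpd l x = \sum_(k <- box (2 * l)) rC (vpW l k) * expk k x.
Proof.
rewrite /vpd; under eq_bigr => j _ do rewrite vp1E sum_zrange.
rewrite bigA_distr_bigA/= /box big_image/=; apply: eq_bigr => phi _.
rewrite /vpW rC_prod /expk eix_sum -big_split/=; apply: eq_bigr => j _.
by rewrite mxE.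
Qed.

(** The substitution of [x - y] for [y], an affine map with [a = -1], turns convolution with a
    character into a coefficient times that character. *)
Lemma fcoef_reflect f k x : cintegrable f -> Defs.periodic f ->
  cintegrable (fun y => f (x - y) * expk k y) /\
  torus_cint (fun y => f (x - y) * expk k y) = fcoef f k * expk k x.
Proof.
move=> fi pf; pose g y := f y * expk (- k) y.
have gi : cintegrable g by exact: cintegrable_fcoef.
have mg := cintegrable_cmeasurable gi.
have pg : Defs.periodic g by move=> y j; rewrite /g pf expk_periodic.
have xE y : x - y = (-1)%:~R *: y + x by rewrite scaleN1r addrC.
have E y : f (x - y) * expk k y = expk k x * g ((-1)%:~R *: y + x).
  rewrite /g -xE expkN expk_shift expk_opp mulrCA; congr (_ * _).
  rewrite -[LHS]mul1r -rC1 -(sqnorm_expk k x) -mul_cconj cconjM expkN mulrA; congr (_ * _).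
  by apply: complexE => /=; rewrite ?opprK.
have gsi : cintegrable (fun y => g ((-1)%:~R *: y + x)).
  apply: cintegrable_lty; first exact: cmeasurable_affine.
  rewrite (@integral_torus_affine R d (-1) x (fun y => (cabs (g y))%:E))//.
  - exact: lty_cintegrable.
  - by apply/measurable_EFinP; exact: measurable_cabs.
  - by move=> y; rewrite lee_fin cabs_ge0.
  - by move=> y j; rewrite pg.
split; first by apply: (eq_cintegrable E); exact: cintegrableZ.
rewrite (funext E) torus_cintZ// torus_cint_affine// mulrC.
by [].
Qed.

Lemma vp_opE l f x : cintegrable f -> Defs.periodic f ->
  vp_op l f x = \sum_(k <- box (2 * l)) rC (vpW l k) * fcoef f k * expk k x.
Proof.
move=> fi pf; rewrite /vp_op.
have E y : f (x - y) * vpd l y = \sum_(k <- box (2 * l)) rC (vpW l k) * (f (x - y) * expk k y).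
  by rewrite vpdE mulr_sumr; apply: eq_bigr => k _; rewrite mulrCA.
rewrite (funext E) torus_cint_sum => [|k].
  apply: eq_bigr => k _; have [i1 i2] := fcoef_reflect k x fi pf.
  by rewrite torus_cintZ// i2 mulrA.
by apply: cintegrableZ; have [] := fcoef_reflect k x fi pf.
Qed.

(** The Fourier multiplier of the block operator [sigma_op t]. *)
Definition lam (t : nat) k : R :=
  match t with 0 => vpW 1 k | t'.+1 => vpW (2 ^ t) k - vpW (2 ^ t') k end.

Lemma norm_lam_le1 t k : `|lam t k| <= 1.
Proof.
case: t => [|t] /=; first by rewrite ger0_norm ?vpW_le1 ?vpW_ge0.
have := vpW_le1 (2 ^ t.+1) k; have := vpW_ge0 (2 ^ t.+1) k.
have := vpW_le1 (2 ^ t) k; have := vpW_ge0 (2 ^ t) k.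
by rewrite ler_norml; lra.
Qed.

(** The multiplier vanishes outside the smallest admissible box; [N] is left free so that the block
    can be compared with sums over other, larger sets of frequencies. *)
Lemma sigma_opE N t f x : (2 ^ t.+1 <= N)%N -> cintegrable f -> Defs.periodic f ->
  sigma_op t f x = \sum_(k <- box N) rC (lam t k) * fcoef f k * expk k x.
Proof.
move=> tN fi pf.
have vE l : (0 < l)%N -> (2 * l <= N)%N ->
    vp_op l f x = \sum_(k <- box N) rC (vpW l k) * fcoef f k * expk k x.
  move=> l0 lN; rewrite vp_opE// (@sum_box_le N)// => k lk.
  by rewrite (vpW0 l0 (ltnW lk)) rC0 !mul0r.
case: t tN => [|t] tN /=; first by rewrite vE.
rewrite vE ?expn_gt0// -?expnS// vE ?expn_gt0//; last first.
  by rewrite -expnS; apply: leq_trans tN; rewrite leq_exp2l.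
by rewrite -sumrB; apply: eq_bigr => k _; rewrite rCD rCN !mulrBl.
Qed.

(** Level 0 is the zero frequency alone, and level [s >= 1] is the dyadic shell
    [2^(s-1) <= nrm k < 2^s]. *)
Definition level k : nat := if nrm k == 0%N then 0%N else (trunc_log 2 (nrm k)).+1.

Lemma level_leP k s : (level k <= s)%N = (nrm k < 2 ^ s)%N.
Proof.
rewrite /level; case: (posnP (nrm k)) => [->|k0]; first by rewrite expn_gt0.
have /andP[h1 h2] := trunc_log_bounds (isT : (1 < 2)%N) k0.
apply/idP/idP => h; first by rewrite (leq_trans h2)// leq_exp2l.
by rewrite -(@ltn_exp2l 2)//; exact: leq_ltn_trans h.
Qed.

Lemma lam_level t k : lam t k != 0 -> (level k == t) || (level k == t.+1).
Proof.
move=> h; suff : (level k <= t.+1)%N /\ (t <= level k)%N by lia.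
split; rewrite ?level_leP.
  rewrite ltnNge; apply: contraNN h => kt.
  case: t kt => [|t] kt /=; first by rewrite vpW0.
  rewrite vpW0 -?expnS ?expn_gt0// vpW0 ?subrr ?expn_gt0//.
  by apply: leq_trans kt; rewrite -expnS leq_exp2l.
case: t h => // t h; rewrite ltnNge level_leP.
apply: contraNN h => kt /=.
by rewrite !vpW1 ?subrr ?expn_gt0// 1?ltnW// (leq_trans kt)// leq_exp2l.
Qed.

End ValleePoussin.

(** The integral of a non-negative function is a supremum over simple functions below it, so
    monotonicity holds without measurability. This is applied to the modulus of smoothness, whose
    measurability in [t] is not established. *)
Lemma le_integral_ge0 (disp : measure_display) (T : measurableType disp) (R : realType)
    (mu : {measure set T -> \bar R}) (D : set T) (f g : T -> \bar R) :
  (forall x, D x -> 0 <= f x)%E -> (forall x, D x -> f x <= g x)%E ->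
  (\int[mu]_(x in D) f x <= \int[mu]_(x in D) g x)%E.
Proof.
move=> f0 fg; have g0 x : D x -> (0 <= g x)%E by move=> Dx; exact: le_trans (f0 _ Dx) (fg _ Dx).
rewrite integral_mkcond [leRHS]integral_mkcond !ge0_integralTE.
- apply: ereal_sup_le => _ [h /= hf <-]; exists h => //= x; apply: (le_trans (hf x)).
  by rewrite !patchE; case: ifPn => // /set_mem; exact: fg.
- by move=> x; rewrite patchE; case: ifPn => // /set_mem; exact: g0.
- by move=> x; rewrite patchE; case: ifPn => // /set_mem; exact: f0.
Qed.

(** * Comparison of power means on a probability space *)

Section PowerNorms.
Variable R : realType.
Local Open Scope ereal_scope.

Lemma poweRK (x : \bar R) (p : R) : (0 < p)%R -> 0 <= x -> poweR (poweR x p^-1) p = x.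
Proof. by move=> p0 x0; rewrite -poweRrM mulVf ?gt_eqF// poweRe1. Qed.

Lemma le_poweR_inv (x : \bar R) (p a : R) : (0 < p)%R -> (0 <= a)%R -> 0 <= x ->
  poweR x p^-1 <= a%:E -> x <= (a `^ p)%:E.
Proof.
move=> p0 a0 x0 h; rewrite -(poweRK p0 x0) -poweR_EFin.
apply: gt0_ler_poweR => //; first exact: ltW.
  by rewrite in_itv/= poweR_ge0 leey.
by rewrite in_itv/= leey lee_fin a0.
Qed.

Lemma poweR_inv_le (x : \bar R) (p a : R) : (0 < p)%R -> (0 <= a)%R -> 0 <= x ->
  x <= (a `^ p)%:E -> poweR x p^-1 <= a%:E.
Proof.
move=> p0 a0 x0 h.
have -> : a%:E = poweR (a `^ p)%:E p^-1.
  by rewrite poweR_EFin -powRrM divff ?gt_eqF// powRr1.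
apply: gt0_ler_poweR => //; first by rewrite invr_ge0 ltW.
  by rewrite in_itv/= x0 leey.
by rewrite in_itv/= leey lee_fin powR_ge0.
Qed.

Variable d : nat.
Local Notation C := (complex.complex R).
Local Notation T := (Torus R d).
Local Notation P := (torus_prob R d).
Implicit Types f : 'rV[R]_d -> C.

Lemma LpnormE (p : R) f : cmeasurable f ->
  Lpnorm p f = poweR (\int[P]_x (cabs (f x) `^ p)%:E) p^-1.
Proof.
move=> mf; rewrite /Lpnorm torus_intE//; first exact: measurable_cabs_powR.
by move=> x; rewrite lee_fin powR_ge0.
Qed.

Lemma Lpnorm_ge0 (p : R) f : 0 <= Lpnorm p f. Proof. exact: poweR_ge0. Qed.

Lemma Lpnorm_leP (p a : R) f : (0 < p)%R -> (0 <= a)%R -> cmeasurable f ->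
  Lpnorm p f <= a%:E <-> \int[P]_x (cabs (f x) `^ p)%:E <= (a `^ p)%:E.
Proof.
move=> p0 a0 mf; rewrite LpnormE//.
have I0 : 0 <= \int[P]_x (cabs (f x) `^ p)%:E.
  by apply: integral_ge0 => x _; rewrite lee_fin powR_ge0.
by split; [exact: le_poweR_inv|exact: poweR_inv_le].
Qed.

Lemma Lpnorm_bounded (p a : R) f : (0 < p)%R -> (0 <= a)%R -> cmeasurable f ->
  (forall x, cabs (f x) <= a)%R -> Lpnorm p f <= a%:E.
Proof.
move=> p0 a0 mf fa; apply/Lpnorm_leP => //.
apply: (@le_trans _ _ (\int[P]_x (cst (a `^ p)%:E x))).
  apply: le_integral_ge0 => x _; first by rewrite lee_fin powR_ge0.
  by rewrite lee_fin ge0_ler_powR ?nnegrE ?cabs_ge0// ltW.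
by rewrite integral_cst// [X in _ * X](_ : _ = 1) ?mule1//; exact: probability_setT.
Qed.

(* Either [u <= a], or [u^2 = u^p u^(2-p) <= u^p a^(2-p)]. *)
Lemma sqr_le_powR (u a p : R) : (0 <= u)%R -> (0 < a)%R -> (2 <= p)%R ->
  (u ^+ 2 <= a ^+ 2 + a ^+ 2 / a `^ p * u `^ p)%R.
Proof.
move=> u0 a0 p2; have ap : (0 < a `^ p)%R by rewrite powR_gt0.
have [ua|au] := leP u a.
  by rewrite (@le_trans _ _ (a ^+ 2)%R)// ?lerXn2r ?nnegrE// ?(ltW a0)// lerDl mulr_ge0 ?powR_ge0// divr_ge0 ?powR_ge0// sqr_ge0.
rewrite (@le_trans _ _ (a ^+ 2 / a `^ p * u `^ p)%R)//; last by rewrite lerDr sqr_ge0.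
have ugt : (0 < u)%R by exact: lt_trans au.
have E (v : R) : (0 < v)%R -> (v `^ p = v ^+ 2 * v `^ (p - 2))%R.
  move=> v0; rewrite {1}(_ : p = 2%:R + (p - 2))%R; last by ring.
  rewrite [LHS]powRD; last by rewrite (gt_eqF v0) implybT.
  by have -> := @powR_mulrn R v 2 (ltW v0).
rewrite (E a)// (E u)//; have w : (0 < a `^ (p - 2))%R by rewrite powR_gt0.
rewrite (_ : _ / _ * _ = u ^+ 2 * (u `^ (p - 2) / a `^ (p - 2)))%R; last first.
  by field; rewrite !gt_eqF.
rewrite -[leLHS]mulr1 ler_wpM2l ?sqr_ge0// ler_pdivlMr// mul1r.
by rewrite ge0_ler_powR ?nnegrE ?subr_ge0// ?(ltW a0) ?(ltW ugt)// ltW.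
Qed.

(** Integrate [sqr_le_powR] with threshold [a]: each of its two terms contributes at most [a^2]. *)
Lemma sqnorm_integral_le (p a : R) f : (2 <= p)%R -> (0 < a)%R -> cmeasurable f ->
  Lpnorm p f <= a%:E -> \int[P]_x (sqnorm (f x))%:E <= (2 * a ^+ 2)%:E.
Proof.
move=> p2 a0 mf; have p0 : (0 < p)%R by lra.
move=> /(Lpnorm_leP p0 (ltW a0) mf) fp.
have ap : (0 < a `^ p)%R by rewrite powR_gt0.
have c0 : (0 <= a ^+ 2 / a `^ p)%R by rewrite divr_ge0 ?sqr_ge0// ltW.
apply: (@le_trans _ _ (\int[P]_x ((a ^+ 2)%:E + (a ^+ 2 / a `^ p)%:E * (cabs (f x) `^ p)%:E))).
  apply: le_integral_ge0 => x _; first by rewrite lee_fin sqnorm_ge0.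
  by rewrite -EFinM -EFinD lee_fin -sqr_cabs sqr_le_powR// cabs_ge0.
have mp := measurable_cabs_powR p mf.
rewrite ge0_integralD//; last 3 first.
- by move=> x _; rewrite lee_fin sqr_ge0.
- by move=> x _; rewrite -EFinM lee_fin mulr_ge0// powR_ge0.
- exact: measurable_funeM.
rewrite integral_cst// [X in _ * X + _](_ : _ = 1) ?mule1; last exact: probability_setT.
rewrite ge0_integralZl//; last by move=> x _; rewrite lee_fin powR_ge0.
apply: (@le_trans _ _ ((a ^+ 2)%:E + (a ^+ 2 / a `^ p)%:E * (a `^ p)%:E)).
  by rewrite leeD2l// lee_wpmul2l// lee_fin.
by rewrite -EFinM -EFinD divfK ?gt_eqF// lee_fin; lra.
Qed.

Lemma inLp_cintegrable (p : R) f : (2 <= p)%R -> inLp p f -> cintegrable f.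
Proof.
move=> p2 [mf [_ fp]]; apply: cintegrable_lty => //.
have p0 : (0 < p)%R by lra.
have fin : Lpnorm p f \is a fin_num by rewrite ge0_fin_numE ?Lpnorm_ge0.
(* The summand 1 makes the threshold positive even when the norm is 0. *)
pose a := (fine (Lpnorm p f) + 1)%R.
have a0 : (0 < a)%R by rewrite ltr_wpDl// fine_ge0// Lpnorm_ge0.
have : Lpnorm p f <= a%:E by rewrite -(fineK fin) lee_fin lerDl.
move=> /(sqnorm_integral_le p2 a0 mf) h.
apply: (@le_lt_trans _ _ (\int[P]_x (1 + (sqnorm (f x))%:E))).
  apply: le_integral_ge0 => x _; first by rewrite lee_fin cabs_ge0.
  by rewrite -EFinD lee_fin -sqr_cabs; have := sqr_ge0 (cabs (f x) - 1)%R; have := cabs_ge0 (f x); nra.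
rewrite ge0_integralD//; last 2 first.
- by move=> x _; rewrite lee_fin sqnorm_ge0.
- by apply/measurable_EFinP; exact: measurable_sqnorm.
rewrite integral_cst// mul1e; apply: lte_add_pinfty; last by apply: le_lt_trans h _; rewrite ltry.
by rewrite [X in X < _](_ : _ = 1) ?ltry//; exact: probability_setT.
Qed.

End PowerNorms.

(** * From the Besov norm to the decay of Fourier coefficients *)

Section BesovModulus.
Variable R : realType.
Variables (d : nat) (p r : R) (theta : \bar R) (K : nat).
Hypotheses (p2 : 2 < p) (r0 : 0 < r) (theta1 : (1 <= theta)%E).
Local Notation C := (complex.complex R).
Local Notation T := (Torus R d).
Local Notation P := (torus_prob R d).
Variable f : 'rV[R]_d -> C.
Hypothesis fB : besov_ball d r p theta K f.
Local Open Scope ereal_scope.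

Lemma modulus_ge0 (t : R) : (0 <= t)%R -> 0 <= modulus K p f t.
Proof.
move=> t0; apply: (@le_trans _ _ (Lpnorm p (fdiffk K 0 f))); first exact: Lpnorm_ge0.
apply: ereal_sup_ubound; exists 0%R => //=.
by rewrite /enorm big1 ?sqrtr0// => j _; rewrite mxE expr0n.
Qed.

Lemma le_modulus (s t : R) : (s <= t)%R -> modulus K p f s <= modulus K p f t.
Proof.
move=> st; apply: ereal_sup_le => _ [h /= hs <-]; exists h => //=.
exact: le_trans st.
Qed.

Lemma besov_semi_le1 : besov_semi r p theta K f <= 1.
Proof.
apply: le_trans fB.2; rewrite /besov_norm leeDr//; exact: Lpnorm_ge0.
Qed.

(** For finite [theta] look at the window [[t, 2t]] only. The modulus is monotone, so there the
    integrand is at least [((2t)^(-r) w)^theta / (2t)]; the window has length [t], hence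
    [((2t)^(-r) w)^theta <= 2], and [2^(1/theta) <= 2]. *)
Lemma modulus_le (t : R) : (0 < t)%R -> modulus K p f t <= (2 * (2 * t) `^ r)%:E.
Proof.
move=> t0; have t20 : (0 < 2 * t)%R by lra.
set w := modulus K p f t.
have w0 : 0 <= w by apply: modulus_ge0; exact: ltW.
have c0 : (0 < (2 * t) `^ (- r))%R by rewrite powR_gt0.
suff h : ((2 * t) `^ (- r))%:E * w <= 2%:E.
  move: h; rewrite muleC -lee_pdivlMr// => /le_trans; apply.
  by rewrite powRN invrK -EFinM.
have := besov_semi_le1; rewrite /besov_semi.
case: theta theta1 => [th| |//]; last first.
  move=> _ h; apply: (@le_trans _ _ 1); last by rewrite lee_fin; lra.
  apply: le_trans h; apply: le_trans (ereal_sup_ubound _); last first.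
    by exists (2 * t)%R => //=; rewrite in_itv/= t20.
  by rewrite lee_pmul2l// le_modulus//; lra.
rewrite lee_fin => th1 h; have th0 : (0 < th)%R by lra.
pose F (s : R) := poweR ((s `^ (- r))%:E * modulus K p f s) th * (s^-1)%:E.
have F0 s : (s > 0)%R -> 0 <= F s.
  by move=> s0; rewrite /F mule_ge0 ?poweR_ge0// lee_fin invr_ge0 ltW.
have : \int[lebesgue_measure]_(s in `]0%R, +oo[%classic) F s <= (1 `^ th)%:E.
  apply: le_poweR_inv h => //; apply: integral_ge0 => s /=; rewrite in_itv/= andbT.
  exact: F0.
rewrite powR1 => {}h.
pose c := poweR (((2 * t) `^ (- r))%:E * w) th * ((2 * t)^-1)%:E.
have cF : c * t%:E <= 1.
  apply: le_trans h.
  apply: (@le_trans _ _ (\int[lebesgue_measure]_(s in `]0%R, +oo[%classic) ((cst c) \_ `[t, (2 * t)%R]) s)).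
    rewrite -integral_mkcondr setIidr; last first.
      by move=> s /=; rewrite !in_itv/=; lra.
    have mE : lebesgue_measure (`[t, (2 * t)%R]%classic : set R) = t%:E.
      rewrite lebesgue_measure_itv/= lte_fin ifT; last by lra.
      by rewrite -EFinB; congr (_%:E); lra.
    by rewrite integral_cst// [X in _ <= _ * X](_ : _ = t%:E).
  apply: le_integral_ge0 => s /=; rewrite in_itv/= andbT => s0.
    by rewrite patchE; case: ifP => // _; rewrite /c mule_ge0 ?poweR_ge0// lee_fin invr_ge0 ltW.
  rewrite patchE; case: ifPn => [|_]; last exact: F0.
  rewrite inE/= in_itv/= => /andP[ts st].
  rewrite /c /F; apply: lee_pmul; rewrite ?poweR_ge0// ?lee_fin ?invr_ge0 ?(ltW t20)//.
    apply: gt0_ler_poweR; rewrite ?in_itv/= ?leey ?andbT.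
    - exact: ltW.
    - by rewrite mule_ge0// lee_fin ltW.
    - by rewrite mule_ge0 ?modulus_ge0 ?(ltW s0)// lee_fin powR_ge0.
    - apply: lee_pmul => //; first by rewrite lee_fin ltW.
        rewrite lee_fin !powRN lef_pV2 ?posrE ?powR_gt0//.
        by rewrite ge0_ler_powR ?nnegrE// ?(ltW r0) ?(ltW s0) ?(ltW t20).
      exact: le_modulus.
  by rewrite lef_pV2 ?posrE.
have : poweR (((2 * t) `^ (- r))%:E * w) th <= 2%:E.
  rewrite -[leLHS]mule1 (_ : 1 = ((2 * t)^-1 * (2 * t))%:E); last by rewrite mulVf ?gt_eqF.
  rewrite EFinM muleA -/c (_ : (2 * t)%:E = t%:E * 2%:E); last by rewrite -EFinM mulrC.
  by rewrite muleA -[leRHS]mul1e lee_wpmul2r// lee_fin.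
move=> {}h; have : poweR (((2 * t) `^ (- r))%:E * w) (th^-1)^-1 <= (2 `^ (th^-1)^-1)%:E.
  rewrite invrK; apply: le_trans h _; rewrite lee_fin le1r_powR//; lra.
move=> {}h; have : poweR (poweR (((2 * t) `^ (- r))%:E * w) th) th^-1 <= 2%:E.
  by apply: poweR_inv_le => //; [exact: poweR_ge0|move: h; rewrite invrK].
rewrite -poweRrM divff ?gt_eqF// poweRe1//.
by rewrite mule_ge0// lee_fin ltW.
Qed.

Lemma sqnorm_fdiffk_le (h : 'rV[R]_d) (t : R) : (0 < t)%R -> (enorm h <= t)%R ->
  \int[P]_x (sqnorm (fdiffk K h f x))%:E <= (2 * (2 * (2 * t) `^ r) ^+ 2)%:E.
Proof.
move=> t0 ht; have fi : cintegrable f.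
  by apply: (@inLp_cintegrable _ _ p); [exact: ltW|exact: fB.1].
have [gi _ _] := fdiffk_props h K fi fB.1.2.1.
apply: (@sqnorm_integral_le _ _ p); first exact: ltW.
- by rewrite mulr_gt0// powR_gt0//; lra.
- exact: cintegrable_cmeasurable.
apply: le_trans (modulus_le t0); apply: ereal_sup_ubound.
by exists h.
Qed.

End BesovModulus.

Section BesovCoefficients.
Variable R : realType.
Variables (d : nat) (p r : R) (theta : \bar R) (K : nat).
Hypotheses (p2 : 2 < p) (r0 : 0 < r) (theta1 : (1 <= theta)%E).
Local Notation C := (complex.complex R).
Implicit Types (f : 'rV[R]_d -> C) (sh : seq 'rV[int]_d).

Lemma enorm_delta (t : R) (j : 'I_d) : enorm (t *: delta_mx ord0 j) = `|t|.
Proof.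
rewrite /enorm (bigD1 j)//= big1 ?addr0 => [|i ij].
  by rewrite !mxE !eqxx mulr1 sqrtr_sqr.
by rewrite !mxE (negbTE ij) andbF mulr0 expr0n.
Qed.

(** The squared chord [|e^(i/2) - 1|^2], the minimum of [|e^(iu) - 1|^2] over phases [u] with
    [1/2 <= |u| <= 1]. *)
Definition cosgap : R := 2 - 2 * cos 2^-1.

Lemma cosgap_gt0 : 0 < cosgap.
Proof.
have p2' := @pi_ge2 R.
have : cos (2^-1 : R) < cos 0.
  by rewrite ltr_cos ?in_itv/= ?invr_gt0// ?lexx ?invr_ge0/=; lra.
by rewrite cos0 /cosgap; lra.
Qed.

Lemma powR_inv2X (n : nat) (a : R) : (2 ^+ n)^-1 `^ a = (2 `^ (- a)) ^+ n.
Proof.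
have E : (2 ^+ n)^-1 = 2 `^ (- n%:R) :> R by rewrite powRN powR_mulrn.
have <- := @powR_mulrn R (2 `^ (- a)) n (powR_ge0 _ _).
by rewrite E -!powRrM; congr powR; ring.
Qed.

Lemma level_gt0_bounds (k : 'rV[int]_d) s : level k = s.+1 ->
  exists j, (2 ^ s <= `|k ord0 j| < 2 ^ s.+1)%N.
Proof.
move=> ks; have h1 : (nrm k < 2 ^ s.+1)%N by rewrite -level_leP ks.
have /nrm_geP[|j jk] : (2 ^ s <= nrm k)%N by rewrite leqNgt -level_leP ks ltnn.
  by rewrite expn_gt0.
by exists j; rewrite jk (leq_ltn_trans (leq_nrm k j)).
Qed.

Lemma cosgap_le (k : 'rV[int]_d) (j : 'I_d) s : (2 ^ s <= `|k ord0 j| < 2 ^ s.+1)%N ->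
  cosgap <= sqnorm (expk k ((2 ^+ s.+1)^-1 *: delta_mx ord0 j) - 1 : C).
Proof.
move=> /andP[k1 k2]; rewrite expk_delta sqnorm_eixB1 /cosgap.
suff : cos ((k ord0 j)%:~R / 2 ^+ s.+1 : R) <= cos 2^-1 by lra.
have e0 : (0 : R) < 2 ^+ s.+1 by rewrite exprn_gt0.
rewrite -cos_norm normrM [`|_^-1|]gtr0_norm ?invr_gt0// -intr_norm -abszE.
have u1 : 2^-1 <= (`|k ord0 j|%N%:R / 2 ^+ s.+1 : R).
  by rewrite ler_pdivlMr// exprS mulKf// -natrX ler_nat.
have u2 : (`|k ord0 j|%N%:R / 2 ^+ s.+1 : R) < 1.
  by rewrite ltr_pdivrMr// mul1r -natrX ltr_nat.
have p2' := @pi_ge2 R.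
by rewrite -pmulrn leNgt ltr_cos ?in_itv/= -?leNgt//; apply/andP; split; lra.
Qed.

(** The summand 2 serves level 0. The other one is the bound of [sqnorm_fdiffk_le], summed over [d]
    directions and divided by the smallest value of the squared multiplier. *)
Definition besov_const2 : R := 2 + d%:R * (2 * (2 * 2 `^ r) ^+ 2) / cosgap ^+ K.

Lemma besov_const2_ge0 : 0 <= besov_const2.
Proof.
have := cosgap_gt0 => c0; rewrite addr_ge0// divr_ge0 ?exprn_ge0 ?(ltW c0)//.
Qed.

(** Bessel's inequality is applied to the differences of order [K] with step [2^(-s)] along the
    axes. At that scale the dominant coordinate of a frequency of level [s] produces a phase between
    1/2 and 1, where the multiplier is bounded below. *)
Lemma shell_sq f s sh : besov_ball d r p theta K f -> uniq sh ->
  (forall k, k \in sh -> level k = s) ->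
  \sum_(k <- sh) sqnorm (fcoef f k) <= besov_const2 * ((2 `^ (- r)) ^+ s) ^+ 2.
Proof.
move=> fB ush shs.
have fi : cintegrable f.
  by apply: (@inLp_cintegrable _ _ p); [exact: ltW|exact: fB.1].
have pf := fB.1.2.1; have mf := fB.1.1.
have c0 := cosgap_gt0.
(* Level 0 is the zero frequency, to which differences are blind; there the norm of [f] itself is
   used. *)
case: s shs => [|s] shs.
  have f2 : (\int[torus_prob R d]_x (sqnorm (f x))%:E <= 2%:E)%E.
    have := @sqnorm_integral_le R d p 1 f (ltW p2) ltr01 mf; rewrite expr1n mulr1; apply.
    apply: le_trans fB.2; rewrite /besov_norm leeDl//.
    case: theta => [th| |]; rewrite /besov_semi ?poweR_ge0//.
      apply: le_trans (ereal_sup_ubound _); last by exists 1%R => //=; rewrite in_itv/= ltr01.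
      by rewrite mule_ge0 ?lee_fin ?powR_ge0// modulus_ge0.
    apply: le_trans (ereal_sup_ubound _); last by exists 1%R => //=; rewrite in_itv/= ltr01.
    by rewrite mule_ge0 ?lee_fin ?powR_ge0// modulus_ge0.
  have : ((\sum_(k <- sh) sqnorm (fcoef f k))%:E <= 2%:E)%E.
    by apply: le_trans (f2); apply: bessel => //; apply: le_lt_trans f2 _; rewrite ltry.
  rewrite lee_fin => /le_trans; apply; rewrite expr0 expr1n mulr1 /besov_const2 lerDl.
  by rewrite divr_ge0 ?exprn_ge0 ?(ltW c0)// !mulr_ge0 ?sqr_ge0.
pose t : R := (2 ^+ s.+1)^-1.
have t0 : 0 < t by rewrite invr_gt0 exprn_gt0.
pose h (j : 'I_d) : 'rV[R]_d := t *: delta_mx ord0 j.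
have tr : (2 * t) `^ r = 2 `^ r * (2 `^ (- r)) ^+ s.+1.
  by rewrite powRM ?(ltW t0)// powR_inv2X.
have step (j : 'I_d) : \sum_(k <- sh) sqnorm ((expk k (h j) - 1) ^+ K * fcoef f k) <=
    2 * (2 * 2 `^ r) ^+ 2 * ((2 `^ (- r)) ^+ s.+1) ^+ 2.
  have [gi _ gE] := fdiffk_props (h j) K fi pf.
  have gle := @sqnorm_fdiffk_le R d p r theta K p2 r0 theta1 f fB (h j) t t0.
  rewrite enorm_delta gtr0_norm// lexx in gle; have {}gle := gle isT.
  rewrite (eq_bigr (fun k => sqnorm (fcoef (fdiffk K (h j) f) k))) => [|k _]; last by rewrite gE.
  rewrite -lee_fin; apply: le_trans (bessel _ _ ush) _.
  - exact: cintegrable_cmeasurable.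
  - by apply: le_lt_trans gle _; rewrite ltry.
  - by apply: le_trans gle _; rewrite tr lee_fin mulrA exprMn mulrA.
have key : cosgap ^+ K * \sum_(k <- sh) sqnorm (fcoef f k) <=
    d%:R * (2 * (2 * 2 `^ r) ^+ 2 * ((2 `^ (- r)) ^+ s.+1) ^+ 2).
  (* Each frequency is detected in the direction of a dominant coordinate, so summing over all
     directions detects every one of them at the price of a factor [d]. *)
  apply: (@le_trans _ _ (\sum_(k <- sh) \sum_(j < d) sqnorm ((expk k (h j) - 1) ^+ K * fcoef f k))).
    rewrite mulr_sumr big_seq [leRHS]big_seq; apply: ler_sum => k /shs ks.
    have [j jk] := level_gt0_bounds ks.
    rewrite (bigD1 j)//= ler_wpDr ?sumr_ge0// => [i _|]; first exact: sqnorm_ge0.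
    rewrite sqnormM ler_wpM2r ?sqnorm_ge0//.
    have -> : sqnorm ((expk k (h j) - 1) ^+ K : C) = sqnorm (expk k (h j) - 1 : C) ^+ K.
      by rewrite -!sqr_cabs cabsX exprAC.
    by rewrite lerXn2r ?nnegrE ?sqnorm_ge0 ?(ltW c0)// cosgap_le.
  rewrite exchange_big/= -[X in X%:R * _]card_ord mulr_natl -sumr_const.
  by apply: ler_sum => j _; exact: step.
rewrite /besov_const2 mulrDl ler_wpDl ?mulr_ge0 ?sqr_ge0//.
have cK : 0 < cosgap ^+ K by rewrite exprn_gt0.
by rewrite mulrAC ler_pdivlMr// mulrC -mulrA.
Qed.

Definition besov_ratio : R := 2 `^ (- r) * 2 `^ (d%:R / 2).

Definition besov_const1 : R := (4 ^+ d + besov_const2) / 2.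

Lemma besov_ratio_gt0 : 0 < besov_ratio.
Proof. by rewrite mulr_gt0// powR_gt0. Qed.

Lemma besov_const1_gt0 : 0 < besov_const1.
Proof.
by rewrite divr_gt0// ltr_pwDl ?exprn_gt0// besov_const2_ge0.
Qed.

(** Cauchy-Schwarz over the at most [4^d 2^(ds)] frequencies of the shell, in the form
    [u <= (eta + u^2 / eta) / 2] with the balancing value [eta = a / b]: [a] is the size of the
    quadratic sum and [b] the square root of the number of frequencies. *)
Lemma shell_abs f s sh : besov_ball d r p theta K f -> uniq sh ->
  (forall k, k \in sh -> level k = s) ->
  \sum_(k <- sh) cabs (fcoef f k) <= besov_const1 * besov_ratio ^+ s.
Proof.
move=> fB ush shs; have sq := shell_sq fB ush shs.
pose a : R := (2 `^ (- r)) ^+ s; pose b : R := (2 `^ (d%:R / 2)) ^+ s.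
have a0 : 0 < a by rewrite exprn_gt0// powR_gt0.
have b0 : 0 < b by rewrite exprn_gt0// powR_gt0.
have bb : b ^+ 2 = 2 ^+ (s * d).
  have E : (2 `^ (d%:R / 2)) ^+ 2 = 2 ^+ d :> R.
    have <- := @powR_mulrn R (2 `^ (d%:R / 2)) 2 (powR_ge0 _ _).
    by rewrite -powRrM divfK// powR_mulrn.
  by rewrite /b exprAC E -exprM mulnC.
have sz : (size sh)%:R <= 4 ^+ d * b ^+ 2.
  rewrite bb -natrX -natrX -natrM ler_nat.
  apply: (@leq_trans (size (box d (2 ^ s)))).
    by apply: uniq_leq_size => // k /shs ks; rewrite mem_box ltnW// -level_leP ks.
  rewrite size_box expnM -expnMn.
  have H m n e : (m <= n -> m ^ e <= n ^ e)%N by case: e => // e; rewrite leq_exp2r.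
  by apply: H; have := expn_gt0 2 s; lia.
have eta : forall k, cabs (fcoef f k) <= (a / b + sqnorm (fcoef f k) / (a / b)) / 2.
  move=> k; set u := cabs _; have e0 : 0 < a / b by rewrite divr_gt0.
  rewrite -sqr_cabs -/u ler_pdivlMr// -subr_ge0.
  have -> : a / b + u ^+ 2 / (a / b) - u * 2 = (a / b - u) ^+ 2 / (a / b).
    by field; rewrite !gt_eqF.
  by rewrite divr_ge0 ?sqr_ge0 ?(ltW e0).
apply: (@le_trans _ _ (\sum_(k <- sh) (a / b + sqnorm (fcoef f k) / (a / b)) / 2)).
  by apply: ler_sum => k _; exact: eta.
rewrite -mulr_suml big_split/= -mulr_suml big_const_seq count_predT iter_addr_0.
rewrite /besov_const1 mulrAC ler_pM2r ?invr_gt0// mulrDl exprMn -/a -/b lerD//.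
  rewrite ler_pdivrMr// -[leLHS]mulr_natl (_ : _ * _ * b = 4 ^+ d * b ^+ 2 * a); last by ring.
  by rewrite ler_wpM2r// ltW.
rewrite -mulr_suml ler_pdivrMr ?divr_gt0// (le_trans sq)// -/a -mulrA ler_wpM2l ?besov_const2_ge0//.
by rewrite (_ : a * b * (a / b) = a ^+ 2)//; field; rewrite gt_eqF.
Qed.

Lemma sum_by_level f sh (v : nat -> R) s0 S : besov_ball d r p theta K f -> uniq sh ->
  (forall t, 0 <= v t) -> (forall k, k \in sh -> (s0 <= level k < S)%N) ->
  \sum_(k <- sh) v (level k) * cabs (fcoef f k) <=
  \sum_(s0 <= t < S) v t * (besov_const1 * besov_ratio ^+ t).
Proof.
move=> fB ush v0 shl.
apply: (@le_trans _ _ (\sum_(k <- sh) \sum_(s0 <= t < S | level k == t) v t * cabs (fcoef f k))).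
  rewrite big_seq [leRHS]big_seq; apply: ler_sum => k /shl ks.
  rewrite big_mkcond (bigD1_seq (level k)) ?iota_uniq ?mem_index_iota//= eqxx.
  by rewrite ler_wpDr// sumr_ge0// => t _; case: ifP => // _; rewrite mulr_ge0// cabs_ge0.
rewrite (exchange_big_dep xpredT)//=; apply: ler_sum => t _.
rewrite -mulr_sumr ler_wpM2l// -big_filter (shell_abs fB)// ?filter_uniq// => k.
by rewrite mem_filter => /andP[/eqP].
Qed.

End BesovCoefficients.

(** * The Fejer kernel and essential boundedness from summable coefficients *)

Section FejerKernel.
Variable R : realType.
Variables (d n : nat).
Local Notation C := (complex.complex R).
Local Notation Re := (@complex.Re R).
Local Notation N := n.+1.
Local Notation P := (torus_prob R d).

Definition cube : seq 'rV[int]_d := [seq \row_j (a j)%:Z | a : {ffun 'I_d -> 'I_N}].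

Lemma uniq_cube : uniq cube.
Proof.
rewrite map_inj_uniq ?enum_uniq// => a b /rowP h; apply/ffunP => j.
by have := h j; rewrite !mxE => -[E]; apply/val_inj.
Qed.

Lemma mem_cube (k : 'rV[int]_d) : (forall j, 0 <= k ord0 j < N%:Z) -> k \in cube.
Proof.
move=> h; apply/codomP.
have hb j : (absz (k ord0 j) < N)%N by have := h j; lia.
exists [ffun j => Ordinal (hb j)]; apply/rowP => j.
by rewrite mxE ffunE/= (ord1 0); have := h j; rewrite (ord1 ord0); lia.
Qed.

Lemma size_cube : size cube = (N ^ d)%N.
Proof. by rewrite size_map -cardE card_ffun !card_ord. Qed.

Let Nd : R := N%:R ^+ d.

Let Nd_gt0 : 0 < Nd.
Proof. by rewrite exprn_gt0// ltr0Sn. Qed.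

(** Written as a normalised square, the kernel is visibly non-negative, and its mean 1 is Parseval's
    identity. *)
Definition fejer (h : 'rV[R]_d) : R := Nd^-1 * sqnorm (trigpoly cube (fun=> 1) h).

Lemma fejer_ge0 h : 0 <= fejer h.
Proof. by rewrite mulr_ge0 ?sqnorm_ge0// invr_ge0 ltW. Qed.

Lemma fejerE h : rC (fejer h) = rC Nd^-1 * \sum_(l <- cube) \sum_(k <- cube) expk (k - l) h.
Proof.
rewrite rCM -mul_cconj /trigpoly; congr (_ * _).
rewrite cconj_sum mulr_sumr; apply: eq_bigr => l _; rewrite mulr_suml; apply: eq_bigr => k _.
by rewrite !mul1r expkD expkN.
Qed.

Lemma cmeasurable_fejer : cmeasurable (fun h => rC (fejer h)).
Proof.
rewrite (funext fejerE); apply: cmeasurableM; first exact: cmeasurable_cst.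
by apply: cmeasurable_sum => l; apply: cmeasurable_sum => k; exact: cmeasurable_expk.
Qed.

Lemma fejer_le h : fejer h <= Nd.
Proof.
rewrite /fejer ler_pdivrMl// -sqr_cabs -expr2 lerXn2r ?nnegrE ?cabs_ge0 ?(ltW Nd_gt0)//.
apply: (le_trans (ler_cabs_sum _ _ _)).
under eq_bigr do rewrite mul1r cabs_expk.
by rewrite big_const_seq count_predT iter_addr_0 size_cube natrX.
Qed.

Lemma integral_fejer : (\int[P]_h (fejer h)%:E = 1)%E.
Proof.
under eq_integral do rewrite EFinM.
rewrite ge0_integralZl//; last 3 first.
- by apply/measurable_EFinP; apply: measurable_sqnorm; apply: cintegrable_cmeasurable; exact: cintegrable_trigpoly.
- by move=> x _; rewrite lee_fin sqnorm_ge0.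
- by rewrite lee_fin invr_ge0 ltW.
rewrite parseval_trigpoly ?uniq_cube// -EFinM.
have s1 : sqnorm (1 : C) = 1 by rewrite -rC1 sqnorm_rC expr1n.
rewrite s1 big_const_seq count_predT iter_addr_0 size_cube natrX.
by rewrite mulVf ?gt_eqF.
Qed.

Lemma count_cube_face (j : 'I_d) :
  N%:R * \sum_(l <- cube) (l ord0 j == 0)%:R = Nd.
Proof.
rewrite big_image/=.
(* The indicator of the face becomes a product over coordinates, so that the sum over the cube
   factorises. *)
rewrite (eq_bigr (fun a : {ffun 'I_d -> 'I_N} =>
    \prod_(i < d) (if i == j then (a i == ord0)%:R else 1))) => [|a _]; last first.
  by rewrite (bigD1 j)//= eqxx big1 ?mulr1 ?mxE// => i /negbTE ->.
rewrite -(bigA_distr_bigA (fun i v => if i == j then (v == ord0)%:R else 1))/=.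
rewrite (bigD1 j)//= (eqxx j) (bigD1 ord0)//= big1 ?addr0 ?mul1r; last first.
  by move=> i /negbTE ->.
rewrite (eq_bigr (fun=> N%:R)) => [|i /negbTE ij]; last first.
  by rewrite ij sumr_const card_ord.
rewrite /Nd -[X in _ = _ ^+ X]card_ord -prodr_const [RHS](bigD1 j)//=.
Qed.

(** Quantitative concentration at the origin. The mean of the kernel against [expk e] counts the
    points [l] of the cube with [l - e] in the cube; only the face [l_j = 0] fails, a fraction [1/N]
    of the cube. *)
Lemma integral_fejer_cos (j : 'I_d) :
  (\int[P]_h (fejer h * (1 - cos (h ord0 j)))%:E <= (N%:R^-1)%:E)%E.
Proof.
pose e : 'rV[int]_d := delta_mx ord0 j.
have ehE h : expk e h = eix (h ord0 j) :> C.
  rewrite /expk; congr eix; rewrite (bigD1 j)//= big1 ?addr0 => [|i ij].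
    by rewrite mxE !eqxx mul1r.
  by rewrite mxE (negbTE ij) andbF mul0r.
have Fi : cintegrable (fun h => rC (fejer h)).
  apply: (@cintegrable_bounded _ _ _ Nd); first exact: cmeasurable_fejer.
  by move=> h; rewrite cabs_rC ger0_norm ?fejer_ge0 ?fejer_le.
have Fei : cintegrable (fun h => rC (fejer h) * expk e h) by exact: cintegrable_fcoef.
have F1i : cintegrable (fun h => rC (fejer h) - rC (fejer h) * expk e h).
  by apply: cintegrableD => //; exact: cintegrableN.
have E : torus_cint (fun h => rC (fejer h) * expk e h) =
    rC (Nd^-1 * \sum_(l <- cube) \sum_(k <- cube) (k - l + e == 0)%:R).
  under eq_fun do rewrite fejerE -mulrA mulr_suml.
  have i2 l k : cintegrable (fun h => expk (k - l + e) h : C) by exact: cintegrable_expk.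
  have E2 h : (\sum_(l <- cube) (\sum_(k <- cube) expk (k - l) h) * expk e h : C) =
      \sum_(l <- cube) \sum_(k <- cube) expk (k - l + e) h.
    apply: eq_bigr => l _; rewrite mulr_suml; apply: eq_bigr => k _.
    by rewrite -expkD.
  under eq_fun do rewrite E2.
  rewrite torus_cintZ; last by apply: cintegrable_sum => l; exact: cintegrable_sum.
  rewrite rCM; congr (_ * _); rewrite torus_cint_sum => [|l]; last exact: cintegrable_sum.
  rewrite rC_sum; apply: eq_bigr => l _; rewrite torus_cint_sum//.
  by rewrite rC_sum; apply: eq_bigr => k _; rewrite torus_cint_expk.
have E1 : torus_cint (fun h => rC (fejer h)) = 1.
  rewrite torus_cintE//; apply: complexE => /=; first by rewrite integral_fejer.
  by rewrite integral0.
have cnt : 1 - N%:R^-1 <= Nd^-1 * \sum_(l <- cube) \sum_(k <- cube) (k - l + e == 0)%:R.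
  rewrite ler_pdivlMl//.
  have -> : Nd * (1 - N%:R^-1) = \sum_(l <- cube) (1 - (l ord0 j == 0)%:R).
    rewrite sumrB big_const_seq count_predT iter_addr_0 size_cube natrX -/Nd.
    by rewrite mulrBr mulr1 -{2}(count_cube_face j) mulrC mulKf// pnatr_eq0.
  rewrite big_seq [leRHS]big_seq; apply: ler_sum => l lc.
  have [l0|l0] := eqVneq (l ord0 j) 0.
    by rewrite subrr sumr_ge0.
  (* Off the face, [l] contributes through its neighbour [k = l - e], which still lies in the
     cube. *)
  rewrite subr0 (bigD1_seq (l - e))//= ?uniq_cube//.
    rewrite (_ : l - e - l + e = 0) ?eqxx ?lerDl ?sumr_ge0//.
    by rewrite addrAC subrK subrr.
  move: lc l0 => /codomP[a ->]; rewrite mxE => l0; apply: mem_cube => i.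
  rewrite !mxE eqxx/=; case: (eqVneq i j) => [->|_]; rewrite ?mulr1n ?mulr0n ?subr0.
    by move: l0 (ltn_ord (a j)); move: (nat_of_ord (a j)) => v; lia.
  by move: (ltn_ord (a i)); move: (nat_of_ord (a i)) => v; lia.
have : torus_cint (fun h => rC (fejer h) - rC (fejer h) * expk e h) =
    rC (1 - Nd^-1 * \sum_(l <- cube) \sum_(k <- cube) (k - l + e == 0)%:R).
  rewrite torus_cintD//; last exact: cintegrableN.
  rewrite E1 rCD rCN -E; congr (_ + _).
  rewrite -[RHS]mulN1r -torus_cintZ//; congr torus_cint; apply/funext => h.
  by rewrite mulN1r.
rewrite torus_cintE// => /(congr1 Re) H.
have {}H : fine (\int[P]_h (Re (rC (fejer h) - rC (fejer h) * expk e h))%:E)%E =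
  1 - Nd^-1 * \sum_(l <- cube) \sum_(k <- cube) (k - l + e == 0)%:R := H.
rewrite (_ : (\int[P]_h _)%E = (fine (\int[P]_h (Re (rC (fejer h) - rC (fejer h) * expk e h))%:E))%:E).
  by rewrite H lee_fin lerBlDr addrC -lerBlDr.
rewrite fineK; last by apply: integrable_fin_num => //; case: F1i.
apply: eq_integral => h _; congr (_%:E).
by rewrite cReD cReN cReM ehE/=; ring.
Qed.

End FejerKernel.

Section EssentialBound.
Variable R : realType.
Variables (d K : nat).
Local Notation C := (complex.complex R).
Local Notation T := (Torus R d).
Local Notation P := (torus_prob R d).
Implicit Types f : 'rV[R]_d -> C.

(** The coefficient of [z^j] in [(z - 1)^m], by Pascal's recurrence. *)
Fixpoint dcoef (m : nat) (j : nat) : R :=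
  match m with
  | 0 => (j == 0)%N%:R
  | m'.+1 => (if j is j'.+1 then dcoef m' j' else 0) - dcoef m' j
  end.

Arguments dcoef : simpl never.

Lemma dcoefS m j : dcoef m.+1 j = (if j is j'.+1 then dcoef m j' else 0) - dcoef m j.
Proof. by []. Qed.

Lemma dcoef_gt m j : (m < j)%N -> dcoef m j = 0.
Proof.
elim: m j => [|m IH] [|j]// mj; rewrite dcoefS !IH ?subr0//.
by rewrite ltnW.
Qed.

Lemma dcoef0 m : dcoef m 0 = (-1) ^+ m.
Proof. by elim: m => // m IH; rewrite dcoefS IH exprS mulN1r sub0r. Qed.

Lemma sum_dcoef m : \sum_(j < m.+1) `|dcoef m j| <= 2 ^+ m.
Proof.
elim: m => [|m IH]; first by rewrite big_ord1/= /dcoef normr1.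
apply: (@le_trans _ _ (\sum_(j < m.+2) (`|if nat_of_ord j is j'.+1 then dcoef m j' else 0| + `|dcoef m j|))).
  by apply: ler_sum => j _; rewrite dcoefS; exact: ler_normB.
rewrite big_split/= exprS mulr_natl mulr2n lerD//.
  by rewrite big_ord_recl/= normr0 add0r.
by rewrite big_ord_recr/= dcoef_gt// normr0 addr0.
Qed.

Lemma fdiffkE f m (h x : 'rV[R]_d) :
  fdiffk m h f x = \sum_(j < m.+1) rC (dcoef m j) * f (j%:Z%:~R *: h + x).
Proof.
elim: m x => [|m IH] x.
  by rewrite big_ord1/= /dcoef mul1r scale0r add0r.
rewrite /fdiffk iterS -/(fdiffk m h f) /fdiff !IH.
under [RHS]eq_bigr do rewrite dcoefS rCD rCN mulrBl.
rewrite sumrB; congr (_ - _).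
  rewrite [RHS]big_ord_recl/= mul0r add0r; apply: eq_bigr => j _.
  rewrite (_ : _ + (x + h) = (bump 0 j)%:Z%:~R *: h + x)//.
  by rewrite /bump/= add1n intS intrD scalerDl scale1r [LHS]addrA [LHS]addrC [LHS]addrA.
by rewrite [RHS]big_ord_recr/= dcoef_gt// mul0r addr0.
Qed.

Variable f : 'rV[R]_d -> C.
Hypotheses (fi : cintegrable f) (pf : Defs.periodic f).
Variable M0 : R.
Hypothesis fM0 : forall s : seq 'rV[int]_d, uniq s -> \sum_(k <- s) cabs (fcoef f k) <= M0.

Let mf : cmeasurable f := cintegrable_cmeasurable fi.

Lemma cintegrable_dilate (j : int) x : j != 0 -> cintegrable (fun h => f (j%:~R *: h + x)).
Proof.
move=> j0; apply: cintegrable_lty; first exact: cmeasurable_affine.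
rewrite (@integral_torus_affine R d j x (fun y => (cabs (f y))%:E))//.
- exact: lty_cintegrable.
- by apply/measurable_EFinP; exact: measurable_cabs.
- by move=> y; rewrite lee_fin cabs_ge0.
- by move=> y i; rewrite pf.
Qed.

Lemma torus_cint_dilate_dvd (j : int) (l : 'rV[int]_d) x : j != 0 ->
  torus_cint (fun h => f (j%:~R *: h + x) * expk (- (j *: l)) h) = expk l x * fcoef f l.
Proof.
move=> j0; have fli := cintegrable_fcoef (- l) fi.
rewrite /fcoef -torus_cintZ// -(@torus_cint_affine _ _ j x (fun y => expk l x * (f y * expk (- l) y)))//.
- congr torus_cint; apply/funext => h.
  rewrite expk_shift expk_scale scalerN mulrCA; congr (_ * _).
  by rewrite mulrCA mulrA -mulrA -expkD subrr expk0 mulr1.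
- by apply: cintegrable_cmeasurable; exact: cintegrableZ.
- by move=> y i; rewrite pf expk_periodic.
Qed.

Lemma eix_neq1 (j : nat) (a : int) : (0 < j)%N -> ~~ (j%:Z %| a)%Z ->
  eix (a%:~R * (2 * pi / j%:R) : R) <> 1.
Proof.
move=> j0 ja; have jR : (0 : R) < j%:R by rewrite ltr0n.
have p0 := @pi_gt0 R.
pose m := (a %% j%:Z)%Z; pose q := (a %/ j%:Z)%Z.
have m0 : (0 < m)%Z.
  rewrite lt_neqAle modz_ge0 ?eqz_nat ?gtn_eqF// andbT eq_sym.
  by apply: contraNN ja => /eqP m0; apply/dvdz_mod0P.
have mj : (m < j%:Z)%Z by rewrite ltz_pmod.
have aE : a%:~R * (2 * pi / j%:R) = q%:~R * (2 * pi) + m%:~R / j%:R * (2 * pi) :> R.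
  rewrite {1}(divz_eq a j%:Z) intrD intrM -/q -/m; field.
  by rewrite gt_eqF.
rewrite aE eixD eix_mulz2pi mul1r => /(congr1 (@complex.Re R))/=.
set y := m%:~R / j%:R * _.
have m0R : (0 : R) < m%:~R by rewrite ltr0z.
have mjR : (m%:~R : R) < j%:R by rewrite -[j%:R]/(j%:Z%:~R) ltr_int.
have u1 : 0 < m%:~R / j%:R :> R by rewrite divr_gt0.
have u2 : m%:~R / j%:R < 1 :> R by rewrite ltr_pdivrMr// mul1r.
(* Halve the angle: [cos (2u) = 1] would force [sin u = 0], which is impossible for [0 < u < pi]. *)
have -> : y = (m%:~R / j%:R * pi) *+ 2 by rewrite /y; ring.
rewrite cos_mulr2n cos2sin2 => h.
have s0 : 0 < sin (m%:~R / j%:R * pi : R).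
  by apply: sin_gt0_pi; rewrite mulr_gt0//= -[ltRHS]mul1r ltr_pM2r.
have : sin (m%:~R / j%:R * pi : R) ^+ 2 = 0 by lra.
by move/eqP; rewrite sqrf_eq0 gt_eqF.
Qed.

(* Translating [h] by [2 pi / j] in a coordinate where [j] does not divide [k] multiplies
   the integral by a nontrivial root of unity. *)
Lemma torus_cint_dilate_ndvd (j : nat) (k : 'rV[int]_d) (i : 'I_d) x : (0 < j)%N ->
  ~~ (j%:Z %| k ord0 i)%Z ->
  torus_cint (fun h => f (j%:Z%:~R *: h + x) * expk k h) = 0.
Proof.
move=> j0 ji; have jz : j%:Z != 0 by rewrite eqz_nat -lt0n.
pose g h := f (j%:Z%:~R *: h + x) * expk k h.
have jR : (j%:R : R) != 0 by rewrite pnatr_eq0 -lt0n.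
have gi : cintegrable g by apply: cintegrable_fcoef; exact: cintegrable_dilate.
have mg := cintegrable_cmeasurable gi.
have pfn (m : nat) y l : f (y + m%:R *: ((2 * pi) *: delta_mx ord0 l)) = f y.
  elim: m => [|m IH]; first by rewrite scale0r addr0.
  by rewrite -natr1 scalerDl scale1r addrA pf.
have pg : Defs.periodic g.
  move=> h l; rewrite /g expk_periodic scalerDr addrAC.
  by rewrite -[j%:Z%:~R]/(j%:R) pfn.
pose b : 'rV[R]_d := (2 * pi / j%:R) *: delta_mx ord0 i.
have := torus_cint_shift b mg pg.
have -> : (fun h => g (h + b)) = (fun h => expk k b * g h).
  apply/funext => h; rewrite /g expk_shift scalerDr addrAC.
  rewrite (_ : j%:Z%:~R *: b = (2 * pi) *: delta_mx ord0 i); last first.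
    by rewrite /b scalerA -[j%:Z%:~R]/(j%:R); congr (_ *: _); field.
  by rewrite pf mulrA mulrC.
rewrite torus_cintZ// -/g expk_delta => E.
have {}E : (eix ((k ord0 i)%:~R * (2 * pi / j%:R)) - 1) * torus_cint g = 0.
  by rewrite mulrBl mul1r E subrr.
have : cabs (eix ((k ord0 i)%:~R * (2 * pi / j%:R) : R) - 1) * cabs (torus_cint g) = 0.
  by rewrite -cabsM E cabs0.
move/eqP; rewrite mulf_eq0 => /orP[|] /eqP/cabs_eq0 // /subr0_eq h.
by case: (eix_neq1 j0 ji).
Qed.

(** The kernel is the average over [l] in the cube of the sums over [k] of [expk (k - l)]. Against
    [f(j h + x)] such a character gives 0 unless [j] divides [k - l], and then a coefficient of [f]
    up to a unimodular factor. For fixed [l] distinct [k] give distinct coefficients, so each inner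
    sum is at most [M0]. The bound holds at every point [x], although nothing is known about the
    convergence of the Fourier series. *)
Lemma cabs_fejer_dilate n (j : nat) x : (0 < j)%N ->
  cabs (torus_cint (fun h => rC (fejer n h) * f (j%:Z%:~R *: h + x))) <= M0.
Proof.
move=> j0; have jz : j%:Z != 0 by rewrite eqz_nat -lt0n.
have fji := cintegrable_dilate x jz.
have M00 : 0 <= M0 by have := fM0 (isT : uniq [::]); rewrite big_nil.
pose J k := torus_cint (fun h => f (j%:Z%:~R *: h + x) * expk k h).
pose Nd : R := n.+1%:R ^+ d; have Nd0 : 0 < Nd by rewrite exprn_gt0.
have -> : torus_cint (fun h => rC (fejer n h) * f (j%:Z%:~R *: h + x)) =
    rC Nd^-1 * \sum_(l <- cube d n) \sum_(k <- cube d n) J (k - l).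
  have E h : rC (fejer n h) * f (j%:Z%:~R *: h + x) =
      rC Nd^-1 * \sum_(l <- cube d n) \sum_(k <- cube d n) f (j%:Z%:~R *: h + x) * expk (k - l) h.
    rewrite fejerE -mulrA; congr (_ * _); rewrite mulr_suml; apply: eq_bigr => l _.
    by rewrite mulr_suml; apply: eq_bigr => k _; rewrite mulrC.
  rewrite (funext E) torus_cintZ; last first.
    by apply: cintegrable_sum => l; apply: cintegrable_sum => k; exact: cintegrable_fcoef.
  congr (_ * _); rewrite torus_cint_sum => [|l]; last first.
    by apply: cintegrable_sum => k; exact: cintegrable_fcoef.
  by apply: eq_bigr => l _; rewrite torus_cint_sum// => k; exact: cintegrable_fcoef.
rewrite cabsM cabs_rC ger0_norm ?invr_ge0 ?(ltW Nd0)// ler_pdivrMl//.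
apply: (le_trans (ler_cabs_sum _ _ _)).
have -> : Nd * M0 = \sum_(l <- cube d n) M0.
  by rewrite big_const_seq count_predT iter_addr_0 size_cube -mulr_natl natrX.
apply: ler_sum => l _; apply: (le_trans (ler_cabs_sum _ _ _)).
pose dv (k : 'rV[int]_d) := [forall i : 'I_d, (j%:Z %| (k - l) ord0 i)%Z].
pose q (k : 'rV[int]_d) : 'rV[int]_d := \row_i (- ((k - l) ord0 i %/ j%:Z)%Z).
have qE k : dv k -> k - l = - (j%:Z *: q k).
  move=> /forallP h; apply/rowP => i.
  rewrite [in RHS]mxE [in RHS]mxE [in RHS]mxE mulrN opprK mulrC divzK//.
rewrite (bigID dv)/= [X in _ + X]big1 ?addr0 => [|k]; last first.
  rewrite negb_forall => /existsP[i ki].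
  by rewrite /J (torus_cint_dilate_ndvd _ j0 ki) cabs0.
rewrite (eq_bigr (fun k => cabs (fcoef f (q k)))) => [|k dk]; last first.
  by rewrite /J qE// torus_cint_dilate_dvd// cabsM cabs_expk mul1r.
rewrite -big_filter -(big_map q xpredT (fun l => cabs (fcoef f l))); apply: fM0.
rewrite map_inj_in_uniq ?filter_uniq ?uniq_cube// => k k'.
rewrite !mem_filter => /andP[dk _] /andP[dk' _] qq.
by apply: (addIr (- l)); rewrite (qE _ dk) (qE _ dk') qq.
Qed.

(** Average the difference of order [K] at [x] over the step [h]. Its term [j = 0] is [f x] up to
    sign, and the terms [f(x + j h)] with [j >= 1] are bounded by [cabs_fejer_dilate] with total
    weight at most [2^K]. *)
Lemma cabs_le_fejer n x : ((cabs (f x))%:E <=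
  (2 ^+ K * M0)%:E + 2%:E * \int[P]_h (fejer n h * cabs (fdiffk K h f x))%:E)%E.
Proof.
have M00 : 0 <= M0 by have := fM0 (isT : uniq [::]); rewrite big_nil.
pose A (j : nat) h := rC (fejer n h) * f (j%:Z%:~R *: h + x).
have FB (h : 'rV[R]_d) : cabs (rC (fejer n h) : C) <= n.+1%:R ^+ d.
  by rewrite cabs_rC ger0_norm ?fejer_ge0 ?fejer_le.
have mF : cmeasurable (fun h : 'rV[R]_d => rC (fejer n h)) by exact: cmeasurable_fejer.
have Ai j : cintegrable (A j).
  case: j => [|j].
    apply: (@cintegrable_bounded _ _ _ (n.+1%:R ^+ d * cabs (f x))).
      apply: cmeasurableM => //.
      have E h : f (0%:Z%:~R *: h + x) = f x by rewrite scale0r add0r.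
      by rewrite (funext E); exact: cmeasurable_cst.
    move=> h; rewrite /A cabsM scale0r add0r ler_wpM2r ?cabs_ge0//.
  apply: (@eq_cintegrable _ _ _ (fun h => f (j.+1%:Z%:~R *: h + x) * rC (fejer n h))).
    by move=> h; rewrite mulrC.
  by apply: (@cintegrableM _ _ _ _ (n.+1%:R ^+ d)) => //; exact: cintegrable_dilate.
pose g h := rC (fejer n h) * fdiffk K h f x.
have gE h : g h = \sum_(j < K.+1) rC (dcoef K j) * A j h.
  by rewrite /g fdiffkE mulr_sumr; apply: eq_bigr => j _; rewrite /A mulrCA.
have gi : cintegrable g.
  by apply: (eq_cintegrable gE); apply: cintegrable_sum => j; exact: cintegrableZ.
have gI : torus_cint g = \sum_(j < K.+1) rC (dcoef K j) * torus_cint (A j).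
  rewrite (funext gE) torus_cint_sum => [|j]; last exact: cintegrableZ.
  by apply: eq_bigr => j _; rewrite torus_cintZ.
have A0 : torus_cint (A 0%N) = f x.
  have E h : A 0%N h = f x * rC (fejer n h) by rewrite /A scale0r add0r mulrC.
  have Fi : cintegrable (fun h : 'rV[R]_d => rC (fejer n h)).
    exact: (@cintegrable_bounded _ _ _ (n.+1%:R ^+ d)).
  rewrite (funext E) torus_cintZ// (_ : torus_cint _ = 1) ?mulr1//.
  rewrite torus_cintE//; apply: complexE => /=; first by rewrite integral_fejer.
  by rewrite integral0.
have fx : cabs (f x) <= 2 ^+ K * M0 + cabs (torus_cint g).
  have -> : cabs (f x) = cabs (rC (dcoef K 0) * torus_cint (A 0%N)).
    by rewrite A0 cabsM cabs_rC dcoef0 normrX normrN1 expr1n mul1r.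
  move: gI; rewrite big_ord_recl/= => gI.
  rewrite (_ : rC (dcoef K 0) * _ = torus_cint g - \sum_(j < K)
      rC (dcoef K (bump 0 j)) * torus_cint (A (bump 0 j))); last by rewrite gI addrK.
  rewrite [leRHS]addrC (le_trans (ler_cabsB _ _))// lerD2l (le_trans (ler_cabs_sum _ _ _))//.
  apply: (@le_trans _ _ (\sum_(j < K) `|dcoef K (bump 0 j)| * M0)).
    apply: ler_sum => j _; rewrite cabsM cabs_rC ler_wpM2l// cabs_fejer_dilate//.
  rewrite -mulr_suml ler_wpM2r// (le_trans _ (sum_dcoef K))//.
  by rewrite [leRHS]big_ord_recl/= lerDr.
apply: (@le_trans _ _ (2 ^+ K * M0 + cabs (torus_cint g))%:E); first by rewrite lee_fin.
rewrite EFinD leeD2l// (le_trans (cabs_torus_cint gi))//.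
rewrite (_ : (\int[P]_h (cabs (g h))%:E = \int[P]_h (fejer n h * cabs (fdiffk K h f x))%:E)%E)//.
by apply: eq_integral => h _; rewrite /g cabsM cabs_rC ger0_norm// fejer_ge0.
Qed.

(** Joint measurability in the point and the step, as required to exchange their integrals. *)
Lemma measurable_fdiffk_pair :
  measurable_fun setT (fun xh : T * T => cabs (fdiffk K xh.2 f xh.1)).
Proof.
have mj (j : int) : measurable_fun setT (fun xh : T * T => (j%:~R *: xh.2 + xh.1 : T)).
  apply: measurable_fun_torus => i.
  rewrite (_ : (fun t => _) = (fun t : T * T => j%:~R * t.2 ord0 i + t.1 ord0 i)); last first.
    by apply/funext => t; rewrite !mxE.
  apply: measurable_funD.
    apply: measurable_funM => //.
    exact: (measurableT_comp (@measurable_coord_torus R d i) measurable_snd).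
  exact: (measurableT_comp (@measurable_coord_torus R d i) measurable_fst).
have [m1 m2] := (@cmeasurableP R d f).1 mf.
have mRe : measurable_fun setT (fun xh : T * T => complex.Re (fdiffk K xh.2 f xh.1)).
  rewrite (_ : (fun xh => _) = (fun xh : T * T =>
     \sum_(j < K.+1) dcoef K j * complex.Re (f (j%:Z%:~R *: xh.2 + xh.1)))); last first.
    apply/funext => xh; rewrite fdiffkE cRe_sum; apply: eq_bigr => j _.
    by rewrite cReM/= mul0r subr0.
  by apply: measurable_sum => j; apply: measurable_funM => //; exact: (measurableT_comp m1 (mj _)).
have mIm : measurable_fun setT (fun xh : T * T => complex.Im (fdiffk K xh.2 f xh.1)).
  rewrite (_ : (fun xh => _) = (fun xh : T * T =>
     \sum_(j < K.+1) dcoef K j * complex.Im (f (j%:Z%:~R *: xh.2 + xh.1)))); last first.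
    apply/funext => xh; rewrite fdiffkE cIm_sum; apply: eq_bigr => j _.
    by rewrite cImM/= mul0r addr0.
  by apply: measurable_sum => j; apply: measurable_funM => //; exact: (measurableT_comp m2 (mj _)).
apply: (measurableT_comp (f := @Num.sqrt R)).
  by apply: continuous_measurable_fun; exact: sqrt_continuous.
by apply: measurable_funD; exact: measurable_funX.
Qed.

Lemma fdiffk_periodic m (h : 'rV[R]_d) (z : 'rV[int]_d) x :
  fdiffk m (h + (2 * pi) *: map_mx intr z) f x = fdiffk m h f x.
Proof.
have p1 (w : int) (j : 'I_d) y : f (y + (w%:~R * (2 * pi)) *: delta_mx ord0 j) = f y.
  have H (v : nat) y' : f (y' + (v%:R * (2 * pi)) *: delta_mx ord0 j) = f y'.
    elim: v => [|v IH]; first by rewrite mul0r scale0r addr0.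
    by rewrite -natr1 mulrDl mul1r scalerDl addrA pf.
  case: w => v; first exact: H.
  by rewrite -[LHS](H v.+1) NegzE mulrNz mulNr scaleNr subrK.
have p2 (s : seq 'I_d) (w : 'I_d -> int) y :
    f (y + \sum_(j <- s) ((w j)%:~R * (2 * pi)) *: delta_mx ord0 j) = f y.
  elim: s y => [|j s IH] y; first by rewrite big_nil addr0.
  by rewrite big_cons addrA IH p1.
have p3 (w : 'rV[int]_d) y : f (y + (2 * pi) *: map_mx intr w) = f y.
  rewrite -[RHS](p2 (index_enum 'I_d) (fun j => w ord0 j)); congr (f (_ + _)).
  apply/rowP => i; rewrite summxE (bigD1 i)//= big1 ?addr0 => [|j ji].
    by rewrite !mxE !eqxx mulr1 mulrC.
  by rewrite !mxE [i == j]eq_sym (negbTE ji) andbF mulr0.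
rewrite !fdiffkE; apply: eq_bigr => j _; congr (_ * _).
rewrite scalerDr -[RHS](p3 (j%:Z *: z)); congr f.
rewrite addrAC; congr (_ + _); apply/rowP => i; rewrite !mxE intrM; ring.
Qed.

Lemma reduce_mod2pi (x : R) : exists z : int, `|x + 2 * pi * z%:~R| <= pi.
Proof.
have p0 : 0 < 2 * pi :> R by rewrite mulr_gt0// pi_gt0.
have key (v w : R) : w <= v -> v < w + 1 -> `|(v - 2^-1) * (2 * pi) + 2 * pi * - w| <= pi.
  move=> v1 v2; rewrite (_ : _ + _ = (v - w - 2^-1) * (2 * pi)); last by ring.
  rewrite normrM [`|2 * pi|]gtr0_norm// -ler_pdivlMr//.
  rewrite (_ : pi / (2 * pi) = 2^-1); last by rewrite invfM mulrCA divff ?mulr1 ?gt_eqF ?pi_gt0.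
  by rewrite ler_norml; lra.
pose v := x / (2 * pi) + 2^-1.
exists (- Num.floor v); have v1 := Num.Theory.floor_le v.
have := Num.Theory.floorD1_gt v; rewrite intrD => v2.
have E : x = (v - 2^-1) * (2 * pi) by rewrite /v addrK divfK// gt_eqF.
rewrite E mulrNz; apply: key v1 v2.
Qed.

Variables (B r : R).
Hypotheses (B0 : 0 <= B) (r0 : 0 < r).
Hypothesis frho : forall (h : 'rV[R]_d) (t : R), 0 < t -> enorm h <= t ->
  (\int[P]_x (cabs (fdiffk K h f x))%:E <= (B * t `^ r)%:E)%E.

Lemma enorm_le (h : 'rV[R]_d) (t : R) : 0 <= t -> (forall j, `|h ord0 j| <= t) ->
  enorm h <= d.+1%:R * t.
Proof.
move=> t0 ht; rewrite /enorm -[leRHS]ger0_norm ?mulr_ge0// -sqrtr_sqr ler_wsqrtr//.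
apply: (@le_trans _ _ (\sum_(j < d) t ^+ 2)).
  by apply: ler_sum => j _; rewrite -real_normK ?num_real// lerXn2r ?nnegrE.
rewrite sumr_const card_ord exprMn -[leLHS]mulr_natl ler_wpM2r ?sqr_ge0//.
by rewrite -natrX ler_nat; nia.
Qed.

(** Near the origin [B t^r] is below [eps]. Elsewhere modulo periods some [1 - cos (h_j)] is bounded
    below and absorbs the differences. The majorant is chosen so that its Fejer mean is controlled
    by [integral_fejer_cos]. *)
Lemma frho_split (eps : R) : 0 < eps -> exists2 c : R, 0 <= c & forall h : 'rV[R]_d,
  (\int[P]_x (cabs (fdiffk K h f x))%:E <=
    (eps + c * \sum_(j < d) (1 - cos (h ord0 j)))%:E)%E.
Proof.
move=> eps0; have p0 := @pi_gt0 R.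
have B1 : 0 < B + 1 by rewrite ltr_wpDl.
have [D [D0 DE]] : exists D : R, 0 < D /\ forall (h : 'rV[R]_d) t, 0 <= t ->
    (forall j, `|h ord0 j| <= t) -> enorm h <= D * t.
  by exists d.+1%:R; split => //; exact: enorm_le.
(* The solution of [(B + 1) (D dl0)^r = eps]; [B + 1] avoids dividing by a vanishing [B]. *)
pose dl0 : R := (eps / (B + 1)) `^ r^-1 / D.
have dl00 : 0 < dl0 by rewrite divr_gt0// powR_gt0// divr_gt0.
pose dl := Num.min dl0 pi.
have dl_gt0 : 0 < dl by rewrite lt_min dl00.
have dlpi : dl <= pi by rewrite ge_min lexx orbT.
have small : B * (D * dl) `^ r <= eps.
  apply: (@le_trans _ _ (B * (eps / (B + 1)))).
    rewrite ler_wpM2l//.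
    have -> : eps / (B + 1) = ((eps / (B + 1)) `^ r^-1) `^ r.
      by rewrite -powRrM mulVf ?gt_eqF// powRr1// divr_ge0 ?(ltW eps0)// ltW.
    rewrite ge0_ler_powR ?nnegrE ?powR_ge0 ?(ltW r0)//.
      by rewrite mulr_ge0// ltW.
    rewrite (@le_trans _ _ (D * dl0))//.
      by rewrite ler_wpM2l ?(ltW D0)// ge_min lexx.
    by rewrite /dl0 mulrC divfK// gt_eqF.
  by rewrite mulrCA ler_piMr ?(ltW eps0)// ler_pdivrMr//; lra.
have gap : 0 < 1 - cos dl.
  have : cos dl < cos 0.
    by rewrite ltr_cos ?in_itv/=; rewrite ?lexx ?(ltW dl_gt0) ?(ltW p0) ?dlpi.
  by rewrite cos0; lra.
pose B' := B * (D * pi) `^ r.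
have B'0 : 0 <= B' by rewrite mulr_ge0// powR_ge0.
exists (B' / (1 - cos dl)) => [|h0]; first by rewrite divr_ge0// ltW.
(* Both sides depend on the step only modulo [2 pi], so it may be moved into the cube [[-pi, pi]^d],
   where [1 - cos] vanishes at the origin alone. *)
have [zf zfP] := choice (fun j => reduce_mod2pi (h0 ord0 j)).
pose h := h0 + (2 * pi) *: map_mx intr (\row_j zf j).
have hjE j : h ord0 j = h0 ord0 j + 2 * pi * (zf j)%:~R by rewrite !mxE.
have hj j : `|h ord0 j| <= pi by rewrite hjE.
have cosE j : cos (h0 ord0 j) = cos (h ord0 j).
  have := eixD (h0 ord0 j) ((zf j)%:~R * (2 * pi)).
  by rewrite eix_mulz2pi mulr1 hjE mulrC => /(congr1 (@complex.Re R)).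
have -> : (\int[P]_x (cabs (fdiffk K h0 f x))%:E = \int[P]_x (cabs (fdiffk K h f x))%:E)%E.
  by apply: eq_integral => x _; rewrite /h fdiffk_periodic.
under eq_bigr do rewrite cosE.
have S0 : 0 <= \sum_(j < d) (1 - cos (h ord0 j)).
  by apply: sumr_ge0 => j _; rewrite subr_ge0 cos_le1.
have [/forallP hd|] := boolP [forall j, `|h ord0 j| <= dl].
  apply: (le_trans (@frho h (D * dl) _ _)).
  - by rewrite mulr_gt0.
  - by apply: DE => //; exact: ltW.
  rewrite lee_fin (le_trans small)// lerDl mulr_ge0// divr_ge0// ltW//.
rewrite negb_forall => /existsP[j]; rewrite -ltNge => hjd.
apply: (le_trans (@frho h (D * pi) _ _)).
- by rewrite mulr_gt0.
- by apply: DE => //; exact: ltW.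
rewrite lee_fin -/B' ler_wpDl ?(ltW eps0)// mulrAC ler_pdivlMr// ler_wpM2l//.
rewrite (bigD1 j)//=; apply: ler_wpDr.
  by apply: sumr_ge0 => i _; rewrite subr_ge0 cos_le1.
rewrite lerD2l lerN2 -(cos_norm (h ord0 j)) leNgt ltr_cos ?in_itv/= -?leNgt ?(ltW hjd)//.
- by rewrite normr_ge0 hj.
- by rewrite ltW//= dlpi.
Qed.

(** Integrate [cabs_le_fejer] in [x] and exchange the integrals: the excess is at most twice a Fejer
    mean of the mean differences, which tends to 0 with growing [n] because these differences are
    small near [h = 0]. *)
Lemma excess_integral (u := fun x => Num.max (cabs (f x) - 2 ^+ K * M0) 0) :
  (\int[P]_x (u x)%:E = 0)%E.
Proof.
have u0 x : 0 <= u x by rewrite le_max lexx orbT.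
have mc : measurable_fun setT (fun x : T => cabs (f x)) by exact: measurable_cabs.
suff H (eps : R) : 0 < eps -> (\int[P]_x (u x)%:E <= eps%:E)%E.
  apply/eqP; rewrite eq_le integral_ge0 ?andbT => [|x _]; last by rewrite lee_fin.
  by apply/lee_addgt0Pr => e e0; rewrite add0e; exact: H.
(* The Fejer mean of the majorant is at most [eps/4 + c d / (n+1)]; doubled by [cabs_le_fejer], each
   part is at most [eps/2]. *)
move=> eps0; have e4 : 0 < eps / 4 by lra.
have [c c0 cH] := frho_split e4.
have [n nH] : exists n : nat, 2 * (c * d%:R) / n.+1%:R <= eps / 2.
  exists (Num.truncn (2 * (c * d%:R) / (eps / 2))).
  rewrite ler_pdivrMr// -ler_pdivrMl; last by lra.
  by rewrite mulrC ltW// truncnS_gt.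
have mF : measurable_fun setT (fun h : T => fejer n h).
  by have [] := (@cmeasurableP R d _).1 (cmeasurable_fejer R d n).
have mp := measurable_fdiffk_pair.
have mG : measurable_fun setT (fun xh : T * T => (fejer n xh.2 * cabs (fdiffk K xh.2 f xh.1))%:E).
  apply/measurable_EFinP; apply: measurable_funM => //.
  exact: (measurableT_comp mF measurable_snd).
have G0 (xh : T * T) : (0 <= (fejer n xh.2 * cabs (fdiffk K xh.2 f xh.1))%:E)%E.
  by rewrite lee_fin mulr_ge0 ?fejer_ge0 ?cabs_ge0.
have I1 : (\int[P]_x (u x)%:E <=
    2%:E * \int[P]_x \int[P]_h (fejer n h * cabs (fdiffk K h f x))%:E)%E.
  rewrite -ge0_integralZl//; last 2 first.
  - exact: (@measurable_fun_fubini_tonelli_F _ _ _ _ _ P _ mG G0).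
  - by move=> x _; apply: integral_ge0 => h _; exact: (G0 (x, h)).
  apply: le_integral_ge0 => x _; first by rewrite lee_fin.
  have I0 : (0 <= \int[P]_h (fejer n h * cabs (fdiffk K h f x))%:E)%E.
    by apply: integral_ge0 => h _; exact: (G0 (x, h)).
  rewrite /u EFin_max ge_max mule_ge0// andbT EFinB leeBlDl//.
  exact: cabs_le_fejer.
apply: (le_trans I1).
have -> : (\int[P]_x \int[P]_h (fejer n h * cabs (fdiffk K h f x))%:E =
    \int[P]_h \int[P]_x (fejer n h * cabs (fdiffk K h f x))%:E)%E.
  exact: (fubini_tonelli (m1 := P) (m2 := P) _ mG G0).
have mcos j : measurable_fun setT (fun h : T => (fejer n h * (1 - cos (h ord0 j)))%:E).
  apply/measurable_EFinP; apply: measurable_funM => //; apply: measurable_funB => //.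
  apply: (measurableT_comp _ (@measurable_coord_torus R d j)).
  by apply: continuous_measurable_fun; exact: continuous_cos.
have fc0 j h : (0 <= (fejer n h * (1 - cos (h ord0 j)))%:E)%E.
  by rewrite lee_fin mulr_ge0 ?fejer_ge0// subr_ge0 cos_le1.
apply: (@le_trans _ _ (2%:E * \int[P]_h ((eps / 4)%:E * (fejer n h)%:E +
    c%:E * \sum_(j < d) (fejer n h * (1 - cos (h ord0 j)))%:E))%E).
  rewrite lee_wpmul2l//; apply: le_integral_ge0 => h _.
    by apply: integral_ge0 => x _; exact: (G0 (x, h)).
  under eq_integral do rewrite EFinM.
  rewrite ge0_integralZl//; last 3 first.
  - apply/measurable_EFinP; apply: measurable_cabs.
    by apply: cintegrable_cmeasurable; have [] := fdiffk_props h K fi pf.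
  - by move=> x _; rewrite lee_fin cabs_ge0.
  - by rewrite lee_fin fejer_ge0.
  apply: (@le_trans _ _ ((fejer n h)%:E * (eps / 4 + c * \sum_(j < d) (1 - cos (h ord0 j)))%:E)%E).
    by rewrite lee_wpmul2l// lee_fin fejer_ge0.
  rewrite sumEFin -!EFinM -EFinD lee_fin -mulr_sumr.
  by rewrite le_eqVlt; apply/orP; left; apply/eqP; ring.
have mFE : measurable_fun setT (fun h : T => (fejer n h)%:E) by exact/measurable_EFinP.
have msum : measurable_fun setT (fun h : T => (\sum_(j < d) (fejer n h * (1 - cos (h ord0 j)))%:E)%E).
  by apply: emeasurable_sum => j _; exact: mcos.
have sum0 h : (0 <= \sum_(j < d) (fejer n h * (1 - cos (h ord0 j)))%:E)%E.
  by apply: sume_ge0 => j _; exact: fc0.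
rewrite ge0_integralD//; last 4 first.
- by move=> h _; rewrite mule_ge0// lee_fin ?fejer_ge0// ltW.
- exact: measurable_funeM.
- by move=> h _; rewrite mule_ge0.
- exact: measurable_funeM.
rewrite ge0_integralZl//; last 2 first.
- by move=> h _; rewrite lee_fin fejer_ge0.
- by rewrite lee_fin ltW.
rewrite integral_fejer mule1 ge0_integralZl//.
rewrite ge0_integral_sum//.
apply: (@le_trans _ _ (2%:E * ((eps / 4)%:E + c%:E * \sum_(j < d) (n.+1%:R^-1)%:E))%E).
  rewrite lee_wpmul2l// leeD2l// lee_wpmul2l// lee_sum// => j _.
  exact: integral_fejer_cos.
rewrite sumEFin -[leLHS]/((2 * (eps / 4 + c * \sum_(j < d) n.+1%:R^-1))%:E) lee_fin.
rewrite sumr_const card_ord -[_ *+ d]mulr_natl.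
rewrite mulrDr mulrA [X in _ + X](_ : _ = 2 * (c * d%:R) / n.+1%:R); last by ring.
have half (e : R) : 2 * e / 4 + e / 2 = e by field.
by rewrite -[leRHS]half lerD2l.
Qed.

Lemma ess_bounded_Lpnorm (q : R) : 0 < q -> (Lpnorm q f < +oo)%E.
Proof.
move=> q0; have M00 : 0 <= M0 by have := fM0 (isT : uniq [::]); rewrite big_nil.
pose M := 2 ^+ K * M0; have M0' : 0 <= M by rewrite mulr_ge0// exprn_ge0.
have E := excess_integral.
have mu : measurable_fun setT (fun x : T => (Num.max (cabs (f x) - M) 0)%:E).
  by apply/measurable_EFinP; apply: measurable_maxr => //; apply: measurable_funB => //; exact: measurable_cabs.
have ae0 : {ae P, forall x, setT x -> (Num.max (cabs (f x) - M) 0)%:E = 0%E}.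
  apply/(ae_eq_integral_abs P measurableT mu).
  by under eq_integral do rewrite gee0_abs ?lee_fin ?le_max ?lexx ?orbT//.
apply: (@le_lt_trans _ _ M%:E); last by rewrite ltry.
apply/Lpnorm_leP => //.
apply: (@le_trans _ _ (\int[P]_x (cst (M `^ q)%:E x))%E).
  apply: ae_ge0_le_integral => //.
  - by move=> x _; rewrite lee_fin powR_ge0.
  - exact: measurable_cabs_powR.
  - by move=> x _; rewrite lee_fin powR_ge0.
  case: ae0 => A [mA A0 sA]; exists A; split => // x /= nx; apply: sA => /= h; apply: nx => _.
  have [{}h] := h I; rewrite lee_fin ge0_ler_powR ?nnegrE ?cabs_ge0 ?(ltW q0)//.
  by rewrite -subr_le0 -h le_max lexx.
by rewrite integral_cst// [X in (_ * X)%E](_ : _ = 1%E) ?mule1//; exact: probability_setT.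
Qed.

End EssentialBound.

(** * Derandomised sampling with an exponential potential *)

Section ExponentialPotential.
Variable R : realType.

(** From [expR (- y) >= 1 - y] comes [expR y <= 1 / (1 - y)], and [(1 + y + 2 y^2)(1 - y) = 1 + y^2
    (1 - 2y) >= 1]. *)
Lemma expR_le_quadratic (y : R) : y <= 2^-1 -> expR y <= 1 + y + 2 * y ^+ 2.
Proof.
move=> y2; have h := expR_ge1Dx (- y).
have y1 : 0 < 1 - y by lra.
have e0 := expR_gt0 y.
have : expR y * (1 - y) <= 1.
  by rewrite -[leRHS](expRxMexpNx_1 y) ler_wpM2l// ltW.
rewrite -ler_pdivlMr// div1r => /le_trans; apply.
rewrite -div1r ler_pdivrMr//.
have -> : (1 + y + 2 * y ^+ 2) * (1 - y) = 1 + y ^+ 2 * (1 - 2 * y) by ring.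
by rewrite lerDl mulr_ge0 ?sqr_ge0//; lra.
Qed.

(** The [q]-th power of [y/q <= expR (y/q)]. It lets one exponential moment control the moment of
    order [q]. *)
Lemma powR_le_exp (q y : R) : 0 < q -> 0 <= y -> y `^ q <= q `^ q * expR y.
Proof.
move=> q0 y0.
have h : y / q <= expR (y / q).
  by have := expR_ge1Dx (y / q); lra.
have -> : y = q * (y / q) by rewrite mulrCA divff ?gt_eqF// mulr1.
have yq : 0 <= y / q by rewrite divr_ge0// ltW.
rewrite powRM ?(ltW q0)// ler_wpM2l ?powR_ge0//.
rewrite [X in _ <= expR X]mulrC expRM.
by rewrite ge0_ler_powR ?nnegrE ?expR_ge0// ltW.
Qed.

Variables (disp : measure_display) (T : measurableType disp) (P : probability T R).
Variables (I J : finType) (p : I -> R) (w : J -> R) (u : I -> J -> T -> R).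
Hypotheses (p0 : forall i, 0 <= p i) (p1 : \sum_i p i = 1) (w0 : forall j, 0 <= w j).
Hypotheses (mu : forall i j, measurable_fun setT (u i j)) (u1 : forall i j x, `|u i j x| <= 1).
Hypothesis ubar : forall j x, \sum_i p i * u i j x = 0.
Variable lm : R.
Hypothesis lm_itv : 0 <= lm <= 2^-1.
Local Open Scope ereal_scope.

(** The linear term of [expR_le_quadratic] averages to 0 by [ubar], which leaves only the quadratic
    one. *)
Lemma mean_exp_le j x : (\sum_i p i * expR (lm * u i j x) <= 1 + 2 * lm ^+ 2)%R.
Proof.
apply: (@le_trans _ _ (\sum_i (p i + lm * (p i * u i j x) + 2 * lm ^+ 2 * p i)))%R.
  apply: ler_sum => i _.
  have := u1 i j x; rewrite ler_norml => /andP[ul ur].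
  have /andP[l0 l2] := lm_itv.
  have e : (expR (lm * u i j x) <= 1 + lm * u i j x + 2 * lm ^+ 2)%R.
    apply: (le_trans (expR_le_quadratic _)); first by nra.
    rewrite lerD2l ler_pM2l// exprMn -[leRHS]mulr1 ler_wpM2l ?sqr_ge0//; nra.
  apply: (le_trans (ler_wpM2l (p0 i) e)); rewrite le_eqVlt; apply/orP; left; apply/eqP; ring.
rewrite !big_split/= -!mulr_sumr p1 ubar; lra.
Qed.

Definition potential (S : J -> T -> R) : \bar R :=
  \sum_j (w j)%:E * \int[P]_x (expR (lm * S j x))%:E.

Lemma measurable_expR_scaled (v : T -> R) : measurable_fun setT v ->
  measurable_fun setT (fun x => (expR (lm * v x))%:E).
Proof.
move=> mv; apply/measurable_EFinP; apply: measurableT_comp => //.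
exact: measurable_funM.
Qed.

(** The method of conditional expectations: by [mean_exp_le] under the integral sign, the
    [p]-average of the potentials after one more step obeys the bound, and the minimising index does
    no worse than the average. *)
Lemma greedy_step (S : J -> T -> R) : (forall j, measurable_fun setT (S j)) ->
  exists i, potential (fun j x => S j x + u i j x)%R <= (1 + 2 * lm ^+ 2)%:E * potential S.
Proof.
move=> mS; pose Phi i := potential (fun j x => S j x + u i j x)%R.
(* The index set is inhabited because [p] has total mass 1. *)
have [i0 _] : exists i0 : I, True.
  apply: contrapT => /forallNP h; have : (\sum_i p i = 0)%R by rewrite big1// => i; have := h i.
  by rewrite p1 => /eqP; rewrite oner_eq0.
pose i := [arg min_(i < i0) Phi i]%O.
have imin k : Phi i <= Phi k by rewrite /i; case: arg_minP => // i' _; exact.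
exists i; rewrite -/(Phi i).
have Phi0 k : 0 <= Phi k.
  apply: sume_ge0 => j _; rewrite mule_ge0 ?lee_fin//; apply: integral_ge0 => x _.
  by rewrite lee_fin expR_ge0.
have E0 (v : T -> R) : 0 <= \int[P]_x (expR (lm * v x))%:E.
  by apply: integral_ge0 => x _; rewrite lee_fin expR_ge0.
apply: (@le_trans _ _ (\sum_k (p k)%:E * Phi k)).
  rewrite -[leLHS]mul1e -p1 -sumEFin ge0_sume_distrl => [|k _]; last by rewrite lee_fin.
  by apply: lee_sum => k _; rewrite lee_wpmul2l// lee_fin.
rewrite /Phi /potential.
under eq_bigr => k _.
  rewrite ge0_sume_distrr => [|j _]; last by rewrite mule_ge0 ?lee_fin// E0.
  over.
rewrite exchange_big/= ge0_sume_distrr => [|j _]; last by rewrite mule_ge0 ?lee_fin// E0.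
apply: lee_sum => j _.
under eq_bigr do rewrite muleCA.
rewrite -ge0_sume_distrr => [|k _]; last by rewrite mule_ge0 ?lee_fin// E0.
rewrite muleCA lee_wpmul2l ?lee_fin//.
have mSu k : measurable_fun setT (fun x => (expR (lm * (S j x + u k j x)))%:E).
  by apply: measurable_expR_scaled; exact: measurable_funD.
have zl k : (p k)%:E * \int[P]_x (expR (lm * (S j x + u k j x)))%:E =
    \int[P]_x ((p k)%:E * (expR (lm * (S j x + u k j x)))%:E).
  by rewrite ge0_integralZl ?lee_fin// => x _; rewrite lee_fin expR_ge0.
under eq_bigr do rewrite zl.
rewrite -ge0_integral_sum//; last 2 first.
- by move=> k; exact: measurable_funeM.
- by move=> k x _; rewrite mule_ge0 ?lee_fin ?expR_ge0.
have c0 : (0 <= 1 + 2 * lm ^+ 2)%R by rewrite addr_ge0// mulr_ge0// sqr_ge0.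
rewrite -ge0_integralZl//; last exact: measurable_expR_scaled.
apply: le_integral_ge0 => x _.
  by apply: sume_ge0 => k _; rewrite mule_ge0 ?lee_fin ?expR_ge0.
under eq_bigr do rewrite -EFinM mulrDr expRD mulrCA.
rewrite sumEFin -mulr_sumr -EFinM lee_fin mulrC ler_wpM2r ?expR_ge0//.
exact: mean_exp_le.
Qed.

Lemma greedy M : exists s : seq I, size s = M /\
  potential (fun j x => \sum_(i <- s) u i j x)%R <= ((1 + 2 * lm ^+ 2) ^+ M * \sum_j w j)%:E.
Proof.
elim: M => [|M [s [sM IH]]].
  exists [::]; split => //; rewrite expr0 mul1r /potential -sumEFin; apply: lee_sum => j _.
  rewrite -[leRHS]mule1 lee_wpmul2l ?lee_fin//.
  under eq_integral do rewrite big_nil mulr0 expR0.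
  by rewrite integral_cst// mul1e [leLHS](_ : _ = 1)//; exact: probability_setT.
have [|i ih] := @greedy_step (fun j x => \sum_(i <- s) u i j x)%R.
  by move=> j; apply: measurable_sum.
exists (i :: s); split; first by rewrite /= sM.
rewrite (_ : (fun j x => _) = (fun j x => \sum_(i <- s) u i j x + u i j x)%R); last first.
  by apply/funext => j; apply/funext => x; rewrite big_cons addrC.
apply: (le_trans ih); rewrite [in leRHS](exprS _ M) -[in leRHS]mulrA [leRHS]EFinM lee_wpmul2l// lee_fin.
by rewrite addr_ge0// mulr_ge0// sqr_ge0.
Qed.

End ExponentialPotential.

Section MaureyBound.
Variable R : realType.
Variable d : nat.
Local Notation C := (complex.complex R).
Local Notation Re := (@complex.Re R).
Local Notation Im := (@complex.Im R).
Local Notation T := (Torus R d).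
Local Notation P := (torus_prob R d).
Variables (I J : finType) (p : I -> R) (w B : J -> R) (v : I -> J -> 'rV[R]_d -> C).
Hypotheses (p0 : forall i, 0 <= p i) (p1 : \sum_i p i = 1) (w0 : forall j, 0 < w j).
Hypotheses (B0 : forall j, 0 < B j) (mv : forall i j, cmeasurable (v i j)).
Hypothesis vB : forall i j x, cabs (v i j x) <= B j.
Hypothesis vbar : forall j x, \sum_i rC (p i) * v i j x = 0.
Variable q : R.
Hypothesis q0 : 0 < q.

(** In [(4q)^q] one factor 2 passes from a modulus to its real or imaginary part and the other is
    that of [lm]. Of the 16, one 4 counts the directions in the initial potential and one those in
    the moment bound; [expR 1] bounds the growth of the potential. *)
Definition maurey_const : R := (4 * q) `^ q * (16 * expR 1).

Let dirpart (b : bool * bool) (z : C) : R :=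
  (if b.1 then 1 else -1) * (if b.2 then Re z else Im z).

Let norm_dirpart b z : `|dirpart b z| <= cabs z.
Proof.
rewrite /dirpart normrM (_ : `|if b.1 then 1 else -1| = 1); last first.
  by case: b.1; rewrite ?normrN normr1.
by rewrite mul1r; case: b.2; [exact: ler_Re_cabs|exact: ler_Im_cabs].
Qed.

Let dirpart_sum b (K : Type) (s : seq K) (F : K -> C) :
  dirpart b (\sum_(i <- s) F i) = \sum_(i <- s) dirpart b (F i).
Proof.
rewrite /dirpart -mulr_sumr; congr (_ * _).
by case: b.2; rewrite ?cRe_sum ?cIm_sum.
Qed.

Let dirpartZ b (a : R) z : dirpart b (rC a * z) = a * dirpart b z.
Proof.
rewrite /dirpart mulrCA; congr (_ * _).
by case: b.2; rewrite ?cReM ?cImM/= mul0r ?subr0 ?addr0.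
Qed.

(* One of the four directions [+-Re], [+-Im] carries at least half of [cabs z]. *)
Let cabs_powR_le (z : C) (c : R) : 0 <= c ->
  (c * cabs z) `^ q <= (2 * q) `^ q * \sum_(b : bool * bool) expR (c * dirpart b z).
Proof.
move=> c0; pose m := Num.max `|Re z| `|Im z|.
have m0 : 0 <= m by rewrite le_max normr_ge0.
have h1 : (c * cabs z) `^ q <= (2 * (c * m)) `^ q.
  rewrite ge0_ler_powR ?nnegrE ?(ltW q0)//; first by rewrite mulr_ge0// cabs_ge0.
    by rewrite !mulr_ge0.
  rewrite mulrCA ler_wpM2l// (le_trans (ler_cabs_ReIm z))// mulr_natl mulr2n lerD//.
    by rewrite le_max lexx.
  by rewrite le_max lexx orbT.
apply: (le_trans h1); rewrite (@powRM _ 2 (c * m)) ?mulr_ge0// (@powRM _ 2 q) ?(ltW q0)// -mulrA ler_wpM2l ?powR_ge0//.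
apply: (le_trans (powR_le_exp q0 _)); first by rewrite mulr_ge0.
rewrite ler_wpM2l ?powR_ge0//.
have [b hb] : exists b, m = dirpart b z.
  rewrite /m /dirpart; case: leP => _.
    case: (leP 0 (Im z)) => h; [exists (true, false)|exists (false, false)] => /=.
      by rewrite mul1r ger0_norm.
    by rewrite mulN1r ltr0_norm.
  case: (leP 0 (Re z)) => h; [exists (true, true)|exists (false, true)] => /=.
    by rewrite mul1r ger0_norm.
  by rewrite mulN1r ltr0_norm.
by rewrite hb (bigD1 b)//= lerDl sumr_ge0// => b' _; exact: expR_ge0.
Qed.

(** Maurey's empirical method for all [j] at once: the greedy choice runs on the normalised [v i j]
    in all four directions, and each moment is read off from single summands of the final potential.
    Isolating [j] costs the inverse of its share of the total weight. *)
Lemma maurey M : (0 < M)%N -> exists s : seq I, size s = M /\ forall j,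
  (\int[P]_x (cabs (\sum_(i <- s) v i j x) `^ q)%:E <=
    (maurey_const * ((\sum_j w j) / w j) * (B j * Num.sqrt M%:R) `^ q)%:E)%E.
Proof.
move=> M0; have MR : (0 : R) < M%:R by rewrite ltr0n.
pose rM : R := Num.sqrt M%:R; have rM0 : 0 < rM by rewrite sqrtr_gt0.
have rM1 : 1 <= rM by rewrite -sqrtr1 ler_wsqrtr// ler1n.
(* Of order [M^(-1/2)], so that [M] steps multiply the potential by [(1 + 1/(2M))^M <= e] only; the
   2 keeps [lm <= 1/2] even for [M = 1]. *)
pose lm : R := (2 * rM)^-1.
have lm0 : 0 < lm by rewrite invr_gt0 mulr_gt0.
have lm_itv : 0 <= lm <= 2^-1.
  by rewrite ltW//= lef_pV2 ?posrE ?mulr_gt0//; lra.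
pose u (i : I) (jb : J * (bool * bool)) (x : 'rV[R]_d) : R := (B jb.1)^-1 * dirpart jb.2 (v i jb.1 x).
pose w' (jb : J * (bool * bool)) : R := w jb.1.
have mdir b (g : 'rV[R]_d -> C) : cmeasurable g ->
    measurable_fun setT (fun x : T => dirpart b (g x)).
  move=> /cmeasurableP[g1 g2]; apply: measurable_funM => //.
  by case: b => b1 [].
have mu i jb : measurable_fun setT (u i jb : T -> R).
  by apply: measurable_funM => //; exact: mdir.
have u1 i jb x : `|u i jb x| <= 1.
  rewrite /u normrM gtr0_norm ?invr_gt0// mulrC ler_pdivrMr// mul1r.
  exact: le_trans (norm_dirpart _ _) (vB _ _ _).
have ubar jb x : \sum_i p i * u i jb x = 0.
  under eq_bigr do rewrite /u mulrCA -dirpartZ.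
  rewrite -mulr_sumr -dirpart_sum vbar /dirpart.
  by case: jb.2.2; rewrite /= !mulr0.
have [s [sM sP]] := @greedy R _ T P I _ p w' u p0 p1 (fun jb => ltW (w0 _)) mu u1 ubar lm lm_itv M.
exists s; split => // j.
pose S x := \sum_(i <- s) v i j x.
have mS : cmeasurable S by apply: cmeasurable_sum => i.
have W4 : \sum_jb w' jb = 4 * \sum_j w j.
  rewrite -(pair_bigA _ (fun j (b : bool * bool) => w j))/= mulr_sumr; apply: eq_bigr => k _.
  by rewrite sumr_const card_prod card_bool mulr_natl.
have W0 : 0 <= \sum_j w j by apply: sumr_ge0 => k _; exact: ltW.
have growth : (1 + 2 * lm ^+ 2) ^+ M <= expR 1.
  have -> : 2 * lm ^+ 2 = (2 * M%:R)^-1.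
    by rewrite /lm exprVn exprMn sqr_sqrtr ?(ltW MR)//; field; rewrite (gt_eqF MR).
  apply: (@le_trans _ _ (expR (2 * M%:R)^-1 ^+ M)).
    by rewrite lerXn2r ?nnegrE ?expR_ge0 ?expR_ge1Dx// addr_ge0// invr_ge0 mulr_ge0// ltW.
  rewrite -expRM_natl ler_expR.
  have -> : M%:R * (2 * M%:R)^-1 = 2^-1 :> R by field; exact: lt0r_neq0.
  by rewrite invf_le1 ?ler1n.
have each b : (\int[P]_x (expR (lm / B j * dirpart b (S x)))%:E <=
    (expR 1 * (4 * (\sum_j w j)) / w j)%:E)%E.
  have : ((w j)%:E * \int[P]_x (expR (lm / B j * dirpart b (S x)))%:E <=
      (expR 1 * (4 * \sum_j w j))%:E)%E.
    apply: (le_trans _ (le_trans sP _)); last first.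
      rewrite lee_fin W4; apply: ler_wpM2r; last exact: growth.
      by rewrite mulr_ge0.
    rewrite /potential (bigD1 (j, b))//=.
    rewrite (_ : (\int[P]_x _ = \int[P]_x (expR (lm * \sum_(i <- s) u i (j, b) x))%:E)%E).
      rewrite leeDl// sume_ge0// => k _; rewrite mule_ge0 ?lee_fin ?(ltW (w0 _))//.
      by apply: integral_ge0 => x _; rewrite lee_fin expR_ge0.
    apply: eq_integral => x _; congr ((expR _)%:E).
    by rewrite /u -mulr_sumr /S dirpart_sum/= mulrA.
  by rewrite -lee_pdivlMl// -EFinM => /le_trans; apply; rewrite lee_fin [leLHS]mulrC.
have c0 : 0 <= lm / B j by rewrite divr_ge0// ltW.
have cB : 0 < lm / B j by rewrite divr_gt0.
have key : (\int[P]_x ((lm / B j * cabs (S x)) `^ q)%:E <=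
    ((2 * q) `^ q * (4 * (expR 1 * (4 * (\sum_j w j)) / w j)))%:E)%E.
  apply: (@le_trans _ _ (\int[P]_x (((2 * q) `^ q)%:E *
      \sum_(b : bool * bool) (expR (lm / B j * dirpart b (S x)))%:E))%E).
    apply: le_integral_ge0 => x _; first by rewrite lee_fin powR_ge0.
    by rewrite sumEFin -EFinM lee_fin cabs_powR_le.
  have me b : measurable_fun setT (fun x : T => (expR (lm / B j * dirpart b (S x)))%:E).
    by apply: measurable_expR_scaled; exact: mdir.
  rewrite ge0_integralZl ?lee_fin ?powR_ge0//; last 2 first.
  - by apply: emeasurable_sum.
  - by move=> x _; apply: sume_ge0 => b _; rewrite lee_fin expR_ge0.
  rewrite ge0_integral_sum// EFinM lee_wpmul2l ?lee_fin ?powR_ge0//.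
  apply: (le_trans (lee_sum _ (fun b _ => each b))).
  by rewrite sumEFin sumr_const card_prod card_bool lee_fin -[leLHS]mulr_natl.
have E x : ((cabs (S x) `^ q)%:E = ((lm / B j)^-1 `^ q)%:E * ((lm / B j * cabs (S x)) `^ q)%:E)%E.
  rewrite -EFinM -powRM; last 2 first.
  - by rewrite invr_ge0.
  - by rewrite mulr_ge0// cabs_ge0.
  by rewrite mulrA mulVf ?mul1r// gt_eqF.
under eq_integral do rewrite E.
rewrite ge0_integralZl; last 4 first.
- exact: measurableT.
- apply/measurable_EFinP; apply: (measurableT_comp (measurable_powR q)).
  by apply: measurable_funM => //; exact: measurable_cabs.
- by move=> x _; rewrite lee_fin powR_ge0.
- by rewrite lee_fin powR_ge0.
apply: (le_trans (lee_wpmul2l _ key)); first by rewrite lee_fin powR_ge0.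
rewrite -EFinM lee_fin le_eqVlt; apply/orP; left; apply/eqP.
rewrite invf_div /lm invrK /maurey_const -/rM.
have -> : B j * (2 * rM) = 2 * (B j * rM) by ring.
have Br : 0 <= B j * rM by rewrite mulr_ge0// ltW.
have -> : 4 * q = 2 * (2 * q) by ring.
rewrite !powRM ?mulr_ge0 ?(ltW q0) ?(ltW rM0) ?(ltW (B0 j))//.
by field; rewrite gt_eqF.
Qed.

End MaureyBound.

Section GeometricSums.
Variable R : realType.
Implicit Types b : R.

Lemma sum_geometric_le b m n : 0 <= b < 1 -> \sum_(m <= t < n) b ^+ t <= b ^+ m / (1 - b).
Proof.
move=> /andP[b0 b1]; have b1' : 0 < 1 - b by rewrite subr_gt0.
rewrite ler_pdivlMr//; case: (leqP m n) => mn; last first.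
  by rewrite big_geq ?mul0r ?exprn_ge0// ltnW.
suff -> : (\sum_(m <= t < n) b ^+ t) * (1 - b) = b ^+ m - b ^+ n.
  by rewrite gerBl exprn_ge0.
elim: n mn => [|n IH]; first by rewrite leqn0 => /eqP ->; rewrite big_geq// mul0r subrr.
rewrite leq_eqVlt => /orP[/eqP <-|]; first by rewrite big_geq// mul0r subrr.
rewrite ltnS => mn; rewrite big_nat_recr//= mulrDl IH// exprS; ring.
Qed.

Lemma sum_shifted_geometric_le b s n : 0 <= b < 1 ->
  \sum_(0 <= t < n) (if (s <= t.+1)%N then b ^+ (t.+1 - s) else 0) <= (1 - b)^-1.
Proof.
move=> /andP[b0 b1]; have b1' : 0 < 1 - b by rewrite subr_gt0.
(* Strengthened to a telescoping bound for the induction. By truncated subtraction its right side is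
   0 while the sum is still empty. *)
suff : (\sum_(0 <= t < n) (if (s <= t.+1)%N then b ^+ (t.+1 - s) else 0)) * (1 - b) <=
    1 - b ^+ (n.+1 - s).
  by rewrite -(div1r (1 - b)) ler_pdivlMr// => /le_trans; apply; rewrite gerBl exprn_ge0.
elim: n => [|n IH].
  by rewrite big_geq// mul0r subr_ge0 exprn_ile1// ltW.
rewrite big_nat_recr//= mulrDl; apply: (le_trans (lerD IH (lexx _))).
case: ifP => sn.
  have -> : (n.+2 - s = (n.+1 - s).+1)%N by lia.
  by rewrite exprS le_eqVlt; apply/orP; left; apply/eqP; ring.
have -> : (n.+2 - s = 0)%N by lia.
have -> : (n.+1 - s = 0)%N by lia.
by rewrite mul0r addr0.
Qed.

End GeometricSums.

(** * Summable coefficients and integrability of the functions of the ball *)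

Section BesovBounded.
Variable R : realType.
Variables (d : nat) (p r : R) (theta : \bar R) (K : nat).
Hypotheses (p2 : 2 < p) (r0 : 0 < r) (theta1 : (1 <= theta)%E).
Hypothesis rd : d%:R / 2 < r.
Local Notation C := (complex.complex R).
Local Notation T := (Torus R d).
Local Notation P := (torus_prob R d).
Local Notation rho := (besov_ratio d r).
Local Notation A := (besov_const1 d r K).
Variable f : 'rV[R]_d -> C.
Hypothesis fB : besov_ball d r p theta K f.

(** Here [r > d/2] makes the coefficients absolutely summable over the levels. *)
Lemma besov_ratio_lt1 : rho < 1.
Proof.
rewrite /besov_ratio -powRD; last by rewrite pnatr_eq0/= implybT.
have -> : - r + d%:R / 2 = - (r - d%:R / 2) by ring.
rewrite powRN invf_lt1 ?powR_gt0// -[ltLHS](powRr0 2) /powR pnatr_eq0/= ltr_expR mul0r.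
by rewrite mulr_gt0 ?ln_gt0 ?ltr1n ?subr_gt0.
Qed.

Lemma besov_cintegrable : cintegrable f.
Proof. by case: fB => fp _; apply: inLp_cintegrable fp; exact: ltW. Qed.

Lemma besov_periodic : Defs.periodic f.
Proof. by case: fB => -[_ []]. Qed.

Lemma sum_fcoef_le (s : seq 'rV[int]_d) : uniq s ->
  \sum_(k <- s) cabs (fcoef f k) <= A / (1 - rho).
Proof.
move=> us; pose S := (\max_(k <- s) level k).+1.
have lS k : k \in s -> (0 <= level k < S)%N.
  by move=> ks; rewrite /= ltnS /S (big_rem k)//= leq_maxl.
have := sum_by_level p2 r0 theta1 fB us (fun=> ler01) lS.
under eq_bigr do rewrite mul1r.
move=> /le_trans; apply; under eq_bigr do rewrite mul1r.
rewrite -mulr_sumr ler_wpM2l ?(ltW (besov_const1_gt0 _ _ _))//.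
rewrite (le_trans (sum_geometric_le _ _ _)) ?besov_ratio_lt1 ?(ltW (besov_ratio_gt0 _ _))//.
by rewrite expr0 div1r.
Qed.

(* [u <= (eta + u^2 / eta) / 2] turns the quadratic mean bound into a mean bound. *)
Lemma fdiffk_mean_le (h : 'rV[R]_d) (t : R) : 0 < t -> enorm h <= t ->
  (\int[P]_x (cabs (fdiffk K h f x))%:E <= (3 * 2 `^ r * t `^ r)%:E)%E.
Proof.
move=> t0 ht; pose eta : R := 2 * (2 * t) `^ r.
have eta0 : 0 < eta by rewrite mulr_gt0// powR_gt0// mulr_gt0.
have sq := sqnorm_fdiffk_le p2 r0 theta1 fB t0 ht.
have [ci _ _] := fdiffk_props h K besov_cintegrable besov_periodic.
have cm := cintegrable_cmeasurable ci.
apply: (@le_trans _ _ (\int[P]_x ((eta / 2)%:E + ((2 * eta)^-1)%:E * (sqnorm (fdiffk K h f x))%:E))%E).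
  apply: le_integral_ge0 => x _; first by rewrite lee_fin cabs_ge0.
  rewrite -EFinM -EFinD lee_fin -sqr_cabs; set u := cabs _.
  have eta2 : 0 < 2 * eta by rewrite mulr_gt0.
  rewrite -(ler_pM2l eta2).
  have -> : 2 * eta * (eta / 2 + (2 * eta)^-1 * u ^+ 2) = eta ^+ 2 + u ^+ 2.
    by field; exact: lt0r_neq0.
  by have := sqr_ge0 (eta - u); rewrite sqrrB; lra.
have ms : measurable_fun setT (fun x : T => (sqnorm (fdiffk K h f x))%:E).
  by apply/measurable_EFinP; exact: measurable_sqnorm.
rewrite ge0_integralD//; last 3 first.
- by move=> x _; rewrite lee_fin divr_ge0// ltW.
- by move=> x _; rewrite mule_ge0// lee_fin ?sqnorm_ge0// invr_ge0 mulr_ge0// ltW.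
- exact: measurable_funeM.
rewrite integral_cst// [X in (_ * X + _)%E](_ : _ = 1%E); last exact: probability_setT.
rewrite mule1 ge0_integralZl//; last 2 first.
- by move=> x _; rewrite lee_fin sqnorm_ge0.
- by rewrite lee_fin invr_ge0 mulr_ge0// ltW.
apply: (@le_trans _ _ ((eta / 2)%:E + ((2 * eta)^-1)%:E * (2 * eta ^+ 2)%:E)%E).
  by rewrite leeD2l// lee_wpmul2l// lee_fin invr_ge0 mulr_ge0// ltW.
rewrite -EFinM -EFinD lee_fin le_eqVlt; apply/orP; left; apply/eqP.
have -> : eta / 2 + (2 * eta)^-1 * (2 * eta ^+ 2) = 3 / 2 * eta.
  by field; exact: lt0r_neq0.
by rewrite /eta powRM// ?(ltW t0)//; field.
Qed.

(** [Bq1norm] is infinite outside [L_q], and for [q > p] membership does not follow from the norm of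
    [f] in [L_p]; it comes from the essential bound. *)
Lemma besov_inLp (q : R) : 0 < q -> inLp q f.
Proof.
move=> q0; split; first exact: cintegrable_cmeasurable besov_cintegrable.
split; first exact: besov_periodic.
apply: (@ess_bounded_Lpnorm R d K f besov_cintegrable besov_periodic _ sum_fcoef_le
  (3 * 2 `^ r) r _ r0 _ q q0).
- by rewrite mulr_ge0// powR_ge0.
- exact: fdiffk_mean_le.
Qed.

End BesovBounded.

(** * Padding of short polynomials, a triangle inequality and the count of low frequencies *)

Section MtermPolynomials.
Variable R : realType.
Variable d : nat.
Local Notation C := (complex.complex R).
Hypothesis d0 : (0 < d)%N.

(** [mterm_polys] asks for exactly [m] distinct frequencies, so a shorter list has to be padded. The
    box of radius [m] has at least [m] points because [d > 0]. *)
Lemma extend_uniq (s : seq 'rV[int]_d) m : uniq s -> (size s <= m)%N ->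
  exists s', [/\ uniq (s ++ s') & size (s ++ s') = m].
Proof.
move=> us sm; pose r := [seq k <- box d m | k \notin s].
have ur : uniq r by rewrite filter_uniq// uniq_box.
have sr : (m - size s <= size r)%N.
  have h : (size (box d m) <= size (s ++ r))%N.
    apply: uniq_leq_size; first exact: uniq_box.
    by move=> k kb; rewrite mem_cat mem_filter kb andbT orbN.
  rewrite size_box size_cat in h.
  have : (m <= (2 * m).+1 ^ d)%N.
    by apply: (@leq_trans ((2 * m).+1 ^ 1)); [rewrite expn1; lia|rewrite leq_pexp2l].
  by move=> h'; rewrite leq_subLR (leq_trans h' h).
exists (take (m - size s) r); split.
  rewrite cat_uniq us take_uniq// andbT/=; apply/hasPn => k /mem_take.
  by rewrite mem_filter => /andP[].
by rewrite size_cat size_takel// subnKC.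
Qed.

Lemma mterm_trigpoly (s : seq 'rV[int]_d) (c : 'rV[int]_d -> C) m : uniq s -> (size s <= m)%N ->
  mterm_polys d m (trigpoly s c).
Proof.
move=> us sm; have [s' [us' ss']] := extend_uniq us sm.
pose c' k : C := if k \in s then c k else 0.
exists (fun i : 'I_m => nth 0 (s ++ s') i), (fun i : 'I_m => c' (nth 0 (s ++ s') i)); split.
  move=> i j /eqP; rewrite nth_uniq ?ss'//; last by move=> /eqP; exact: val_inj.
apply/funext => x; rewrite -(big_mkord xpredT (fun i => c' (nth 0 (s ++ s') i) * expk (nth 0 (s ++ s') i) x)).
rewrite -ss' -(big_nth 0 xpredT (fun k => c' k * expk k x)) big_cat/=.
rewrite [X in _ + X]big_seq [X in _ + X]big1 ?addr0; last first.
  move=> k ks'; rewrite /c' ifF ?mul0r//; apply/negP => ks.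
  by move: us'; rewrite cat_uniq => /and3P[_ /hasPn/(_ _ ks')]; rewrite /= ks.
by rewrite /trigpoly; apply: eq_big_seq => k ks; rewrite /c' ks.
Qed.

End MtermPolynomials.

Section NormOfSum.
Variable R : realType.
Variable d : nat.
Local Notation C := (complex.complex R).
Local Notation T := (Torus R d).
Local Notation P := (torus_prob R d).

(** A crude triangle inequality through [|g + h| <= 2 max(|g|, b)]. The second factor 2 of the
    constant comes from [2 <= 2^q]. *)
Lemma Lpnorm_perturb (q a b : R) (g h : 'rV[R]_d -> C) : 1 <= q -> 0 <= a -> 0 <= b ->
  cmeasurable g -> cmeasurable h ->
  (\int[P]_x (cabs (g x) `^ q)%:E <= (a `^ q)%:E)%E -> (forall x, cabs (h x) <= b) ->
  (Lpnorm q (fun x => g x + h x)%R <= (4 * (a + b))%:E)%E.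
Proof.
move=> q1 a0 b0 mg mh ga hb; have q0 : 0 < q by lra.
have ab0 : 0 <= a + b by rewrite addr_ge0.
apply/Lpnorm_leP => //; [by rewrite mulr_ge0|exact: cmeasurableD|].
apply: (@le_trans _ _ (\int[P]_x ((2 `^ q)%:E * ((cabs (g x) `^ q)%:E + (b `^ q)%:E)))%E).
  apply: le_integral_ge0 => x _; first by rewrite lee_fin powR_ge0.
  rewrite -EFinD -EFinM lee_fin.
  pose m := Num.max (cabs (g x)) b.
  have m0 : 0 <= m by rewrite le_max cabs_ge0.
  apply: (@le_trans _ _ ((2 * m) `^ q)).
    rewrite ge0_ler_powR ?nnegrE ?cabs_ge0 ?mulr_ge0//; first exact: ltW.
    rewrite (le_trans (ler_cabsD _ _))// mulr_natl mulr2n lerD//.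
      by rewrite le_max lexx.
    by rewrite le_max hb orbT.
  rewrite powRM// ler_wpM2l ?powR_ge0// /m; case: (leP (cabs (g x)) b) => _.
    by rewrite lerDr powR_ge0.
  by rewrite lerDl powR_ge0.
have mg' := measurable_cabs_powR q mg.
rewrite ge0_integralZl ?lee_fin ?powR_ge0//; last 2 first.
- by apply: emeasurable_funD.
- by move=> x _; rewrite -EFinD lee_fin addr_ge0 ?powR_ge0.
rewrite ge0_integralD//; last 2 first.
- by move=> x _; rewrite lee_fin powR_ge0.
- by move=> x _; rewrite lee_fin powR_ge0.
rewrite integral_cst// [X in (_ + _ * X)%E](_ : _ = 1%E); last exact: probability_setT.
rewrite mule1.
apply: (@le_trans _ _ ((2 `^ q)%:E * ((a `^ q)%:E + (b `^ q)%:E))%E).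
  by rewrite lee_wpmul2l ?lee_fin ?powR_ge0// leeD2r.
rewrite -EFinD -EFinM lee_fin (_ : 4 * (a + b) = 2 * (2 * (a + b))); last by ring.
rewrite [leRHS]powRM ?mulr_ge0// ler_wpM2l ?powR_ge0// powRM//.
apply: (@le_trans _ _ (2 * (a + b) `^ q)).
  by rewrite mulr_natl mulr2n lerD// ge0_ler_powR ?nnegrE// ?(ltW q0)// ?lerDl ?lerDr.
by rewrite ler_wpM2r ?powR_ge0// le1r_powR// ler1n.
Qed.

End NormOfSum.

Section LowFrequencies.
Variables d s0 : nat.
Implicit Type k : 'rV[int]_d.

Definition low_freqs : seq 'rV[int]_d := [seq k <- box d (2 ^ s0) | (level k < s0)%N].
Local Notation low := low_freqs.

Lemma mem_low_freqs k : (k \in low) = (level k < s0)%N.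
Proof.
rewrite mem_filter mem_box andb_idr// => /ltnW.
by rewrite level_leP => /ltnW.
Qed.

(** For [s0 >= 1] the condition means [nrm k < 2^(s0-1)], a box of [(2^s0 - 1)^d] points. For
    [s0 = 0] the list is empty, and the case [m = 1] depends on the bound being 0 there rather than
    1. *)
Lemma size_low : (size low <= if s0 == 0 then 0 else 2 ^ (d * s0))%N.
Proof.
case: (eqVneq s0 0%N) => [s00|s0n].
  by rewrite leqn0 size_filter -leqn0 leqNgt -has_count; apply/hasPn => k _; rewrite s00 ltn0.
apply: (@leq_trans (size (box d (2 ^ s0.-1).-1))).
  apply: uniq_leq_size; first by rewrite filter_uniq// uniq_box.
  move=> k; rewrite mem_low_freqs mem_box => kl.
  have : (level k <= s0.-1)%N by lia.
  by rewrite level_leP; lia.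
rewrite size_box [X in (_ <= 2 ^ X)%N]mulnC expnM; case: (posnP d) => [->|d0]; first by rewrite !expn0.
rewrite leq_exp2r//.
have -> : s0 = s0.-1.+1 by lia.
have : (0 < 2 ^ s0.-1)%N by rewrite expn_gt0.
by rewrite expnS/=; lia.
Qed.

End LowFrequencies.

(** * Sampling of the middle frequencies of one function of the ball *)

Section Sampling.
Variable R : realType.
Variables (d : nat) (p r : R) (theta : \bar R) (K : nat).
Hypotheses (p2 : 2 < p) (r0 : 0 < r) (theta1 : (1 <= theta)%E).
Hypotheses (rd : d%:R / 2 < r).
Local Notation C := (complex.complex R).
Local Notation T := (Torus R d).
Local Notation P := (torus_prob R d).
Local Notation rho := (besov_ratio d r).
Local Notation A := (besov_const1 d r K).
Variable f : 'rV[R]_d -> C.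
Hypothesis fB : besov_ball d r p theta K f.
Variables (s0 L : nat).
Implicit Types (k : 'rV[int]_d) (t i : nat).

(* [besov_root ^ 4] is the decay rate of the level sums of the coefficients: one square root
   is spent on the sampling weights, another one on the weights of the potential. *)
Definition besov_root : R := rho `^ 4^-1.
Local Notation b := besov_root.

Lemma besov_root_gt0 : 0 < b. Proof. by rewrite powR_gt0// besov_ratio_gt0. Qed.

Lemma besov_rootX4 : b ^+ 4 = rho.
Proof.
rewrite -powR_mulrn ?powR_ge0// -powRrM mulVf ?pnatr_eq0// powRr1//.
exact: ltW (besov_ratio_gt0 _ _).
Qed.

Lemma besov_root_lt1 : b < 1.
Proof.
rewrite -(@ltr_pXn2r _ 4)// ?nnegrE ?(ltW besov_root_gt0)//.
by rewrite besov_rootX4 expr1n besov_ratio_lt1.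
Qed.

Lemma besov_rootX_le m n : (m <= n)%N -> b ^+ n <= b ^+ m.
Proof. by move=> mn; rewrite ler_wiXn2l// ?(ltW besov_root_gt0)// ltW// besov_root_lt1. Qed.

Lemma besov_root_ge0 : 0 <= b. Proof. exact: ltW besov_root_gt0. Qed.
Lemma besov_root_neq0 : b != 0. Proof. exact: lt0r_neq0 besov_root_gt0. Qed.

#[local] Hint Resolve besov_root_gt0 besov_root_ge0 besov_root_neq0 besov_root_lt1 : core.

Local Ltac pos := repeat first [ by [] | exact: cabs_ge0 | apply: exprn_ge0 | apply: exprn_gt0 | apply: mulr_ge0
  | apply: mulr_gt0 | rewrite invr_ge0 | rewrite invr_gt0 ].

Let besov_const1_pos : 0 < A. Proof. exact: besov_const1_gt0. Qed.
Let besov_const1_ge0 : 0 <= A. Proof. exact: ltW (besov_const1_gt0 d r K). Qed.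
#[local] Hint Resolve besov_const1_pos besov_const1_ge0 : core.
Let besov_ratio_pos : 0 < rho. Proof. exact: besov_ratio_gt0. Qed.
Let besov_ratio_ge0 : 0 <= rho. Proof. exact: ltW (besov_ratio_gt0 d r). Qed.
#[local] Hint Resolve besov_ratio_pos besov_ratio_ge0 : core.

(** Only finitely many levels can be sampled; what lies above this one is left in the error. The
    number of terms used does not depend on [L], so [L] can be taken as large as the tail
    requires. *)
Definition top_level := (s0 + L)%N.
Local Notation S := top_level.
Definition mid_freqs : seq 'rV[int]_d := [seq k <- box d (2 ^ S) | (s0 <= level k <= S)%N].
Local Notation mid := mid_freqs.
Definition num_mid := size mid.
Local Notation n := num_mid.
Definition mid_freq i : 'rV[int]_d := nth 0 mid i.
Local Notation kk := mid_freq.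
Local Notation c := (fcoef f).
(** For a vanishing coefficient the convention [0^-1 = 0] makes the phase 0. *)
Definition coef_phase k : C := rC (cabs (c k))^-1 * c k.
Local Notation phase := coef_phase.
(** A bound for the sum of [|c_k| / b^(2 level k)]: level [t] contributes at most
    [A rho^t / b^(2t) = A b^(2t)], and the geometric series starts at [s0]. *)
Definition sampling_mass : R := A * b ^+ (2 * s0) / (1 - b ^+ 2).
Local Notation Z := sampling_mass.
(** High levels are favoured by the factor [b^(-2 level)], so that the sampled coefficient
    [c_k / p_k] has modulus at most [Z b^(2 level)] and decays with the level. *)
Definition sampling_prob k : R := cabs (c k) / b ^+ (2 * level k) / Z.
Local Notation pm := sampling_prob.
Definition sample_coef k : C := rC (Z * b ^+ (2 * level k)) * phase k.
Local Notation xm := sample_coef.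

Lemma besov_root_sqr_lt1 : 0 < 1 - b ^+ 2.
Proof. by rewrite subr_gt0 exprn_ilt1. Qed.

Lemma besov_root_sqr_le1 : 0 <= 1 - b ^+ 2. Proof. exact: ltW besov_root_sqr_lt1. Qed.
#[local] Hint Resolve besov_root_sqr_lt1 besov_root_sqr_le1 : core.

Lemma sampling_mass_gt0 : 0 < Z.
Proof. by rewrite /sampling_mass; pos. Qed.

Lemma sampling_mass_ge0 : 0 <= Z. Proof. exact: ltW sampling_mass_gt0. Qed.
#[local] Hint Resolve sampling_mass_gt0 sampling_mass_ge0 : core.

Lemma mid_level k : k \in mid -> (s0 <= level k <= S)%N.
Proof. by rewrite mem_filter => /andP[]. Qed.

Lemma mem_mid_freqs k : (k \in mid) = (s0 <= level k <= S)%N.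
Proof.
rewrite mem_filter mem_box andb_idr// => /andP[_].
by rewrite level_leP => /ltnW.
Qed.

Lemma uniq_mid_freqs : uniq mid. Proof. by rewrite filter_uniq// uniq_box. Qed.

Lemma sum_sampling_prob : \sum_(k <- mid) pm k <= 1.
Proof.
rewrite /sampling_prob -mulr_suml ler_pdivrMr// mul1r.
pose v t : R := (b ^+ (2 * t))^-1.
have v0 t : 0 <= v t by rewrite invr_ge0 exprn_ge0.
rewrite (eq_bigr (fun k => v (level k) * cabs (c k))); last by move=> k _; rewrite mulrC.
have mP k : k \in mid -> (s0 <= level k < S.+1)%N by rewrite mem_mid_freqs.
apply: (le_trans (sum_by_level p2 r0 theta1 fB uniq_mid_freqs v0 mP)).
rewrite (eq_bigr (fun t => A * (b ^+ 2) ^+ t)); last first.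
  move=> t _; rewrite /v mulrCA; congr (_ * _); rewrite -besov_rootX4 -!exprM.
  have -> : (4 * t = 2 * t + 2 * t)%N by lia.
  by rewrite exprD mulKf// expf_neq0.
rewrite -mulr_sumr /sampling_mass -mulrA ler_wpM2l ?(ltW (besov_const1_gt0 d r K))// exprM.
by apply: sum_geometric_le; rewrite exprn_ge0//= -subr_gt0.
Qed.

Lemma sampling_prob_ge0 k : 0 <= pm k.
Proof. by rewrite /sampling_prob; pos. Qed.

Lemma cabs_coef_phase k : cabs (phase k) <= 1.
Proof.
rewrite cabsM cabs_rC ger0_norm ?invr_ge0 ?cabs_ge0//.
case: (eqVneq (cabs (c k)) 0) => [->|ck]; first by rewrite mulr0.
by rewrite mulVf.
Qed.

Lemma rC_coef_phase k : rC (cabs (c k)) * phase k = c k.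
Proof.
rewrite /coef_phase mulrA -rCM; case: (eqVneq (cabs (c k)) 0) => [ck|ck].
  by rewrite (cabs_eq0 ck) mulr0.
by rewrite divff// rC1 mul1r.
Qed.

Lemma sampling_prob_coef k : rC (pm k) * xm k = c k.
Proof.
rewrite /sample_coef mulrA -rCM -[RHS]rC_coef_phase; congr (rC _ * _).
rewrite /sampling_prob; move: (lt0r_neq0 sampling_mass_gt0) (expf_neq0 (2 * level k) besov_root_neq0).
by move: Z (b ^+ _) (cabs _) => z y u z0 y0; field; rewrite z0 y0.
Qed.

(** The weights [sampling_prob] may add up to less than 1. The extra index [n], which stands for the
    zero term, takes the remaining mass. *)
Definition index_prob i : R := if (i < n)%N then pm (kk i) else 1 - \sum_(k <- mid) pm k.
Local Notation pn := index_prob.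
Definition index_coef i : C := if (i < n)%N then xm (kk i) else 0.
Local Notation xn := index_coef.
Definition sample_term t i (x : 'rV[R]_d) : C := rC (lam R t (kk i)) * xn i * expk (kk i) x.
Local Notation term := sample_term.
Definition mid_mean t (x : 'rV[R]_d) : C := \sum_(k <- mid) rC (lam R t k) * c k * expk k x.
Local Notation mean := mid_mean.
Definition deviation t i x : C := term t i x - mean t x.
Local Notation dev := deviation.

Lemma sum_mid_freqs (V : nmodType) (F : 'rV[int]_d -> V) : \sum_(k <- mid) F k = \sum_(i < n) F (kk i).
Proof. by rewrite (big_nth 0) big_mkord. Qed.

Lemma index_prob_ge0 (i : 'I_n.+1) : 0 <= pn i.
Proof. by rewrite /index_prob; case: ifP => _; rewrite ?subr_ge0 ?sum_sampling_prob ?sampling_prob_ge0. Qed.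

Lemma sum_index_prob : \sum_(i < n.+1) pn i = 1.
Proof.
rewrite big_ord_recr/= {2}/index_prob ltnn sum_mid_freqs (eq_bigr (fun i : 'I_n => pm (kk i))) ?subrKC//.
by move=> i _; rewrite /index_prob ltn_ord.
Qed.

Lemma mean_sample_term t x : \sum_(i < n.+1) rC (pn i) * term t i x = mean t x.
Proof.
rewrite big_ord_recr/= [X in _ + rC _ * X](_ : _ = 0) ?mulr0 ?addr0; last first.
  by rewrite /sample_term /index_coef ltnn mulr0 mul0r.
rewrite /mid_mean sum_mid_freqs.
apply: eq_bigr => i _; rewrite /sample_term /index_prob /index_coef ltn_ord.
by rewrite -[in RHS]sampling_prob_coef; ring.
Qed.

Lemma sum_deviation t x : \sum_(i < n.+1) rC (pn i) * dev t i x = 0.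
Proof.
under eq_bigr do rewrite mulrBr.
by rewrite sumrB mean_sample_term -mulr_suml -rC_sum sum_index_prob rC1 mul1r subrr.
Qed.

Definition deviation_const : R := A / ((1 - b ^+ 2) * b ^+ 2).
Local Notation H := deviation_const.

Lemma deviation_const_gt0 : 0 < H.
Proof. by rewrite /deviation_const; pos. Qed.

Lemma deviation_const_ge0 : 0 <= H. Proof. exact: ltW deviation_const_gt0. Qed.
#[local] Hint Resolve deviation_const_gt0 deviation_const_ge0 : core.

(** A term is at most [Z b^(2 level)], and the level is at least [s0] and, when the block sees the
    term, at least [t]. One factor [b^(2 s0)] from [Z] and one from the level combine into
    [rho^s0]. *)
Lemma cabs_sample_term t i x : cabs (term t i x) <= H * rho ^+ s0 * b ^+ (2 * (t.+1 - s0)).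
Proof.
have R0 : 0 <= H * rho ^+ s0 * b ^+ (2 * (t.+1 - s0)).
  by pos.
rewrite /sample_term !cabsM cabs_expk mulr1 cabs_rC /index_coef.
case: ifP => [iN|_]; last by rewrite cabs0 mulr0.
case: (eqVneq (lam R t (kk i)) 0) => [->|l0]; first by rewrite normr0 mul0r.
apply: (@le_trans _ _ (1 * (Z * b ^+ (2 * level (kk i))))).
  rewrite ler_pM ?normr_ge0 ?cabs_ge0 ?norm_lam_le1// /sample_coef cabsM cabs_rC.
  have Zb : 0 <= Z * b ^+ (2 * level (kk i)) by pos.
  by rewrite (ger0_norm Zb) ler_piMr// cabs_coef_phase.
rewrite mul1r; have /andP[lv1 _] : (s0 <= level (kk i) <= S)%N by apply: mid_level; exact: mem_nth.
have lv2 := lam_level l0.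
(* The block reaches down to level [t] while the decay is counted from [t.+1]. The extra 2 in the
   exponent pays for this and reappears as the last [b ^+ 2] of [deviation_const]. *)
have lv : (2 * s0 + 2 * (t.+1 - s0) <= 2 * level (kk i) + 2)%N by move: lv1 lv2; clear; lia.
have := besov_rootX_le lv; rewrite (exprD b (2 * level _)) (exprD b (2 * s0)) => hb.
rewrite /sampling_mass /deviation_const -besov_rootX4 -exprM.
have -> : (4 * s0 = 2 * s0 + 2 * s0)%N by rewrite -mulnDl.
rewrite exprD -(ler_pM2r (_ : 0 < b ^+ 2)) ?exprn_gt0 ?besov_root_gt0//.
set X := b ^+ (2 * s0); set Y := b ^+ (2 * (_ - _)); set W := b ^+ (2 * level _) in hb *.
have -> : A * X / (1 - b ^+ 2) * W * b ^+ 2 = A * X / (1 - b ^+ 2) * (W * b ^+ 2) by ring.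
have -> : A / ((1 - b ^+ 2) * b ^+ 2) * (X * X) * Y * b ^+ 2 = A * X / (1 - b ^+ 2) * (X * Y).
  by field; rewrite besov_root_neq0 lt0r_neq0.
by rewrite ler_wpM2l//; pos.
Qed.

Lemma cabs_deviation t i x : cabs (dev t i x) <= 2 * H * rho ^+ s0 * b ^+ (2 * (t.+1 - s0)).
Proof.
have -> : 2 * H * rho ^+ s0 * b ^+ (2 * (t.+1 - s0)) =
    H * rho ^+ s0 * b ^+ (2 * (t.+1 - s0)) + H * rho ^+ s0 * b ^+ (2 * (t.+1 - s0)) by ring.
rewrite (le_trans (ler_cabsB _ _))// lerD ?cabs_sample_term//.
rewrite -mean_sample_term (le_trans (ler_cabs_sum _ _ _))//.
(* The mean is a convex combination of the terms and obeys their bound, hence the factor 2. *)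
set X := leRHS; have -> : X = \sum_(i < n.+1) pn i * X by rewrite -mulr_suml sum_index_prob mul1r.
apply: ler_sum => j _; rewrite cabsM cabs_rC ger0_norm ?index_prob_ge0//.
by rewrite ler_wpM2l ?cabs_sample_term ?index_prob_ge0.
Qed.

(* The levels met by [mid] are out of reach of [sigma_op t]. *)
Lemma sample_term_eq0 t i x : (t.+1 < s0)%N || (S < t)%N -> term t i x = 0.
Proof.
move=> ht; rewrite /sample_term /index_coef; case: ifP => [iN|_]; last by rewrite mulr0 mul0r.
have lv : (s0 <= level (kk i) <= S)%N by apply: mid_level; exact: mem_nth.
case: (eqVneq (lam R t (kk i)) 0) => [->|/lam_level h]; first by rewrite rC0 !mul0r.
by exfalso; move: ht lv h; clear; lia.
Qed.

Lemma deviation_eq0 t i x : (t.+1 < s0)%N || (S < t)%N -> dev t i x = 0.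
Proof.
move=> ht; rewrite /deviation sample_term_eq0// -mean_sample_term big1 ?subrr// => j _.
by rewrite sample_term_eq0// mulr0.
Qed.

Lemma cmeasurable_deviation t i : cmeasurable (dev t i).
Proof.
apply: cmeasurableB.
  by apply: cmeasurableM; [exact: cmeasurable_cst|exact: cmeasurable_expk].
apply: cmeasurable_sum => k.
by apply: cmeasurableM; [exact: cmeasurable_cst|exact: cmeasurable_expk].
Qed.

Variables (q : R) (M : nat).
Hypotheses (q1 : 1 <= q) (M0 : (0 < M)%N).

(** The total of the block weights [(b^j)^q]. The selection charges block [j] the inverse of its
    weight, that is [1 / b^j] after a [q]-th root, so one factor [b^j] is left of the decay [b^(2j)]
    of the deviations. *)
Definition potential_mass : R := \sum_(j < L.+2) (b ^+ j) `^ q.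
Local Notation W := potential_mass.

Lemma potential_mass_le : W <= (1 - b)^-1.
Proof.
apply: (@le_trans _ _ (\sum_(j < L.+2) b ^+ j)).
  apply: ler_sum => j _; case: (posnP j) => [->|j0]; first by rewrite expr0 powR1.
  rewrite ge1r_powR// exprn_gt0 ?besov_root_gt0//=.
  by rewrite exprn_ile1// ltW// besov_root_lt1.
rewrite -(big_mkord xpredT (fun j => b ^+ j)) (le_trans (sum_geometric_le _ _ _))//.
  by rewrite besov_root_ge0 besov_root_lt1.
by rewrite expr0 div1r.
Qed.

Definition sampling_const : R := maurey_const q / (1 - b) * (2 * H).

Lemma maurey_const_ge1 : 1 <= maurey_const q.
Proof.
rewrite /maurey_const -[leLHS]mulr1 ler_pM//.
  rewrite -[leLHS](powRr0 (4 * q)) ler_powR ?(le_trans ler01 q1)//.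
  by rewrite -[leLHS]mulr1 ler_pM// ler1n.
by have := expR_ge1Dx (1 : R); lra.
Qed.

Lemma sampling : exists s : seq 'I_n.+1, size s = M /\ forall t,
  (\int[P]_x (cabs (\sum_(i <- s) dev t i x) `^ q)%:E <=
   ((if (s0 <= t.+1)%N then sampling_const * rho ^+ s0 * b ^+ (t.+1 - s0) * Num.sqrt M%:R else 0)
      `^ q)%:E)%E.
Proof.
have q0 : 0 < q := lt_le_trans ltr01 q1.
have rho0 : 0 < rho := besov_ratio_gt0 d r.
(* Sampled levels are visible to the blocks from [s0 - 1] to [S], which are counted by
   [j = t + 1 - s0]. For [s0 = 0] block 0 merely occurs twice. *)
pose tj (j : 'I_L.+2) := (s0 + j).-1.
pose B (j : 'I_L.+2) : R := 2 * H * rho ^+ s0 * b ^+ (2 * j).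
have B0 j : 0 < B j by rewrite /B; pos.
have w0 (j : 'I_L.+2) : 0 < (b ^+ j) `^ q by rewrite powR_gt0// exprn_gt0// besov_root_gt0.
have devB (i : 'I_n.+1) j x : cabs (dev (tj j) i x) <= B j.
  rewrite (le_trans (cabs_deviation _ _ _))// /B ler_wpM2l//.
    by pos.
  by apply: besov_rootX_le; rewrite /tj; clear; lia.
have [s [sM sP]] := @maurey R d _ _ (fun i : 'I_n.+1 => pn i) _ B
  (fun (i : 'I_n.+1) (j : 'I_L.+2) => dev (tj j) i)
  index_prob_ge0 sum_index_prob w0 B0 
  (fun (i : 'I_n.+1) (j : 'I_L.+2) => cmeasurable_deviation (tj j) i) devB
  (fun j : 'I_L.+2 => sum_deviation (tj j)) q q0 M M0.
exists s; split => // t.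
have [ht|ht] := boolP ((s0 <= t.+1)%N && (t <= S)%N); last first.
  under eq_integral => x _.
    rewrite big1 ?cabs0 ?powR0 ?(lt0r_neq0 q0)//; last first.
      by move=> i _; rewrite deviation_eq0//; move: ht; clear; lia.
    over.
  by rewrite integral0 lee_fin powR_ge0.
have /andP[st tS] := ht; rewrite st.
have jL : (t.+1 - s0 < L.+2)%N by move: tS; rewrite /top_level; clear; lia.
have := sP (Ordinal jL); have -> : tj (Ordinal jL) = t by rewrite /tj/= subnKC.
move=> /le_trans; apply; rewrite lee_fin /B/= -/potential_mass.
set j := (t.+1 - s0)%N; set rM := Num.sqrt _.
have rM0 : 0 <= rM by rewrite sqrtr_ge0.
have bj0 : 0 < b ^+ j by rewrite exprn_gt0// besov_root_gt0.
have G0 : 0 <= 2 * H * rho ^+ s0 * b ^+ j * rM.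
  by pos.
have -> : 2 * H * rho ^+ s0 * b ^+ (2 * j) * rM = b ^+ j * (2 * H * rho ^+ s0 * b ^+ j * rM).
  by rewrite mul2n -addnn exprD; ring.
rewrite (powRM _ (ltW bj0) G0).
have -> : maurey_const q * (W / (b ^+ j) `^ q) *
    ((b ^+ j) `^ q * (2 * H * rho ^+ s0 * b ^+ j * rM) `^ q) =
    maurey_const q * W * (2 * H * rho ^+ s0 * b ^+ j * rM) `^ q.
  by field; rewrite gt_eqF// powR_gt0.
have -> : sampling_const * rho ^+ s0 * b ^+ j * rM =
    maurey_const q / (1 - b) * (2 * H * rho ^+ s0 * b ^+ j * rM).
  by rewrite /sampling_const; ring.
have b1 : 0 < 1 - b by rewrite subr_gt0 besov_root_lt1.
have m1 := maurey_const_ge1.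
have b1V : 1 <= (1 - b)^-1 by rewrite invf_ge1//; have := besov_root_ge0; lra.
have mb1 : 1 <= maurey_const q / (1 - b) by rewrite -[leLHS]mulr1 ler_pM.
rewrite [leRHS]powRM ?(le_trans ler01 mb1)// ler_wpM2r ?powR_ge0//.
(* A constant that is at least 1 lies below its own [q]-th power, so it can be carried inside the
   power. *)
apply: (@le_trans _ _ (maurey_const q / (1 - b))); last exact: le1r_powR.
by rewrite ler_wpM2l ?potential_mass_le ?(le_trans ler01 m1).
Qed.

Local Notation low := (low_freqs d s0).

(** The 4 is that of [Lpnorm_perturb]; the summands account for the sampling error and for the tail
    above [S]. *)
Definition upper_const : R := 4 * (sampling_const + 2 * A / b ^+ 4).

(** The approximant keeps the coefficients below [s0] and adds the empirical mean of the drawn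
    terms. In each block the error is minus the mean of the deviations plus the frequencies above
    [S], and the condition on [L] makes the latter of the same order. *)
Lemma sampling_approx (m : nat) : (0 < d)%N -> (size low + M <= m)%N ->
  b ^+ L <= (Num.sqrt M%:R)^-1 ->
  exists2 Q, mterm_polys d m Q & forall t, (Lpnorm q (sigma_op t (fun x => f x - Q x)%R) <=
    (if (s0 <= t.+1)%N then upper_const * rho ^+ s0 / Num.sqrt M%:R * b ^+ (t.+1 - s0) else 0)%:E)%E.
Proof.
move=> d0 sm bL; have [s [sM sP]] := sampling.
(* A frequency drawn several times accumulates its coefficients. The index [n] has coefficient 0, so
   the default frequency 0 that [nth] assigns to it does no harm. *)
pose cc k : C := (if k \in low then c k else 0) + rC M%:R^-1 * \sum_(i <- s | kk i == k) xn i.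
pose ss := undup (low ++ [seq kk i | i : 'I_n.+1 <- s]).
have uss : uniq ss by exact: undup_uniq.
have cc0 k : k \notin ss -> cc k = 0.
  rewrite mem_undup mem_cat negb_or => /andP[/negbTE kl ks].
  rewrite /cc kl add0r big_seq_cond big1 ?mulr0// => i /andP[is_ /eqP ki].
  by move/mapP: ks; case; exists i.
exists (trigpoly ss cc).
  apply: mterm_trigpoly => //; apply: leq_trans (size_undup _) _.
  by rewrite size_cat size_map sM.
have fi := besov_cintegrable p2 fB; have pf := besov_periodic fB.
pose g x := f x - trigpoly ss cc x.
have gi : cintegrable g.
  apply: eq_cintegrable (cintegrableD fi (cintegrableN (cintegrable_trigpoly ss cc))) => //.
have pg : Defs.periodic g.
  move=> x j; rewrite /g pf; congr (_ - _); rewrite /trigpoly.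
  by apply: eq_bigr => k _; rewrite expk_periodic.
have gc k : fcoef g k = c k - cc k.
  rewrite /g fcoefB//; last exact: cintegrable_trigpoly.
  rewrite fcoef_trigpoly//; congr (_ - _); case: ifP => // /negbT ks.
  by rewrite cc0.
(* One box for both the spectrum of the block and all sampled frequencies. *)
move=> t; pose N := (2 ^ t.+1 + 2 ^ S)%N.
pose tail x := \sum_(k <- box d N | (S < level k)%N) rC (lam R t k) * c k * expk k x.
have E x : sigma_op t g x = - rC M%:R^-1 * \sum_(i <- s) dev t i x + tail x.
  rewrite (@sigma_opE R d N) ?leq_addr//.
  under eq_bigr do rewrite gc.
  have S1 : \sum_(k <- box d N) rC (lam R t k) * (if k \in mid then c k else 0) * expk k x = mean t x.
    rewrite /mid_mean (bigID (fun k => k \in mid))/= [X in _ + X]big1 ?addr0; last first.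
      by move=> k /negbTE ->; rewrite mulr0 mul0r.
    rewrite -big_filter (perm_big mid); last first.
      apply: uniq_perm; rewrite ?filter_uniq ?uniq_box// => k.
      rewrite mem_filter andb_idr// mem_mid_freqs mem_box level_leP => /andP[_ /ltnW kS].
      by rewrite (leq_trans kS)// leq_addl.
    by apply: eq_big_seq => k ->.
  have S2 : \sum_(k <- box d N) rC (lam R t k) * (\sum_(i <- s | kk i == k) xn i) * expk k x =
      \sum_(i <- s) term t i x.
    under eq_bigr => k _ do rewrite big_mkcond/= mulr_sumr mulr_suml.
    rewrite exchange_big/=; apply: eq_bigr => i _.
    have kN : kk i \in box d N.
      rewrite mem_box; have [iN|iN] := ltnP i n.
        have : kk i \in mid by exact: mem_nth.
        rewrite mem_mid_freqs level_leP => /andP[_ /ltnW kS].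
        by rewrite (leq_trans kS)// leq_addl.
      rewrite /mid_freq nth_default//; apply/nrm_leP => j; rewrite mxE/=; exact: leq0n.
    rewrite (bigD1_seq (kk i))//= ?uniq_box// eqxx [X in _ + X]big1 ?addr0//.
    by move=> k /negbTE; rewrite eq_sym => ->; rewrite mulr0 mul0r.
  have S3 : \sum_(k <- box d N) rC (lam R t k) * (if (S < level k)%N then c k else 0) * expk k x =
      tail x.
    rewrite /tail [RHS]big_mkcond/=; apply: eq_bigr => k _.
    by case: ifP => //; rewrite mulr0 mul0r.
  have -> : \sum_(i <- s) dev t i x = \sum_(i <- s) term t i x - rC M%:R * mean t x.
    rewrite /deviation sumrB; congr (_ - _).
    rewrite big_const_seq count_predT sM iter_addr_0.
    rewrite (_ : rC M%:R = M%:R :> C) ?mulr_natl//.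
    elim: M => [|M' IH]; first exact: rC0.
    by rewrite -[M'.+1]addn1 !natrD rCD IH rC1.
  have e1 : rC M%:R^-1 * rC M%:R = 1 :> C by rewrite -rCM mulVf ?rC1// pnatr_eq0 -lt0n.
  have -> : - rC M%:R^-1 * (\sum_(i <- s) term t i x - rC M%:R * mean t x) =
      mean t x + (- rC M%:R^-1) * \sum_(i <- s) term t i x.
    by rewrite mulrBr !mulNr opprK mulrA e1 mul1r addrC.
  rewrite -S1 -S2 -S3 mulr_sumr -!big_split/=.
  apply: eq_bigr => k _; rewrite /cc mem_low_freqs mem_mid_freqs.
  (* Below [s0] the error has no coefficient left from [f], between [s0] and [S] the coefficient
     belongs to the mean, and above [S] it belongs to the tail. *)
  case: (ltnP (level k) s0) => l1.
    rewrite /= ltnNge (leq_trans (ltnW l1)) ?leq_addr//=.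
    ring.
  case: (leqP (level k) S) => l2 /=; ring.
(* The block sees only the levels [t] and [t.+1], so it meets a level above [S] only if [S <= t]. *)
have tail_le x : cabs (tail x) <= if (S <= t)%N then 2 * A * rho ^+ t else 0.
  rewrite /tail; apply: (le_trans (ler_cabs_sum _ _ _)).
  pose sh := [seq k <- box d N | (S < level k)%N && ((level k == t) || (level k == t.+1))].
  apply: (@le_trans _ _ (\sum_(k <- sh) 1 * cabs (c k))).
    rewrite big_filter big_mkcondr/=; apply: ler_sum => k _.
    rewrite !cabsM cabs_expk mulr1 cabs_rC; case: ifP => kt.
      by rewrite ler_wpM2r ?cabs_ge0// norm_lam_le1.
    case: (eqVneq (lam R t k) 0) => [->|/lam_level]; first by rewrite normr0 mul0r.
    by rewrite kt.
  case: ifP => St; last first.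
    rewrite big_seq big1// => k; rewrite mem_filter => /andP[kh _].
    by exfalso; move: kh St; clear; lia.
  have ush : uniq sh by rewrite filter_uniq// uniq_box.
  have shP k : k \in sh -> (t <= level k < t.+2)%N.
    by rewrite mem_filter => /andP[/andP[_ /orP[]/eqP ->] _]; rewrite !ltnS ?leqnn ?leqnSn.
  apply: (le_trans (sum_by_level p2 r0 theta1 fB ush (fun=> ler01) shP)).
  rewrite big_nat_recr//= big_nat1 !mul1r -mulrA mulr_natl mulr2n lerD2l.
  rewrite ler_wpM2l ?(ltW (besov_const1_gt0 d r K))// exprS ger_pMl ?exprn_gt0 ?besov_ratio_gt0//.
  exact: ltW (besov_ratio_lt1 rd).
have rM0 : 0 < Num.sqrt M%:R :> R by rewrite sqrtr_gt0 ltr0n.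
have rM0' := ltW rM0.
have rMM : Num.sqrt M%:R * Num.sqrt M%:R = M%:R :> R by rewrite -expr2 sqr_sqrtr.
have rho0 : 0 < rho := besov_ratio_gt0 d r.
have SC0 : 0 <= sampling_const.
  have m0 := le_trans ler01 maurey_const_ge1.
  have b0 : 0 <= 1 - b by rewrite subr_ge0 ltW.
  by rewrite /sampling_const; pos.
pose Y : R := if (s0 <= t.+1)%N then rho ^+ s0 / Num.sqrt M%:R * b ^+ (t.+1 - s0) else 0.
have Y0 : 0 <= Y.
  by rewrite /Y; case: ifP => // _; pos.
have -> : (if (s0 <= t.+1)%N then upper_const * rho ^+ s0 / Num.sqrt M%:R * b ^+ (t.+1 - s0) else 0)
    = 4 * (sampling_const * Y + 2 * A / b ^+ 4 * Y).
  rewrite /Y /upper_const; case: ifP => _; ring.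
rewrite -/g (_ : sigma_op t g = (fun x => - rC M%:R^-1 * \sum_(i <- s) dev t i x + tail x)); last first.
  by apply/funext => x; exact: E.
apply: Lpnorm_perturb => //.
- by pos.
- by pos.
- apply: cmeasurableM; first exact: cmeasurable_cst.
  by apply: cmeasurable_sum => i; exact: cmeasurable_deviation.
- rewrite /tail (_ : (fun x => _) = (fun x => \sum_(k <- [seq k <- box d N | (S < level k)%N])
     (rC (lam R t k) * c k * expk k x))); last by apply/funext => x; rewrite big_filter.
  apply: cmeasurable_sum => k.
  by apply: cmeasurableM; [exact: cmeasurable_cst|exact: cmeasurable_expk].
- have MVM x : (cabs (- rC M%:R^-1 * \sum_(i <- s) dev t i x) `^ q)%:E =
      ((M%:R^-1 `^ q)%:E * (cabs (\sum_(i <- s) dev t i x) `^ q)%:E)%E.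
    rewrite cabsM cabsN cabs_rC ger0_norm ?invr_ge0// powRM ?invr_ge0 ?cabs_ge0//.
  under eq_integral do rewrite MVM.
  rewrite ge0_integralZl ?lee_fin ?powR_ge0//; last 2 first.
  - by apply: measurable_cabs_powR; apply: cmeasurable_sum => i; exact: cmeasurable_deviation.
  - by move=> x _; rewrite lee_fin powR_ge0.
  apply: (le_trans (lee_wpmul2l _ (sP t))); first by rewrite lee_fin powR_ge0.
  rewrite -EFinM lee_fin -powRM ?invr_ge0//; last first.
    by case: ifP => // _; pos.
  rewrite le_eqVlt; apply/orP; left; apply/eqP; congr (_ `^ q).
  rewrite /Y; case: ifP => _; last by rewrite !mulr0.
  by rewrite -[X in X^-1 * _]rMM; field; exact: lt0r_neq0.
- move=> x; apply: (le_trans (tail_le x)); case: ifP => St; last first.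
    by pos.
  have st : (s0 <= t.+1)%N by apply: leqW; apply: leq_trans St; exact: leq_addr.
  have -> : 2 * A * rho ^+ t = 2 * A / b ^+ 4 * (rho ^+ t * b ^+ 4) by field.
  rewrite /Y st; apply: ler_wpM2l; first by pos.
  rewrite -besov_rootX4 -!exprM -exprD.
  (* As [t >= s0 + L], the exponent [4t + 4] is at least [4 s0 + L + (t + 1 - s0)]; then [b^L] is
     traded for [M^(-1/2)]. *)
  apply: (@le_trans _ _ (b ^+ (4 * s0) * (b ^+ L * b ^+ (t.+1 - s0)))).
    rewrite -!exprD besov_rootX_le//; move: St; rewrite /top_level; clear; lia.
  by rewrite -mulrA ler_wpM2l ?exprn_ge0// ler_wpM2r ?exprn_ge0.
Qed.

End Sampling.

(** * The upper estimate *)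

Section UpperBound.
Variable R : realType.
Variables (d : nat) (p q r : R) (theta : \bar R) (K : nat).
Hypotheses (d0 : (0 < d)%N) (p2 : 2 < p) (pq : p < q) (theta1 : (1 <= theta)%E).
Hypothesis rd : d%:R / 2 < r.
Local Notation C := (complex.complex R).
Local Notation P := (torus_prob R d).

Lemma inLp_sub_mterm (f Q : 'rV[R]_d -> C) m : 1 <= q -> inLp q f -> mterm_polys d m Q ->
  inLp q (fun x => f x - Q x).
Proof.
move=> q1 [mf [pf nf]] [ks [c [_ ->]]].
have mQ : cmeasurable (fun x : 'rV[R]_d => - \sum_(i < m) c i * expk (ks i) x).
  apply: cmeasurableN; apply: cmeasurable_sum => i.
  by apply: cmeasurableM; [exact: cmeasurable_cst|exact: cmeasurable_expk].
have q0 := lt_le_trans ltr01 q1.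
split; first exact: cmeasurableD.
split.
  move=> x j; rewrite pf; congr (_ - _); apply: eq_bigr => i _.
  by rewrite expk_periodic.
pose a := fine (Lpnorm q f).
have aE : Lpnorm q f = a%:E by rewrite fineK// ge0_fin_numE// Lpnorm_ge0.
have a0 : 0 <= a by rewrite fine_ge0// Lpnorm_ge0.
apply: (@le_lt_trans _ _ (4 * (a + \sum_(i < m) cabs (c i)))%:E); last exact: ltry.
apply: Lpnorm_perturb => //.
- by rewrite sumr_ge0// => i _; exact: cabs_ge0.
- by apply/Lpnorm_leP => //; rewrite aE.
- move=> x; rewrite cabsN (le_trans (ler_cabs_sum _ _ _))// ler_sum// => i _.
  by rewrite cabsM cabs_expk mulr1.
Qed.

Lemma Bq1norm_le (g : 'rV[R]_d -> C) (s : nat) (b e : R) : inLp q g -> 0 <= e -> 0 <= b < 1 ->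
  (forall t, Lpnorm q (sigma_op t g) <=
    (if (s <= t.+1)%N then e * b ^+ (t.+1 - s) else 0)%:E)%E ->
  (Bq1norm q g <= (e / (1 - b))%:E)%E.
Proof.
move=> gq e0 b01 h; rewrite /Bq1norm; case: asboolP => // _.
apply: lime_le; first by apply: is_cvg_nneseries => t _ _; exact: Lpnorm_ge0.
apply: nearW => N; apply: (le_trans (lee_sum _ (fun t _ => h t))).
rewrite sumEFin lee_fin.
apply: (@le_trans _ _ (e * \sum_(0 <= t < N) (if (s <= t.+1)%N then b ^+ (t.+1 - s) else 0))).
  rewrite mulr_sumr; apply: ler_sum => t _.
  by case: ifP => // _; rewrite mulr0.
by rewrite ler_wpM2l// sum_shifted_geometric_le.
Qed.

Lemma besov_ratioX (s : nat) :
  besov_ratio d r ^+ s = (2 ^ (d * s))%:R `^ (- (r / d%:R - 2^-1)).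
Proof.
have dn0 : d%:R != 0 :> R by rewrite pnatr_eq0 -lt0n.
rewrite /besov_ratio -powRD; last by rewrite pnatr_eq0 implybT.
rewrite -powR_mulrn ?powR_ge0// -powRrM natrX -powR_mulrn// -powRrM natrM.
by congr (_ `^ _); field.
Qed.

(** The level [s] gives the exponent [-(r/d - 1/2)] through [besov_ratioX] and the sample size gives
    [-1/2]; their sum is [-r/d]. *)
Lemma upper_rate (m M s : nat) : (0 < m)%N -> (m < 2 * 2 ^ (d * s.+1))%N -> (m <= 2 * M)%N ->
  besov_ratio d r ^+ s / Num.sqrt M%:R <=
  ((2 * 2 ^ d)%:R `^ (r / d%:R - 2^-1) * 2) * m%:R `^ (- (r / d%:R)).
Proof.
move=> m0 ms mM; have m0R : (0 : R) < m%:R by rewrite ltr0n.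
have M0 : (0 < M)%N by move: m0 mM; clear; lia.
have M0R : (0 : R) < M%:R by rewrite ltr0n.
have dR : (0 : R) < d%:R by rewrite ltr0n.
set a := r / d%:R - 2^-1.
have a0 : 0 <= a by rewrite subr_ge0 ler_pdivlMr// mulrC ltW.
have h1 : besov_ratio d r ^+ s <= (2 * 2 ^ d)%:R `^ a * m%:R `^ (- a).
  rewrite besov_ratioX -/a !powRN.
  have X0 : (0 : R) < (2 ^ (d * s))%:R by rewrite ltr0n expn_gt0.
  rewrite ler_pdivlMr ?powR_gt0// mulrC ler_pdivrMr ?powR_gt0// -powRM ?ler0n//.
  rewrite ge0_ler_powR ?nnegrE ?mulr_ge0 ?ler0n// -natrM ler_nat.
  by apply: ltnW; apply: leq_trans ms _; rewrite mulnS expnD mulnA.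
have h2 : (Num.sqrt M%:R)^-1 <= 2 * m%:R `^ (- 2^-1) :> R.
  rewrite powRN powR12_sqrt ?ler0n//.
  rewrite ler_pdivlMr ?sqrtr_gt0// mulrC ler_pdivrMr ?sqrtr_gt0//.
  rewrite -(@ler_pXn2r _ 2)// ?nnegrE ?mulr_ge0 ?sqrtr_ge0//.
  rewrite exprMn !sqr_sqrtr ?ler0n// -natrX -natrM ler_nat.
  by move: mM; clear; lia.
apply: (le_trans (ler_pM _ _ h1 h2)).
- by rewrite exprn_ge0// ltW// besov_ratio_gt0.
- by rewrite invr_ge0 sqrtr_ge0.
have -> : - (r / d%:R) = - a + - 2^-1 by rewrite /a; ring.
rewrite (@powRD _ m%:R (- a) (- 2^-1)); last by rewrite (gt_eqF m0R) implybT.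
by rewrite le_eqVlt; apply/orP; left; apply/eqP; ring.
Qed.

Lemma upper_bound : exists2 C2 : R, 0 < C2 & forall m : nat, (1 <= m)%N ->
  (best_mterm_class m q (besov_ball d r p theta K) <= (C2 * (m%:R `^ (- (r / d%:R))))%:E)%E.
Proof.
have r0 : 0 < r by apply: le_lt_trans rd; rewrite divr_ge0.
have q1 : 1 <= q by apply: ltW; apply: lt_trans pq; apply: lt_trans p2; rewrite ltr1n.
have q0 : 0 < q := lt_le_trans ltr01 q1.
pose b : R := besov_root d r.
have b0 : 0 < b := besov_root_gt0 d r.
have b1 : b < 1 := besov_root_lt1 rd.
have b1' : 0 < 1 - b by rewrite subr_gt0.
have U0 : 0 <= upper_const d r K q.
  have A0 := besov_const1_gt0 d r K.
  have H0 := deviation_const_gt0 K rd.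
  have m0 : 0 <= maurey_const q by rewrite mulr_ge0 ?powR_ge0// mulr_ge0// expR_ge0.
  apply: mulr_ge0 => //; apply: addr_ge0.
    by apply: mulr_ge0; [apply: mulr_ge0; [|rewrite invr_ge0 ltW]|apply: mulr_ge0; [|exact: ltW]].
  by apply: mulr_ge0; [apply: mulr_ge0; [|exact: ltW]|rewrite invr_ge0 exprn_ge0// ltW].
pose D : R := upper_const d r K q * ((2 * 2 ^ d)%:R `^ (r / d%:R - 2^-1) * 2) / (1 - b).
have D0 : 0 <= D.
  rewrite /D; apply: mulr_ge0; last by rewrite invr_ge0 ltW.
  by apply: mulr_ge0 => //; rewrite mulr_ge0// powR_ge0.
(* [D] is shown to be non-negative only; adding 1 makes the constant positive. *)
exists (1 + D); first by apply: ltr_wpDr.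
move=> m m1; apply: ge_ereal_sup => _ [f fB <-].
(* At most half of the terms go to the low frequencies, so at least half of them remain for
   sampling. For [m = 1] this gives [s0 = 0] and an empty low part. *)
pose s0 := trunc_log (2 ^ d) m./2.
have d2 : (1 < 2 ^ d)%N by rewrite -{1}(expn0 2) ltn_exp2l.
have hs : (m < 2 * 2 ^ (d * s0.+1))%N.
  have := trunc_log_ltn m./2 d2; rewrite -/s0 -expnM; move: (2 ^ _)%N => X; clear; lia.
have low2 : (size (low_freqs d s0) <= m./2)%N.
  apply: leq_trans (size_low d s0) _; case: eqP => // /eqP s0n.
  rewrite expnM; have [m2|m2] := posnP m./2.
    by move: s0n; rewrite /s0 m2 trunc_log0.
  by have /andP[] := trunc_log_bounds d2 m2.
pose M := (m - size (low_freqs d s0))%N.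
have M0 : (0 < M)%N by rewrite /M; move: low2 m1; clear; lia.
have mM : (m <= 2 * M)%N by rewrite /M; move: low2 m1; clear; lia.
have rM : 0 < (Num.sqrt M%:R)^-1 :> R by rewrite invr_gt0 sqrtr_gt0 ltr0n.
(* [L] depends on [m], but none of the final constants depends on [L]. *)
have [L bL] : exists L, b ^+ L <= (Num.sqrt M%:R)^-1.
  have : `|b| < 1 by rewrite gtr0_norm.
  move=> /cvg_expr/cvgrPdist_lt/(_ _ rM)[L _ /(_ L (leqnn _))].
  rewrite /= sub0r normrN ger0_norm ?exprn_ge0 ?(ltW b0)// => h.
  by exists L; exact: ltW.
have smM : (size (low_freqs d s0) + M <= m)%N by rewrite /M; move: low2 m1; clear; lia.
have [Q Qm Qt] := sampling_approx p2 r0 theta1 rd fB q1 M0 d0 smM bL.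
apply: (@le_trans _ _ (Bq1norm q (fun x => f x - Q x)%R)).
  by apply: ereal_inf_lbound; exists Q.
pose e : R := upper_const d r K q * besov_ratio d r ^+ s0 / Num.sqrt M%:R.
have e0 : 0 <= e.
  apply: mulr_ge0; last exact: ltW.
  by rewrite mulr_ge0// exprn_ge0// ltW// besov_ratio_gt0.
apply: (le_trans (@Bq1norm_le _ s0 b e _ e0 _ Qt)).
- by apply: inLp_sub_mterm Qm => //; exact: besov_inLp fB _ q0.
- by rewrite b1 ltW.
have X0 : 0 <= m%:R `^ (- (r / d%:R)) by exact: powR_ge0.
rewrite lee_fin; apply: (@le_trans _ _ (D * m%:R `^ (- (r / d%:R)))); last first.
  by rewrite ler_wpM2r// lerDr.
have := upper_rate m1 hs mM; rewrite /D /e.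
move: U0 X0 rM; set u := upper_const _ _ _ _; set X := m%:R `^ _; set Y := (_ * 2) => U0 X0 rM h.
have -> : u * Y / (1 - b) * X = u * (Y * X) / (1 - b) by ring.
rewrite ler_wpM2r ?invr_ge0 ?(ltW b1')// -mulrA ler_wpM2l//.
Qed.

End UpperBound.

(** * Iterated differences of characters and of products *)

Section ChordBound.
Variable R : realType.

Lemma cos1_le (a : R) : 0 <= a -> `|cos a - 1| <= a.
Proof.
move=> a0; have cts : {within `[0, a], continuous (@cos R)}.
  by apply: continuous_subspaceT => x; exact: continuous_cos.
have [c _] := MVT_segment a0 (fun x _ => is_derive_cos x) cts.
rewrite cos0 subr0 => ->; rewrite normrM normrN (ger0_norm a0).
by rewrite ler_piMl// sin_max.
Qed.

Lemma sin_le (a : R) : 0 <= a -> `|sin a| <= a.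
Proof.
move=> a0; have cts : {within `[0, a], continuous (@sin R)}.
  by apply: continuous_subspaceT => x; exact: continuous_sin.
have [c _] := MVT_segment a0 (fun x _ => is_derive_sin x) cts.
rewrite sin0 !subr0 => ->; rewrite normrM (ger0_norm a0).
by rewrite ler_piMl// cos_max.
Qed.

Lemma cabs_eixB1 (a : R) : cabs (eix a - 1) <= 2 * `|a|.
Proof.
rewrite (le_trans (ler_cabs_ReIm _))// mulr_natl mulr2n cReD cImD cReN cImN/= oppr0 addr0.
apply: lerD; first by rewrite -(cos_norm a) cos1_le.
case: (lerP 0 a) => a0; first by rewrite (ger0_norm a0) sin_le.
by rewrite (ltr0_norm a0) -[a in leLHS]opprK sinN normrN sin_le// oppr_ge0 ltW.
Qed.

End ChordBound.

Section DifferenceBounds.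
Variable R : realType.
Variable d : nat.
Local Notation C := (complex.complex R).
Implicit Types (f g : 'rV[R]_d -> C) (h x : 'rV[R]_d) (k : 'rV[int]_d).

(** A Bernstein-type estimate for all orders at once. Recording the whole geometric sequence makes
    the notion stable under products: amplitudes multiply and rates add. *)
Definition diffbound h (A a : R) f := forall j x, cabs (fdiffk j h f x) <= A * a ^+ j.

Lemma fdiffkSr j h f : fdiffk j.+1 h f = fdiffk j h (fdiff h f).
Proof. exact: iterSr. Qed.

Lemma fdiffkD j h f g x : fdiffk j h (fun x => f x + g x) x = fdiffk j h f x + fdiffk j h g x.
Proof.
elim: j x => // j IH x; rewrite /fdiffk !iterS -!/(fdiffk _ _ _) /fdiff !IH; ring.
Qed.

Lemma fdiffkZ j h (c : C) f x : fdiffk j h (fun x => c * f x) x = c * fdiffk j h f x.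
Proof.
elim: j x => // j IH x; rewrite /fdiffk !iterS -!/(fdiffk _ _ _) /fdiff !IH; ring.
Qed.

Lemma fdiffk_translate j h f y x : fdiffk j h (fun x => f (x + y)) x = fdiffk j h f (x + y).
Proof.
elim: j x => // j IH x; rewrite /fdiffk !iterS -!/(fdiffk _ _ _) /fdiff !IH.
by rewrite addrAC.
Qed.

Lemma eq_fdiffk j h f g : (forall x, f x = g x) -> fdiffk j h f = fdiffk j h g.
Proof. by move=> fg; congr fdiffk; apply/funext. Qed.

Lemma cabs_fdiffk_le j h f (A : R) x : (forall x, cabs (f x) <= A) ->
  cabs (fdiffk j h f x) <= 2 ^+ j * A.
Proof.
move=> fA; elim: j x => [|j IH] x; first by rewrite expr0 mul1r.
rewrite /fdiffk iterS -/(fdiffk _ _ _) /fdiff (le_trans (ler_cabsB _ _))// exprS -mulrA.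
by rewrite mulr_natl mulr2n lerD.
Qed.

Lemma diffbound_fdiff h A a f : diffbound h A a f -> diffbound h (A * a) a (fdiff h f).
Proof. by move=> H j x; rewrite -fdiffkSr -mulrA -exprS. Qed.

Lemma diffbound_translate h A a f y : diffbound h A a f -> diffbound h A a (fun x => f (x + y)).
Proof. by move=> H j x; rewrite fdiffk_translate. Qed.

(** The Leibniz rule is applied to the innermost difference only, and the induction hypothesis to
    both resulting products; the binomial sum condenses into a power of [a + b]. *)
Lemma diffboundM h A a f B b g : diffbound h A a f -> diffbound h B b g ->
  diffbound h (A * B) (a + b) (fun x => f x * g x).
Proof.
move=> Hf Hg j; elim: j A f B g Hf Hg => [|j IH] A f B g Hf Hg x.
  rewrite expr0 mulr1 /= cabsM ler_pM ?cabs_ge0//.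
    by have := Hf 0%N x; rewrite expr0 mulr1.
  by have := Hg 0%N x; rewrite expr0 mulr1.
rewrite fdiffkSr (@eq_fdiffk _ _ _ (fun x => fdiff h f x * g (x + h) + f x * fdiff h g x)).
  rewrite fdiffkD (le_trans (ler_cabsD _ _))//.
  have -> : A * B * (a + b) ^+ j.+1 =
      A * a * B * (a + b) ^+ j + A * (B * b) * (a + b) ^+ j by rewrite exprS; ring.
  apply: lerD; apply: IH => //.
  - exact: diffbound_fdiff.
  - exact: diffbound_translate.
  - exact: diffbound_fdiff.
by move=> y; rewrite /fdiff; ring.
Qed.

Lemma diffbound1 h : diffbound h 1 0 (fun=> 1).
Proof.
have E j : fdiffk j.+1 h (fun=> 1 : C) = fun=> 0.
  elim: j => [|j IH]; first by apply/funext => x; rewrite /= /fdiff subrr.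
  by rewrite /fdiffk iterS -/(fdiffk _ _ _) IH; apply/funext => x; rewrite /fdiff subrr.
case=> [|j] x; first by rewrite /= cabs1 expr0 mulr1.
by rewrite E cabs0 mul1r exprS mul0r.
Qed.

Lemma diffbound_prod h (I : Type) (s : seq I) (A a : I -> R) (F : I -> 'rV[R]_d -> C) :
  (forall i, diffbound h (A i) (a i) (F i)) ->
  diffbound h (\prod_(i <- s) A i) (\sum_(i <- s) a i) (fun x => \prod_(i <- s) F i x).
Proof.
move=> H; elim: s => [|i s IH].
  rewrite !big_nil (_ : (fun x => _) = fun=> 1); first exact: diffbound1.
  by apply/funext => x; rewrite big_nil.
rewrite !big_cons (_ : (fun x => _) = fun x => F i x * \prod_(i <- s) F i x).
  exact: diffboundM.
by apply/funext => x; rewrite big_cons.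
Qed.

Lemma diffbound_expk h (a : R) k : cabs (expk k h - 1 : C) <= a -> diffbound h 1 a (expk k).
Proof.
move=> ka j x; have -> : fdiffk j h (expk k : 'rV[R]_d -> C) x = (expk k h - 1) ^+ j * expk k x.
  elim: j x => [|j IH] x; first by rewrite expr0 mul1r.
  rewrite /fdiffk iterS -/(fdiffk _ _ _) /fdiff !IH expk_shift exprS; ring.
rewrite cabsM cabs_expk mulr1 mul1r cabsX lerXn2r ?nnegrE ?cabs_ge0//.
exact: le_trans (cabs_ge0 _) ka.
Qed.

End DifferenceBounds.

(** * Rudin-Shapiro polynomials and their tensor product *)

Section RudinShapiro.
Variable R : realType.
Variable d : nat.
Local Notation C := (complex.complex R).

Definition axisfreq (i : 'I_d) (z : nat) : 'rV[int]_d := z%:Z *: delta_mx ord0 i.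

Lemma expk_axisfreq i z (x : 'rV[R]_d) : expk (axisfreq i z) x = eix (z%:R * x ord0 i) :> C.
Proof.
rewrite /expk (bigD1 i)//= big1 ?addr0 => [|j ji]; first by rewrite !mxE !eqxx/= mulr1.
by rewrite !mxE (negbTE ji)/= mulr0 mul0r.
Qed.

Lemma axisfreqD i y z : axisfreq i (y + z) = axisfreq i y + axisfreq i z.
Proof. by rewrite /axisfreq PoszD scalerDl. Qed.

Lemma ler_enorm (h : 'rV[R]_d) i : `|h ord0 i| <= enorm h.
Proof.
rewrite -sqrtr_sqr ler_wsqrtr// (bigD1 i)//= lerDl sumr_ge0// => j _.
exact: sqr_ge0.
Qed.

Lemma diffbound_axisfreq h i z :
  diffbound h 1 (z%:R * (2 * enorm h)) (expk (axisfreq i z) : 'rV[R]_d -> C).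
Proof.
apply: diffbound_expk; rewrite expk_axisfreq (le_trans (cabs_eixB1 _))//.
rewrite normrM normr_nat mulrCA; apply: ler_wpM2l => //.
by rewrite ler_wpM2l// ler_enorm.
Qed.

(** Both members of the Rudin-Shapiro pair along axis [i] in one fixpoint: [true] gives [P + e Q]
    and [false] gives [P - e Q]. *)
Fixpoint rs_poly (i : 'I_d) (n : nat) (s : bool) (x : 'rV[R]_d) : C :=
  match n with
  | 0 => 1
  | n'.+1 => rs_poly i n' true x +
      rC (if s then 1 else -1) * (expk (axisfreq i (2 ^ n')) x * rs_poly i n' false x)
  end.

Fixpoint rs_coef (n : nat) (s : bool) (j : nat) : R :=
  match n with
  | 0 => 1
  | n'.+1 => if (j < 2 ^ n')%N then rs_coef n' true j
             else (if s then 1 else -1) * rs_coef n' false (j - 2 ^ n')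
  end.

Lemma sqr_rs_coef n s j : rs_coef n s j ^+ 2 = 1.
Proof.
elim: n s j => [|n IH] s j /=; first by rewrite expr1n.
case: ifP => // _; rewrite exprMn IH mulr1.
by case: s; rewrite ?sqrrN expr1n.
Qed.

Lemma rs_polyE i n s (x : 'rV[R]_d) :
  rs_poly i n s x = \sum_(0 <= j < 2 ^ n) rC (rs_coef n s j) * expk (axisfreq i j) x.
Proof.
elim: n s => [|n IH] s.
  rewrite expn0 big_nat1 /= rC1 mul1r expk_axisfreq mul0r.
  by rewrite eix0.
rewrite /= !IH expnS mul2n -addnn [RHS](@big_cat_nat _ _ _ (2 ^ n)) ?leq_addr//=; congr (_ + _).
  by apply: eq_big_nat => j /andP[_ ->].
have shift (F : nat -> C) : \sum_(2 ^ n <= j < 2 ^ n + 2 ^ n) F j = \sum_(0 <= j < 2 ^ n) F (j + 2 ^ n)%N.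
  by rewrite -{1}[(2 ^ n)%N]add0n big_addn addnK.
rewrite shift !mulr_sumr; apply: eq_big_nat => j /andP[_ jn].
rewrite ltnNge leq_addl/= addnK axisfreqD expkD rCM; ring.
Qed.

Lemma sqnorm_parallelogram (u v : C) : sqnorm (u + v) + sqnorm (u - v) = 2 * (sqnorm u + sqnorm v).
Proof. rewrite /sqnorm !cReD !cImD !cReN !cImN; ring. Qed.

(** By the parallelogram law with a unimodular character, each step doubles the sum. Hence a member
    with [2^n] coefficients of modulus 1 exceeds its quadratic mean by at most a factor [sqrt 2]. *)
Lemma sqnorm_rs_poly i n (x : 'rV[R]_d) :
  sqnorm (rs_poly i n true x) + sqnorm (rs_poly i n false x) = 2 ^+ n.+1.
Proof.
elim: n => [|n IH] /=.
  by rewrite /sqnorm/= !expr1n expr0n !addr0 expr1.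
by rewrite rCN rC1 mulN1r mul1r sqnorm_parallelogram sqnormM sqnorm_expk mul1r IH -exprS.
Qed.

Lemma cabs_rs_poly i n s (x : 'rV[R]_d) : cabs (rs_poly i n s x) <= Num.sqrt (2 ^+ n.+1).
Proof.
rewrite cabsE ler_wsqrtr// -(sqnorm_rs_poly i n x).
by case: s; rewrite ?lerDl ?lerDr sqnorm_ge0.
Qed.

(** The inequality that closes the induction of [diffbound_rs_poly]. It fails for [j = 0], where the
    sup bound [cabs_rs_poly] takes over. The case [j = 1] reads [5 <= 4 sqrt 2], which suggests the
    intermediate value 5/4. *)
Lemma rs_growth j : (0 < j)%N -> 2 ^+ j + 3 ^+ j <= Num.sqrt 2 * 4 ^+ j :> R.
Proof.
move=> j0; have s2 : 5 / 4 <= Num.sqrt 2 :> R.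
  rewrite -(@ler_pXn2r _ 2)// ?nnegrE ?sqrtr_ge0// sqr_sqrtr//.
  by rewrite expr2; lra.
have p4 : (0 : R) <= 4 ^+ j by rewrite exprn_ge0.
apply: (@le_trans _ _ (5 / 4 * 4 ^+ j)); last by rewrite ler_wpM2r.
case: j j0 {p4} => // j _; elim: j => [|j IH]; first by rewrite !expr1; lra.
rewrite !(exprS _ j.+1).
have : (0 : R) <= 2 ^+ j.+1 by rewrite exprn_ge0.
have : (0 : R) <= 3 ^+ j.+1 by rewrite exprn_ge0.
move: (2 ^+ _) (3 ^+ _) (4 ^+ _) IH => a b c; lra.
Qed.

(** With [y = 2^n e], the two halves have rates [2y] and [2y + y], the [y] coming from the
    character. The whole may use rate [4y], and this slack keeps the gain in amplitude at the factor
    [sqrt 2] of the sup norm. *)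
Lemma diffbound_rs_poly h i n s :
  diffbound h (Num.sqrt (2 ^+ n.+1)) (2 ^+ n.+1 * (2 * enorm h)) (rs_poly i n s).
Proof.
set e := 2 * enorm h; have e0 : 0 <= e by rewrite mulr_ge0// sqrtr_ge0.
elim: n s => [|n IH] s j x; (case: (posnP j) => [->|j0]; first by rewrite expr0 mulr1 cabs_rs_poly).
  have sq : 1 <= Num.sqrt (2 ^+ 1) :> R by rewrite -[leLHS]sqrtr1 ler_wsqrtr// expr1 ler1n.
  have := diffbound1 h j x; rewrite expr0n (gtn_eqF j0) mulr0 => /le_trans; apply.
  by rewrite mulr_ge0 ?sqrtr_ge0// exprn_ge0// mulr_ge0.
pose A : R := Num.sqrt (2 ^+ n.+1).
have H1 := IH true j x.
have H2 := diffboundM (@diffbound_axisfreq h i (2 ^ n)) (IH false) j x.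
rewrite /= fdiffkD fdiffkZ (le_trans (ler_cabsD _ _))//.
apply: (@le_trans _ _ (A * (2 ^+ n.+1 * e) ^+ j + 1 * A * ((2 ^ n)%:R * e + 2 ^+ n.+1 * e) ^+ j)).
  apply: lerD => //; rewrite cabsM cabs_rC (_ : `|if s then 1 else -1| = 1) ?mul1r//.
    by move: H2; rewrite mul1r.
  by case: s; rewrite ?normrN normr1.
have A0 : 0 <= A by rewrite sqrtr_ge0.
have -> : Num.sqrt (2 ^+ n.+2) = Num.sqrt 2 * A :> R by rewrite exprS sqrtrM.
rewrite natrX !exprS; set y := 2 ^+ n * e.
have y0 : 0 <= y by rewrite mulr_ge0// exprn_ge0.
have -> : 2 * 2 ^+ n * e = 2 * y by rewrite /y; ring.
have -> : 2 ^+ n * e + 2 * y = 3 * y by rewrite /y; ring.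
have -> : 2 * (2 * 2 ^+ n) * e = 4 * y by rewrite /y; ring.
rewrite (exprMn _ 2 y) (exprMn _ 3 y) (exprMn _ 4 y).
have -> : A * (2 ^+ j * y ^+ j) + 1 * A * (3 ^+ j * y ^+ j) = A * y ^+ j * (2 ^+ j + 3 ^+ j) by ring.
have -> : Num.sqrt 2 * A * (4 ^+ j * y ^+ j) = A * y ^+ j * (Num.sqrt 2 * 4 ^+ j) by ring.
by rewrite ler_wpM2l ?rs_growth// mulr_ge0// exprn_ge0.
Qed.

Variable n : nat.

(** The shift by [2^(n+1)] in every coordinate places the spectrum between [2^(n+1)] and [3 2^n],
    where the multiplier of block [n.+1] is at least [2^(-d)]. *)
Definition rs_prod (x : 'rV[R]_d) : C :=
  \prod_(i < d) (expk (axisfreq i (2 ^ n.+1)) x * rs_poly i n true x).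

Lemma diffbound_rs_prod h :
  diffbound h (Num.sqrt (2 ^+ n.+1) ^+ d) (d%:R * 2 ^+ n.+3 * enorm h) rs_prod.
Proof.
have H i := diffboundM (@diffbound_axisfreq h i (2 ^ n.+1)) (@diffbound_rs_poly h i n true).
have := diffbound_prod (index_enum 'I_d) H.
rewrite prodr_const sumr_const card_ord mul1r -[X in diffbound _ _ X _]mulr_natl.
rewrite (_ : d%:R * _ = d%:R * 2 ^+ n.+3 * enorm h)//.
by rewrite natrX !(exprS 2); ring.
Qed.

Definition rs_freq (phi : {ffun 'I_d -> 'I_(2 ^ n)}) : 'rV[int]_d :=
  \row_i (2 ^ n.+1 + phi i)%N%:Z.

Definition rs_spectrum : seq 'rV[int]_d := [seq rs_freq phi | phi : {ffun 'I_d -> 'I_(2 ^ n)}].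

Definition rs_prodcoef (k : 'rV[int]_d) : C :=
  \prod_(i < d) rC (rs_coef n true (`|k ord0 i| - 2 ^ n.+1)).

Lemma uniq_rs_spectrum : uniq rs_spectrum.
Proof.
rewrite map_inj_uniq ?enum_uniq// => phi psi /rowP h; apply/ffunP => j.
by have := h j; rewrite !mxE => -[] /addnI E; exact: val_inj.
Qed.

Lemma size_rs_spectrum : size rs_spectrum = (2 ^ (d * n))%N.
Proof. by rewrite size_map -cardE card_ffun !card_ord -expnM mulnC. Qed.

Lemma rs_spectrum_nrm k : (0 < d)%N -> k \in rs_spectrum -> (2 ^ n.+1 <= nrm k <= 3 * 2 ^ n)%N.
Proof.
move=> d0 /codomP[phi ->]; apply/andP; split.
  apply/nrm_geP; first by rewrite expn_gt0.
  by exists (Ordinal d0); rewrite mxE absz_nat leq_addr.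
apply/nrm_leP => j; rewrite mxE absz_nat expnS.
by rewrite (mulnDl 2 1) mul1n leq_add2l ltnW.
Qed.

Lemma sqnorm_rs_prodcoef k : sqnorm (rs_prodcoef k) = 1.
Proof.
rewrite -sqr_cabs cabs_prod (eq_bigr (fun=> 1)) ?big1_eq ?expr1n// => i _.
by rewrite cabsE sqnorm_rC sqr_rs_coef sqrtr1.
Qed.

Lemma rs_prodE : rs_prod = trigpoly rs_spectrum rs_prodcoef.
Proof.
apply/funext => x; rewrite /rs_prod /trigpoly.
under eq_bigr => i _ do rewrite rs_polyE big_mkord mulr_sumr.
rewrite bigA_distr_bigA/= /rs_spectrum big_image/=; apply: eq_bigr => phi _.
rewrite /rs_prodcoef /expk eix_sum -big_split/=; apply: eq_bigr => i _.
rewrite -!/(expk _ _) !expk_axisfreq !mxE absz_nat addKn mulrCA -eixD; congr (_ * eix _).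
by rewrite -mulrDl -natrD.
Qed.

End RudinShapiro.

(** * Upper bounds for the Besov integral by dyadic majorants *)

Section CountableCover.
Local Open Scope ereal_scope.

(** Only the majorants [phi j] are asked to be measurable. In the application [f] contains the
    modulus of smoothness, a supremum over uncountably many steps. *)
Lemma integral_le_cover (disp : measure_display) (T : measurableType disp) (R : realType)
    (mu : {measure set T -> \bar R}) (D : set T) (f : T -> \bar R) (phi : nat -> T -> \bar R)
    (M : \bar R) : measurable D ->
  (forall x, D x -> 0 <= f x) -> (forall j, measurable_fun D (phi j)) ->
  (forall j x, D x -> 0 <= phi j x) -> (forall x, D x -> exists j, f x <= phi j x) ->
  (forall n, \sum_(0 <= j < n) \int[mu]_(x in D) phi j x <= M) ->
  \int[mu]_(x in D) f x <= M.
Proof.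
move=> mD f0 mphi phi0 fphi sM.
apply: (@le_trans _ _ (\int[mu]_(x in D) \sum_(j <oo) phi j x)).
  apply: le_integral_ge0 => // x Dx; have [j fj] := fphi x Dx.
  apply: (le_trans fj); apply: le_trans (nneseries_lim_ge j.+1 _); last by move=> k _ _; exact: phi0.
  by rewrite big_nat_recr//= leeDr// sume_ge0// => k _; exact: phi0.
rewrite integral_nneseries//; apply: lime_le.
  by apply: is_cvg_nneseries => j _ _; apply: integral_ge0 => x Dx; exact: phi0.
exact: nearW.
Qed.

End CountableCover.

Section DyadicIntegral.
Variable R : realType.

Lemma dyadic_between (x : R) : 1 <= x -> exists j, 2 ^+ j <= x < 2 ^+ j.+1.
Proof.
move=> x1; have x0 : 0 <= x := le_trans ler01 x1.
have /andP[n1 n2] := truncn_itv x0; set n := Num.truncn x in n1 n2.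
have n0 : (0 < n)%N by rewrite lt0n; apply: contraTneq n2 => ->; rewrite -leNgt.
have /andP[h1 h2] := trunc_log_bounds (isT : (1 < 2)%N) n0.
exists (trunc_log 2 n); apply/andP; split.
  by apply: le_trans n1; rewrite -natrX ler_nat.
by apply: (lt_le_trans n2); rewrite -natrX ler_nat.
Qed.

Variables (a b la H : R) (g : R -> \bar R).
Hypotheses (a0 : 0 < a) (b0 : 0 < b) (la0 : 0 < la) (H0 : 0 < H).
Hypothesis g0 : forall t : R, 0 < t -> (0 <= g t)%E.
Hypothesis g1 : forall t : R, 0 < t -> (g t <= (H * (la * t) `^ (- a))%:E)%E.
Hypothesis g2 : forall t : R, 0 < t -> (g t <= (H * (la * t) `^ b)%:E)%E.

(** Two geometric series, one over the dyadic intervals with [la t >= 1] and one over those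
    below. *)
Definition dyadic_const : R := (1 - 2 `^ (- a))^-1 + (1 - 2 `^ (- b))^-1.

Let pow2_lt1 (c : R) : 0 < c -> 0 < 2 `^ (- c) < 1.
Proof.
move=> c0; rewrite powR_gt0//= powRN invf_lt1 ?powR_gt0//.
by rewrite -[ltLHS](powRr0 2) /powR pnatr_eq0/= ltr_expR mul0r mulr_gt0// ln_gt0 ?ltr1n.
Qed.

Let pow2_inv_ge1 (c : R) : 0 < c -> 1 <= (1 - 2 `^ (- c))^-1.
Proof.
by move=> /pow2_lt1/andP[h1 h2]; rewrite invf_ge1 ?subr_gt0// gerBl ltW.
Qed.

Lemma dyadic_const_ge1 : 1 <= dyadic_const.
Proof.
by rewrite /dyadic_const -[leLHS]addr0 lerD ?pow2_inv_ge1// (le_trans ler01) ?pow2_inv_ge1.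
Qed.

Let pow2X (c : R) j : 0 <= 2 `^ (- c) -> (2 ^+ j) `^ (- c) = (2 `^ (- c)) ^+ j.
Proof. by move=> h; rewrite -!powR_mulrn// -!powRrM mulrC. Qed.

Lemma sup_bound (t : R) : 0 < t -> (g t <= H%:E)%E.
Proof.
move=> t0; have x0 : 0 < la * t by rewrite mulr_gt0.
case: (lerP 1 (la * t)) => x1.
  apply: (le_trans (g1 t0)); rewrite lee_fin ler_piMr ?(ltW H0)// powRN.
  by rewrite invf_le1 ?powR_gt0// -[leLHS](powRr0 (la * t)) ler_powR// ltW.
apply: (le_trans (g2 t0)); rewrite lee_fin ler_piMr ?(ltW H0)//.
by rewrite -[leRHS](powRr0 (la * t)) ger_powR ?x0 ?(ltW x1)// ltW.
Qed.

Local Notation I1 j := (`[2 ^+ j / la, 2 ^+ j.+1 / la[%classic : set R).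
Local Notation I2 j := (`](2 ^+ j.+1)^-1 / la, (2 ^+ j)^-1 / la]%classic : set R).

(** The half-line is cut at the points [2^j / la] with [j] of either sign. The bound [g1] serves
    [la t >= 1] and [g2] the rest; every piece has bounded mass for [dt/t], so geometric series
    remain. *)
Lemma dyadic_integral (th : R) : 1 <= th ->
  (\int[@lebesgue_measure R]_(t in `]0%R, +oo[%classic)
     (poweR (g t) th * (t^-1)%:E) <= (H `^ th * dyadic_const)%:E)%E.
Proof.
move=> th1; have th0 : 0 < th := lt_le_trans ltr01 th1.
have /andP[ua0 ua1] := pow2_lt1 a0; have /andP[ub0 ub1] := pow2_lt1 b0.
set ua := 2 `^ (- a) in ua0 ua1 *; set ub := 2 `^ (- b) in ub0 ub1 *.
pose Hth : R := H `^ th; have Hth0 : 0 <= Hth by exact: powR_ge0.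
(* The last factor of [c1 j] and of [c2 j] bounds [1/t] on the interval and is exactly the inverse
   of its length. *)
pose c1 j : R := Hth * ua ^+ j * (la / 2 ^+ j).
pose c2 j : R := Hth * ub ^+ j * (la * 2 ^+ j.+1).
have p2 j : (0 : R) < 2 ^+ j by rewrite exprn_gt0.
have c10 j : 0 <= c1 j by rewrite !mulr_ge0 ?exprn_ge0 ?invr_ge0 ?(ltW ua0) ?(ltW la0) ?(ltW (p2 _)).
have c20 j : 0 <= c2 j by rewrite !mulr_ge0 ?exprn_ge0 ?(ltW ub0) ?(ltW la0) ?(ltW (p2 _)).
pose phi j (t : R) : \bar R := ((c1 j)%:E * (\1_(I1 j) t)%:E + (c2 j)%:E * (\1_(I2 j) t)%:E)%E.
(* As [th >= 1] and [u < 1], removing the power from [u^j] only increases it; this keeps the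
   geometric series free of [th]. *)
have powth (x u : R) j : 0 < u < 1 -> 0 <= x -> x <= u ^+ j -> (H * x) `^ th <= Hth * u ^+ j.
  move=> /andP[u0 u1] x0 xu; rewrite powRM ?(ltW H0)// ler_wpM2l//.
  apply: (@le_trans _ _ ((u ^+ j) `^ th)).
    by rewrite ge0_ler_powR ?nnegrE ?exprn_ge0 ?(ltW u0) ?(ltW th0).
  by rewrite ge1r_powR ?exprn_gt0// exprn_ile1// ltW.
have gth (t B : R) : 0 < t -> (g t <= B%:E)%E -> 0 <= B -> (poweR (g t) th <= (B `^ th)%:E)%E.
  move=> t0 gB B0; rewrite -poweR_EFin; apply: gt0_ler_poweR; rewrite ?in_itv/= ?leey ?andbT//.
  - exact: ltW.
  - exact: g0.
apply: (@integral_le_cover _ _ R (@lebesgue_measure R) `]0%R, +oo[%classic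
  (fun t => poweR (g t) th * (t^-1)%:E)%E phi) => //.
- move=> t /=; rewrite in_itv/= andbT => t0.
  by rewrite mule_ge0 ?poweR_ge0// lee_fin invr_ge0 ltW.
- move=> j; apply: emeasurable_funD; apply: measurable_funeM; apply/measurable_EFinP.
    exact: measurable_funTS.
  exact: measurable_funTS.
- by move=> j t _; rewrite adde_ge0// mule_ge0 ?lee_fin.
- move=> t /=; rewrite in_itv/= andbT => t0; set x := la * t.
  have x0 : 0 < x by rewrite mulr_gt0.
  have tx : t = x / la by rewrite /x mulrC mulKf// gt_eqF.
  case: (lerP 1 x) => x1.
    have [j /andP[j1 j2]] := dyadic_between x1; exists j.
    have tI : t \in I1 j.
      by rewrite inE/= in_itv/= [t]tx ler_pM2r ?invr_gt0// ltr_pM2r ?invr_gt0// j1.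
    rewrite /phi !indicE tI mule1; apply: (@le_trans _ _ (c1 j)%:E); last first.
      by rewrite leeDl// mule_ge0 ?lee_fin.
    have xa : x `^ (- a) <= ua ^+ j.
      rewrite /ua -pow2X ?(ltW ua0)// !powRN lef_pV2 ?posrE ?powR_gt0//.
      by rewrite ge0_ler_powR ?nnegrE ?(ltW a0) ?(ltW x0) ?(ltW (p2 _)).
    rewrite [c1 j]/c1 EFinM; apply: lee_pmul; rewrite ?poweR_ge0// ?lee_fin ?invr_ge0 ?(ltW t0)//.
      apply: (le_trans (gth _ _ t0 (g1 t0) _)).
        by rewrite mulr_ge0 ?powR_ge0// ltW.
      by rewrite lee_fin; apply: powth xa; rewrite ?powR_ge0 ?ua0.
    by rewrite -[leRHS]invf_div lef_pV2 ?posrE ?divr_gt0// [t]tx ler_pM2r ?invr_gt0.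
  have [|j /andP[j1 j2]] := @dyadic_between x^-1; first by rewrite invf_ge1// ltW.
  exists j.
  have xj1 : x <= (2 ^+ j)^-1 by rewrite -[x]invrK lef_pV2 ?posrE ?invr_gt0.
  have xj2 : (2 ^+ j.+1)^-1 < x by rewrite -[x]invrK ltf_pV2 ?posrE ?invr_gt0.
  have tI : t \in I2 j.
    by rewrite inE/= in_itv/= [t]tx ltr_pM2r ?invr_gt0// ler_pM2r ?invr_gt0// xj2.
  rewrite /phi !indicE tI mule1; apply: (@le_trans _ _ (c2 j)%:E); last first.
    by rewrite leeDr// mule_ge0 ?lee_fin.
  have xb : x `^ b <= ub ^+ j.
    rewrite /ub -pow2X ?(ltW ub0)// powRN -powR_inv1 ?powR_ge0// -powRrM mulrC powRrM.
    rewrite powR_inv1 ?(ltW (p2 _))//.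
    by rewrite ge0_ler_powR ?nnegrE ?(ltW b0) ?(ltW x0) ?invr_ge0 ?(ltW (p2 _)).
  rewrite [c2 j]/c2 EFinM; apply: lee_pmul; rewrite ?poweR_ge0// ?lee_fin ?invr_ge0 ?(ltW t0)//.
    apply: (le_trans (gth _ _ t0 (g2 t0) _)).
      by rewrite mulr_ge0 ?powR_ge0// ltW.
    by rewrite lee_fin; apply: powth xb; rewrite ?powR_ge0 ?ub0.
  rewrite [t]tx invf_div ler_pM2l// -[leRHS]invrK lef_pV2 ?posrE ?invr_gt0//.
  exact: ltW.
move=> n.
have mI1 j : measurable (I1 j) by [].
have mI2 j : measurable (I2 j) by [].
have leI (A : set R) : measurable A ->
    (\int[@lebesgue_measure R]_(t in `]0%R, +oo[%classic) (\1_A t)%:E <= lebesgue_measure A)%E.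
  by move=> mA; rewrite integral_indic//; apply: le_measure; rewrite ?inE//; exact: measurableI.
have each j : (\int[@lebesgue_measure R]_(t in `]0%R, +oo[%classic) phi j t <=
    (Hth * ua ^+ j + Hth * ub ^+ j)%:E)%E.
  rewrite /phi ge0_integralD//; last 4 first.
  - by move=> t _; rewrite mule_ge0 ?lee_fin.
  - by apply: measurable_funeM; apply/measurable_EFinP; exact: measurable_funTS.
  - by move=> t _; rewrite mule_ge0 ?lee_fin.
  - by apply: measurable_funeM; apply/measurable_EFinP; exact: measurable_funTS.
  rewrite EFinD; apply: leeD.
    rewrite ge0_integralZl ?lee_fin//; last by apply/measurable_EFinP; exact: measurable_funTS.
    apply: (le_trans (lee_wpmul2l _ (leI _ (mI1 j)))); first by rewrite lee_fin.
    have lt1 : 2 ^+ j / la < 2 ^+ j.+1 / la.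
      by rewrite ltr_pM2r ?invr_gt0// exprS ltr_pMl// ltr1n.
    rewrite lebesgue_measure_itv/= lte_fin lt1 -EFinB -EFinM lee_fin le_eqVlt; apply/orP; left; apply/eqP.
    by rewrite /c1 exprS; field; rewrite !gt_eqF.
  rewrite ge0_integralZl ?lee_fin//; last by apply/measurable_EFinP; exact: measurable_funTS.
  apply: (le_trans (lee_wpmul2l _ (leI _ (mI2 j)))); first by rewrite lee_fin.
  have lt1 : (2 ^+ j.+1)^-1 / la < (2 ^+ j)^-1 / la.
    by rewrite ltr_pM2r ?invr_gt0// ltf_pV2 ?posrE// exprS ltr_pMl// ltr1n.
  rewrite lebesgue_measure_itv/= lte_fin lt1 -EFinB -EFinM lee_fin le_eqVlt; apply/orP; left; apply/eqP.
  by rewrite /c2 exprS; field; rewrite !gt_eqF.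
apply: (le_trans (lee_sum _ (fun j _ => each j))).
rewrite sumEFin lee_fin big_split/= -!mulr_sumr /dyadic_const mulrDr -/Hth -/ua -/ub.
have geo (u : R) : 0 < u < 1 -> \sum_(0 <= j < n) u ^+ j <= (1 - u)^-1.
  move=> /andP[u0 u1]; apply: (le_trans (sum_geometric_le _ _ _)); first by rewrite (ltW u0).
  by rewrite expr0 div1r.
by apply: lerD; rewrite ler_wpM2l// geo// ?ua0 ?ub0.
Qed.

End DyadicIntegral.

(** * The lower estimate *)

Section LowerBound.
Variable R : realType.
Variables (d : nat) (p q r : R) (theta : \bar R) (K : nat).
Hypotheses (d0 : (0 < d)%N) (p2 : 2 < p) (pq : p < q) (theta1 : (1 <= theta)%E).
Hypotheses (r0 : 0 < r) (rK : r < K%:R).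
Local Notation C := (complex.complex R).
Local Notation P := (torus_prob R d).
Local Notation G := (dyadic_const r (K%:R - r)).

Lemma cmeasurable_fdiffk (f : 'rV[R]_d -> C) h j : cmeasurable f -> cmeasurable (fdiffk j h f).
Proof.
move=> mf; elim: j => // j IH; rewrite /fdiffk iterS -/(fdiffk _ _ _).
by apply: cmeasurableB => //; exact: cmeasurable_shift.
Qed.

(** The modulus is at most [2^K A], which is useful for large [t] as [r > 0], and at most a multiple
    of [(la t)^K], useful for small [t] as [r < K]. These are the two bounds that [dyadic_integral]
    and [sup_bound] ask for. *)
Lemma besov_ball_diffbound (f : 'rV[R]_d -> C) (A la : R) : 0 < A -> 0 < la ->
  cmeasurable f -> Defs.periodic f -> (forall h, diffbound h A (la * enorm h) f) ->
  A + 2 ^+ K * A * la `^ r * G <= 1 -> besov_ball d r p theta K f.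
Proof.
move=> A0 la0 mf pf fA AG; have p0 : 0 < p by apply: lt_trans p2.
have fsup x : cabs (f x) <= A by have := fA 0 0%N x; rewrite expr0 mulr1.
have Lf : (Lpnorm p f <= A%:E)%E by apply: Lpnorm_bounded => //; exact: ltW.
split; first by split=> //; split=> //; apply: le_lt_trans Lf (ltry _).
pose H := 2 ^+ K * A * la `^ r.
have H0 : 0 < H by rewrite !mulr_gt0 ?exprn_gt0 ?powR_gt0.
have G1 : 1 <= G by apply: dyadic_const_ge1; rewrite ?subr_gt0.
suff : (besov_semi r p theta K f <= (H * G)%:E)%E.
  by move=> h; apply: (le_trans (leeD Lf h)); rewrite -EFinD lee_fin.
pose g (t : R) := ((t `^ (- r))%:E * modulus K p f t)%E.
have w1 (t : R) : 0 < t -> (modulus K p f t <= (2 ^+ K * A)%:E)%E.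
  move=> t0; apply: ge_ereal_sup => _ [h ht <-]; apply: Lpnorm_bounded => //.
  - by rewrite mulr_ge0 ?exprn_ge0// ltW.
  - exact: cmeasurable_fdiffk.
  - by move=> x; exact: cabs_fdiffk_le.
have w2 (t : R) : 0 < t -> (modulus K p f t <= (2 ^+ K * A * (la * t) ^+ K)%:E)%E.
  move=> t0; apply: ge_ereal_sup => _ [h /= ht <-]; apply: Lpnorm_bounded => //.
  - by rewrite !mulr_ge0 ?exprn_ge0 ?mulr_ge0// ltW.
  - exact: cmeasurable_fdiffk.
  (* The factor [2^K >= 1] is inserted so that both bounds share the constant [H]. *)
  - move=> x; apply: (le_trans (fA h K x)); rewrite -mulrA -[leLHS]mul1r ler_pM//.
    + by rewrite mulr_ge0 ?exprn_ge0 ?mulr_ge0 ?sqrtr_ge0// ltW.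
    + by rewrite exprn_ege1// ler1n.
    + rewrite ler_wpM2l ?(ltW A0)// lerXn2r ?nnegrE ?mulr_ge0 ?sqrtr_ge0 ?(ltW la0) ?(ltW t0)//.
      by rewrite ler_wpM2l// ltW.
have g0 (t : R) : 0 < t -> (0 <= g t)%E.
  by move=> t0; rewrite mule_ge0 ?lee_fin ?powR_ge0// modulus_ge0// ltW.
have lat (t : R) : 0 < t -> t `^ (- r) = la `^ r * (la * t) `^ (- r).
  move=> t0; rewrite powRM ?(ltW la0) ?(ltW t0)// mulrA -powRD ?subrr ?powRr0 ?mul1r//.
  by rewrite (gt_eqF la0) implybT.
have g1 (t : R) : 0 < t -> (g t <= (H * (la * t) `^ (- r))%:E)%E.
  move=> t0; apply: (le_trans (lee_wpmul2l _ (w1 t t0))); first by rewrite lee_fin powR_ge0.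
  by rewrite -EFinM lee_fin lat// /H le_eqVlt; apply/orP; left; apply/eqP; ring.
have g2 (t : R) : 0 < t -> (g t <= (H * (la * t) `^ (K%:R - r))%:E)%E.
  move=> t0; apply: (le_trans (lee_wpmul2l _ (w2 t t0))); first by rewrite lee_fin powR_ge0.
  have x0 : 0 < la * t by rewrite mulr_gt0.
  rewrite -EFinM lee_fin lat// /H powRD; last by rewrite (gt_eqF x0) implybT.
  by rewrite powR_mulrn ?(ltW x0)// le_eqVlt; apply/orP; left; apply/eqP; ring.
have Kr : 0 < K%:R - r by rewrite subr_gt0.
rewrite /besov_semi; case: theta theta1 => [th| |//].
  rewrite lee_fin => th1; have th0 : 0 < th := lt_le_trans ltr01 th1.
  have HG0 : 0 <= H * G by rewrite mulr_ge0 ?(ltW H0)// (le_trans ler01).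
  apply: poweR_inv_le => //.
    apply: integral_ge0 => t /=; rewrite in_itv/= andbT => t0.
    by rewrite mule_ge0 ?poweR_ge0// lee_fin invr_ge0 ltW.
  apply: (le_trans (dyadic_integral r0 Kr la0 H0 g0 g1 g2 th1)).
  rewrite lee_fin powRM ?(ltW H0)// ?(le_trans ler01 G1)// ler_wpM2l ?powR_ge0//.
  exact: le1r_powR.
move=> _; apply: ge_ereal_sup => _ [t + <-]; rewrite /= in_itv/= andbT => t0.
apply: (le_trans (sup_bound r0 Kr la0 H0 g1 g2 t0)).
by rewrite lee_fin ler_pMr.
Qed.

Section Extremal.
Variable n : nat.
Local Notation N := (2 ^ (d * n))%N.
Local Notation F := (rs_prod n : 'rV[R]_d -> C).

(** [Q] meets at most half of the spectrum; on the rest the block keeps the coefficient of [c0 F]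
    times a multiplier at least [2^(-d)]. Parseval's identity then bounds the mean square from
    below, which the [L_q] norm dominates as [q > 2]. *)
Lemma sigma_rs_prod_lower (c0 a : R) (Q : 'rV[R]_d -> C) m : (2 * m <= N)%N ->
  0 < a -> 2 * a ^+ 2 < (2^-1 ^+ d * c0) ^+ 2 * (N%:R / 2) -> mterm_polys d m Q ->
  (a%:E <= Lpnorm q (sigma_op n.+1 (fun x => rC c0 * F x - Q x)%R))%E.
Proof.
move=> mN a0 ac [ks [c [_ QE]]].
pose g x := rC c0 * F x - Q x.
pose tQ i (x : 'rV[R]_d) := c i * expk (ks i) x.
have iQ i : cintegrable (tQ i) by apply: cintegrableZ; exact: cintegrable_expk.
have Qi : cintegrable Q by rewrite QE; exact: cintegrable_sum iQ.
have Fi : cintegrable F by rewrite rs_prodE; exact: cintegrable_trigpoly.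
have cFi : cintegrable (fun x => rC c0 * F x) by exact: cintegrableZ.
have gi : cintegrable g.
  by apply: eq_cintegrable (cintegrableD cFi (cintegrableN Qi)).
have pg : Defs.periodic g.
  move=> x j; rewrite /g QE rs_prodE /trigpoly; congr (_ * _ - _).
    by apply: eq_bigr => k _; rewrite expk_periodic.
  by apply: eq_bigr => i _; rewrite expk_periodic.
pose ksq := [seq ks i | i : 'I_m].
have gc k : k \in rs_spectrum d n -> k \notin ksq -> fcoef g k = rC c0 * rs_prodcoef R n k.
  move=> kF kQ; rewrite /g fcoefB// fcoefZ// rs_prodE fcoef_trigpoly ?uniq_rs_spectrum// kF.
  have -> : fcoef Q k = 0.
    rewrite QE (fcoef_sum _ _ iQ) big1// => i _.
    rewrite fcoefZ; last exact: cintegrable_expk.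
    rewrite fcoef_expk; case: eqP => [E|_]; last by rewrite rC0 mulr0.
    by move: kQ; rewrite -E map_f ?mem_enum.
  by rewrite subr0.
pose c' k := rC (lam R n.+1 k) * fcoef g k.
have E x : sigma_op n.+1 g x = trigpoly (box d (2 ^ n.+2)) c' x.
  by rewrite (@sigma_opE R d (2 ^ n.+2)).
have ms : cmeasurable (sigma_op n.+1 g).
  rewrite (_ : sigma_op n.+1 g = trigpoly (box d (2 ^ n.+2)) c'); last exact/funext.
  exact: cintegrable_cmeasurable (cintegrable_trigpoly _ _).
(* By contradiction: an [L_q] norm at most [a] would force a mean square at most [2 a^2], below the
   Parseval sum. *)
rewrite leNgt; apply/negP => /ltW la.
have q2 : 2 <= q by apply: ltW; apply: lt_trans pq.
have := sqnorm_integral_le q2 a0 ms la.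
under eq_integral do rewrite E.
rewrite parseval_trigpoly ?uniq_box// lee_fin leNgt => /negP; apply; apply: (lt_le_trans ac).
pose sp := [seq k <- rs_spectrum d n | k \notin ksq].
have usp : uniq sp by rewrite filter_uniq// uniq_rs_spectrum.
have spbox k : k \in sp -> k \in box d (2 ^ n.+2).
  rewrite mem_filter mem_box => /andP[_ /(rs_spectrum_nrm d0)/andP[_ h]].
  by apply: (leq_trans h); rewrite !expnS mulnA leq_mul2r orbT.
have lamk k : k \in sp -> 2^-1 ^+ d <= lam R n.+1 k.
  rewrite mem_filter => /andP[_ /(rs_spectrum_nrm d0)/andP[h1 h2]].
  (* The norms in the spectrum are at least [2^(n+1)], where the smaller kernel vanishes, so only
     the larger one counts. *)
  rewrite /lam (@vpW0 R d (2 ^ n)) ?expn_gt0 -?expnS// subr0.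
  apply: vpW_ge_half; first by rewrite expn_gt0.
  by rewrite expnS mulnCA leq_mul2l.
have spN : N%:R / 2 <= (size sp)%:R :> R.
  have : (N <= size sp + m)%N.
    rewrite -size_rs_spectrum -[X in (_ <= _ + X)%N]card_ord -(size_image ks 'I_m) -size_cat.
    apply: uniq_leq_size; first exact: uniq_rs_spectrum.
    by move=> k kF; rewrite mem_cat mem_filter kF andbT orNb.
  rewrite ler_pdivrMr// -natrM ler_nat; move: mN; move: (2 ^ _)%N => X; clear; lia.
apply: (@le_trans _ _ (\sum_(k <- sp) (2^-1 ^+ d * c0) ^+ 2)).
  by rewrite big_const_seq count_predT iter_addr_0 -[leRHS]mulr_natr ler_wpM2l ?sqr_ge0.
apply: (@le_trans _ _ (\sum_(k <- sp) sqnorm (c' k))).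
  rewrite big_seq [leRHS]big_seq; apply: ler_sum => k ksp.
  have := ksp; rewrite mem_filter => /andP[kQ kF].
  rewrite /c' gc// !sqnormM !sqnorm_rC sqnorm_rs_prodcoef mulr1 exprMn ler_wpM2r ?sqr_ge0//.
  have := lamk _ ksp; have l0 : (0 : R) <= 2^-1 ^+ d by rewrite exprn_ge0// invr_ge0.
  by move=> hl; rewrite lerXn2r ?nnegrE// (le_trans l0).
rewrite (perm_big [seq k <- box d (2 ^ n.+2) | k \in sp])/=; last first.
  apply: uniq_perm => //; first by rewrite filter_uniq// uniq_box.
  by move=> k; rewrite [RHS]mem_filter andb_idr//; exact: spbox.
rewrite big_filter [leRHS](bigID (fun k => k \in sp))/= lerDl sumr_ge0// => k _.
exact: sqnorm_ge0.
Qed.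

End Extremal.

Lemma lower_bound : exists2 C1 : R, 0 < C1 & forall m : nat, (1 <= m)%N ->
  ((C1 * (m%:R `^ (- (r / d%:R))))%:E <= best_mterm_class m q (besov_ball d r p theta K))%E.
Proof.
have dR : (0 : R) < d%:R by rewrite ltr0n.
have Kr : 0 < K%:R - r by rewrite subr_gt0.
have G1 : 1 <= G by exact: dyadic_const_ge1.
pose G' : R := 1 + 2 ^+ K * G.
have G'0 : 0 < G' by rewrite ltr_pwDl// mulr_ge0 ?exprn_ge0// (le_trans ler01).
pose s2 : R := Num.sqrt 2 ^+ d.
have s20 : 0 < s2 by rewrite exprn_gt0// sqrtr_gt0.
pose hd : R := 2^-1 ^+ d; have hd0 : 0 < hd by rewrite exprn_gt0// invr_gt0.
pose D8 : R := (d%:R * 8) `^ r; have D80 : 0 < D8 by rewrite powR_gt0// mulr_gt0.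
pose E2 : R := (2 * 2 ^ d)%:R `^ (r / d%:R).
have E20 : 0 < E2 by rewrite powR_gt0// ltr0n muln_gt0 expn_gt0.
exists (hd / 4 / (s2 * (D8 * E2) * G')).
  by rewrite !divr_gt0// mulr_gt0// mulr_gt0// mulr_gt0.
(* This choice gives [2m <= 2^(dn) <= 2 2^d m]: enough spectrum to survive [m] deletions, yet of the
   order of [m]. *)
move=> m m1; pose n0 := trunc_log (2 ^ d) (2 * m); pose n := n0.+1.
have d2 : (1 < 2 ^ d)%N by rewrite -{1}(expn0 2) ltn_exp2l.
have m2 : (0 < 2 * m)%N by rewrite muln_gt0.
have /andP[hn1 hn2] := trunc_log_bounds d2 m2.
have mN : (2 * m <= 2 ^ (d * n))%N by rewrite expnM ltnW.
have Nm : (2 ^ (d * n) <= 2 * 2 ^ d * m)%N 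
  by rewrite expnM expnS [(2 * 2 ^ d)%N]mulnC -mulnA leq_mul2l hn1 orbT.
pose la : R := d%:R * 2 ^+ n.+3.
have la1 : 1 <= la by rewrite /la -natrX -natrM ler1n muln_gt0 d0 expn_gt0.
have la0 : 0 < la := lt_le_trans ltr01 la1.
have lar0 : 0 < la `^ r by rewrite powR_gt0.
pose AF : R := Num.sqrt (2 ^+ n.+1) ^+ d.
have AF0 : 0 < AF by rewrite exprn_gt0// sqrtr_gt0 exprn_gt0.
(* Normalisation into the unit ball: with sup norm at most [AF] and difference rate [la], the Besov
   norm is at most of order [AF la^r]. *)
pose c0 : R := (AF * la `^ r * G')^-1.
have c00 : 0 < c0 by rewrite invr_gt0 !mulr_gt0.
pose sn : R := Num.sqrt (2 ^+ n) ^+ d.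
have sn0 : 0 < sn by rewrite exprn_gt0// sqrtr_gt0 exprn_gt0.
have AFE : AF = s2 * sn by rewrite /AF /s2 /sn exprS sqrtrM// exprMn.
have snN : sn ^+ 2 = (2 ^ (d * n))%:R.
  by rewrite /sn -exprM mulnC exprM sqr_sqrtr ?exprn_ge0// -exprM natrX mulnC.
pose f (x : 'rV[R]_d) : C := rC c0 * rs_prod n x.
have Fi : cintegrable (rs_prod n : 'rV[R]_d -> C) by rewrite rs_prodE; exact: cintegrable_trigpoly.
have fB : besov_ball d r p theta K f.
  apply: (@besov_ball_diffbound f (c0 * AF) la) => //.
  - exact: mulr_gt0.
  - exact: cintegrable_cmeasurable (cintegrableZ _ Fi).
  - move=> x j; rewrite /f rs_prodE /trigpoly; congr (_ * _).
    by apply: eq_bigr => k _; rewrite expk_periodic.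
  - move=> h j x; rewrite fdiffkZ cabsM cabs_rC gtr0_norm// -mulrA ler_wpM2l ?(ltW c00)//.
    exact: diffbound_rs_prod.
  - have E : c0 * AF * la `^ r * G' = 1.
      by rewrite /c0; field; rewrite !gt_eqF.
    apply: (@le_trans _ _ (c0 * AF * la `^ r + 2 ^+ K * (c0 * AF) * la `^ r * G)); last first.
      by rewrite le_eqVlt; apply/orP; left; apply/eqP; apply: etrans E; rewrite /G'; ring.
    rewrite lerD2r ler_peMr ?mulr_ge0 ?(ltW c00) ?(ltW AF0)//.
    by rewrite -[leLHS](powRr0 la) ler_powR// ltW.
apply: (@le_trans _ _ (best_mterm m q f)); last by apply: ereal_sup_ubound; exists f.
apply: le_ereal_inf_tmp => _ [Q Qm <-].
(* As [sn^2] is the number of frequencies, [a] is up to a constant the quadratic mean of what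
   survives; with the divisor 4 the required strict inequality amounts to [1/8 < 1/2]. *)
pose a : R := hd * c0 * sn / 4.
have a0 : 0 < a by rewrite divr_gt0// mulr_gt0// mulr_gt0.
have La : (a%:E <= Lpnorm q (sigma_op n.+1 (fun x => f x - Q x)%R))%E.
  apply: sigma_rs_prod_lower mN a0 _ Qm; rewrite -snN -/hd.
  have -> : 2 * a ^+ 2 = (hd * c0) ^+ 2 * (sn ^+ 2 / 8) by rewrite /a; field.
  rewrite ltr_pM2l ?exprn_gt0 ?mulr_gt0// ltr_pM2l ?exprn_gt0// ltf_pV2 ?posrE//.
  by rewrite ltr_nat.
apply: (@le_trans _ _ a%:E).
  have mr0 : 0 < m%:R `^ (r / d%:R) :> R by rewrite powR_gt0// ltr0n.
  have laE : la `^ r <= D8 * (E2 * m%:R `^ (r / d%:R)).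
    have -> : la = d%:R * 8 * 2 ^+ n by rewrite /la !(exprS 2); ring.
    rewrite powRM ?mulr_ge0 ?exprn_ge0 ?(ltW dR)// ler_wpM2l ?(ltW D80)//.
    have -> : (2 ^+ n) `^ r = (2 ^ (d * n))%:R `^ (r / d%:R) :> R.
      rewrite natrX -!powR_mulrn// -!powRrM natrM; congr (_ `^ _).
      by field; rewrite gt_eqF.
    rewrite -powRM ?ler0n// ge0_ler_powR ?nnegrE ?mulr_ge0 ?ler0n// ?divr_ge0 ?(ltW r0)//.
    by rewrite -natrM ler_nat.
  rewrite lee_fin.
  (* Flatness at work: [AF = s2 sn], so the sup norm hidden in [c0] cancels [sn] and only [la^r], of
     order [m^(r/d)], remains. *)
  have -> : a = hd / 4 / (s2 * la `^ r * G').
    by rewrite /a /c0 AFE; field; rewrite !gt_eqF.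
  rewrite -mulrA ler_wpM2l ?divr_ge0 ?(ltW hd0)// powRN -invfM lef_pV2 ?posrE ?mulr_gt0//.
  have -> : s2 * (D8 * E2) * G' * m%:R `^ (r / d%:R) = s2 * (D8 * (E2 * m%:R `^ (r / d%:R))) * G' by ring.
  by rewrite ler_pM2r// ler_pM2l.
(* Outside [L_q] the norm is infinite; inside, the single block [n.+1] of the sum is enough. *)
apply: (le_trans La); rewrite /Bq1norm; case: asboolP => [_|_]; last exact: leey.
apply: le_trans (nneseries_lim_ge n.+2 _); last by move=> t _ _; exact: Lpnorm_ge0.
by rewrite big_nat_recr//= leeDr// sume_ge0// => t _; exact: Lpnorm_ge0.
Qed.

End LowerBound.

Theorem theorem2 (R : realType) (d : nat) (p q r : R) (theta : \bar R) (k : nat) :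
  (1 <= d)%N -> 2 < p -> p < q -> (1 <= theta)%E ->
  d%:R / 2 < r -> r < k%:R ->
  exists C1 C2 : R, 0 < C1 /\ 0 < C2 /\
    forall m : nat, (1 <= m)%N ->
      ((C1 * (m%:R `^ (- (r / d%:R))))%:E
         <= best_mterm_class m q (besov_ball d r p theta k))%E /\
      (best_mterm_class m q (besov_ball d r p theta k)
         <= (C2 * (m%:R `^ (- (r / d%:R))))%:E)%E.
Proof.
move=> d0 p2 pq theta1 rd rk.
have r0 : 0 < r by apply: le_lt_trans rd; rewrite divr_ge0.
have [C1 C10 lower] := lower_bound d0 p2 pq theta1 r0 rk.
have [C2 C20 upper] := upper_bound k d0 p2 pq theta1 rd.
by exists C1, C2; split=> //; split=> // m m1; split; [exact: lower|exact: upper].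
Qed.
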